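(* Let $f$ be a nonconstant polynomial with real coefficients, and let $u\in C(\mathbb R;H^1(\mathbb T;\mathbb R))$ be a solution of $$(1-\partial_x^2)u_t+\partial_xf(u)=0\qquad\text{on }\mathbb T\times\mathbb R .$$ Let $\psi(\cdot,t)=(1-\partial_x^2)^{-1}f(u(\cdot,t))$. (i) If $u=C$ on $\omega\times(0,T)$ for some $C\in\mathbb R$, some nonempty open $\omega\subset\mathbb T$ and some $T>0$, then $u\equiv C$ on $\mathbb T\times\mathbb R$. (ii) More generally, if for some $x_0\in\mathbb T$, $C\in\mathbb R$ and $T>0$ one has $u(x_0,t)=C$ and $\psi(x_0,t)=f(C)$ for all $t\in(0,T)$, then $u\equiv C$ on $\mathbb T\times\mathbb R$.
   Context: $\mathbb T=\mathbb R/(2\pi\mathbb Z)$. A solution $u\in C(\mathbb R;H^1(\mathbb T;\mathbb R))$ is understood in the sense of distributions; equivalently, $u\in C^1(\mathbb R;H^1(\mathbb T))$ and $u_t=-\psi_x$ for all $t$. $(1-\partial_x^2)^{-1}$ is the Fourier multiplier $(1+k^2)^{-1}$, $k\in\mathbb Z$. Point values refer to continuous representatives. *)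

(* Defs.v *)
(* Stdlib real numbers and Coquelicot. *)
From Stdlib Require Export Reals ZArith.
From Coquelicot Require Export Coquelicot.
Open Scope R_scope.

(* The torus is R / 2 pi Z: functions on it are 2 pi-periodic functions on R,
   and subsets of it are 2 pi-invariant subsets of R. *)
Definition periodic (g : R -> R) : Prop :=
  forall x, g (x + 2 * PI) = g x.

Definition periodic_set (A : R -> Prop) : Prop :=
  forall x, A (x + 2 * PI) <-> A x.

Definition nonconstant_polynomial (f : R -> R) : Prop :=
  exists (n : nat) (a : nat -> R),
    (0 < n)%nat /\ a n <> 0 /\
    forall x, f x = sum_f_R0 (fun i => a i * x ^ i) n.

(* Summation over Z. It is used below only for absolutely convergent series or
   nonnegative terms, so grouping k with - k is harmless. *)
Definition fold_Z (a : Z -> R) (n : nat) : R :=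
  a (Z.of_nat (S n)) + a (- Z.of_nat (S n))%Z.

Definition summable_Z (a : Z -> R) : Prop := ex_series (fold_Z a).

Definition sum_Z (a : Z -> R) : R := a 0%Z + Series (fold_Z a).

Definition expi (theta : R) : C := (cos theta, sin theta).

(* (1 / 2 pi) * integral of g(x) exp(- i k x) over [0, 2 pi], for real g. *)
Definition fourier_coeff (g : R -> R) (k : Z) : C :=
  (RInt (fun x => g x * cos (IZR k * x)) 0 (2 * PI) / (2 * PI),
   - RInt (fun x => g x * sin (IZR k * x)) 0 (2 * PI) / (2 * PI)).

Definition H1_weight (g : R -> R) (k : Z) : R :=
  (1 + IZR k ^ 2) * Cmod (fourier_coeff g k) ^ 2.

(* Every class in H^1 of the torus has exactly one continuous representative;
   elements of H^1 are identified with these representatives. *)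
Definition in_H1 (g : R -> R) : Prop :=
  periodic g /\ (forall x, continuous g x) /\ summable_Z (H1_weight g).

Definition H1_norm (g : R -> R) : R := sqrt (sum_Z (H1_weight g)).

(* Functions of space and time take the space variable first. *)
Definition continuous_in_H1 (u : R -> R -> R) : Prop :=
  (forall t, in_H1 (fun x => u x t)) /\
  (forall t0, is_lim (fun t => H1_norm (fun x => u x t - u x t0)) t0 0).

(* (1 - d_x^2)^{-1} g as a Fourier series. For real g the terms k and - k are
   complex conjugate, so only real parts survive in the sum. *)
Definition helmholtz_inv (g : R -> R) (x : R) : R :=
  sum_Z (fun k =>
    Re (Cmult (fourier_coeff g k) (expi (IZR k * x))) / (1 + IZR k ^ 2)).

(* Smooth functions on torus x R vanishing for |t| >= M. *)
Definition test_function (M : R) (phi : R -> R -> R) : Prop :=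
  (forall n x t, ex_diff_n phi n x t) /\
  (forall t, periodic (fun x => phi x t)) /\
  (forall x t, M <= Rabs t -> phi x t = 0).

(* (1 - d_x^2) u_t + d_x f(u) = 0 in the sense of distributions: all derivatives
   are moved to phi, with the common factor - 1 dropped. In partial_derive m k
   the order in x is m and the order in t is k. The integrand is continuous when
   u is in C(R; H^1), so the iterated Riemann integral is the integral over
   torus x R. *)
Definition distributional_solution (f : R -> R) (u : R -> R -> R) : Prop :=
  forall (M : R) (phi : R -> R -> R),
    test_function M phi ->
    RInt (fun t =>
      RInt (fun x =>
          u x t * (partial_derive 0 1 phi x t - partial_derive 2 1 phi x t)
          + f (u x t) * partial_derive 1 0 phi x t)
        0 (2 * PI))
      (- M) M = 0.

(* Main.v *)
(* Writing phi = psi - f(C), the equation is u_t = - phi_x with phi - phi_xx = f(u) - f(C).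
   The H^1 norm is conserved, so u is bounded on the torus x R and equicontinuous in x uniformly in t. Being an ODE with polynomial nonlinearity in C(T), the equation makes u and psi real analytic in t with a uniform radius, so u(x0,t) = C and psi(x0,t) = f(C) persist for all real t; then also phi_x(x0,t) = 0.
   On [x0, x0 + 1/2] the functional E = int (x0 + 1/2 - x) G(u) dx, with G' = f - f(C) and G(C) = 0, satisfies E' = (1/2) int (phi_x^2 - phi^2) >= (3/8) int phi_x^2 by Poincare. As E is bounded, int phi_x^2 becomes arbitrarily small along times tending to +oo and to -oo; there f(u) - f(C) = phi - phi_xx is uniformly small by equicontinuity, hence so is u - C, hence E. By monotonicity E = 0, so phi_x = 0 and u = C on the interval, and one moves on to x0 + 1/2.
   Part (i) reduces to part (ii): u_t = 0 near x0 gives psi_x = 0 there, hence psi = f(u) = f(C). *)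
Require Import Defs.
From Stdlib Require Import Lra Lia Classical FunctionalExtensionality.

(** The functional comes from - phi_x (phi - phi_xx) = (1/2) (phi_x^2 - phi^2)_x: G is chosen so
    that E' integrates the weight against an exact derivative. The weight vanishes at the right end
    and phi = phi_x = 0 at x0, so no boundary term survives. Poincare on length 1/2 gives int phi^2
    <= (1/4) int phi_x^2, whence 3/8 = (1/2) (1 - 1/4). Monotonicity must be squeezed from both time
    directions, so the data at x0 are continued to all real times before any step in space.
    Smallness of int phi_x^2 controls phi and phi_x but not phi_xx, which is reached only through
    difference quotients of phi_x; equicontinuity of u makes up for that. Also f - f(C) may vanish
    away from C, but its zeros are isolated, so continuity in x from the value C at x0 keeps u near
    C. The solution is merely distributional: u_t = - psi_x is recovered mode by mode from the
    uniqueness of Fourier coefficients, and psi is rewritten by a Green formula whose sup norm bound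
    1 drives the analytic majorant. *)

(** * Continuity, derivatives and integrals of real functions *)

Lemma cont_const (c x : R) : continuous (fun _ : R => c) x.
Proof. apply continuous_const. Qed.
Lemma cont_id (x : R) : continuous (fun y : R => y) x.
Proof. apply continuous_id. Qed.
Lemma cont_plus (f g : R -> R) (x : R) :
  continuous f x -> continuous g x -> continuous (fun y => f y + g y) x.
Proof. intros Hf Hg. now apply (continuous_plus f g x). Qed.
Lemma cont_opp (f : R -> R) (x : R) :
  continuous f x -> continuous (fun y => - f y) x.
Proof. intros Hf. now apply (continuous_opp f x). Qed.
Lemma cont_minus (f g : R -> R) (x : R) :
  continuous f x -> continuous g x -> continuous (fun y => f y - g y) x.
Proof. intros Hf Hg. now apply (continuous_minus f g x). Qed.
Lemma cont_mult (f g : R -> R) (x : R) :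
  continuous f x -> continuous g x -> continuous (fun y => f y * g y) x.
Proof. intros Hf Hg. now apply (continuous_mult f g x). Qed.
Lemma cont_div (f : R -> R) (c x : R) :
  continuous f x -> continuous (fun y => f y / c) x.
Proof. intros Hf. apply cont_mult; [exact Hf | apply cont_const]. Qed.
Lemma cont_comp (f g : R -> R) (x : R) :
  continuous f x -> continuous g (f x) -> continuous (fun y => g (f y)) x.
Proof. intros Hf Hg. now apply (continuous_comp f g x). Qed.
Lemma cont_pow (f : R -> R) (n : nat) (x : R) :
  continuous f x -> continuous (fun y => f y ^ n) x.
Proof.
  intros Hf; induction n as [|n IH]; simpl.
  - apply cont_const.
  - now apply cont_mult.
Qed.
Lemma derive_cont (f : R -> R) (x l : R) : is_derive f x l -> continuous f x.
Proof. intros H. apply (ex_derive_continuous f x). now exists l. Qed.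
Lemma cont_cos (f : R -> R) (x : R) :
  continuous f x -> continuous (fun y => cos (f y)) x.
Proof. intros H. apply cont_comp; [exact H|]. apply continuous_cos. Qed.
Lemma cont_sin (f : R -> R) (x : R) :
  continuous f x -> continuous (fun y => sin (f y)) x.
Proof. intros H. apply cont_comp; [exact H|]. apply continuous_sin. Qed.
Lemma cont_exp (f : R -> R) (x : R) :
  continuous f x -> continuous (fun y => exp (f y)) x.
Proof. intros H. apply cont_comp; [exact H|]. apply continuous_exp. Qed.
Lemma cont_abs (f : R -> R) (x : R) :
  continuous f x -> continuous (fun y => Rabs (f y)) x.
Proof. intros H. apply cont_comp; [exact H|]. apply continuous_Rabs. Qed.
Lemma cont_sum (f : nat -> R -> R) (n : nat) (x : R) :
  (forall i, (i <= n)%nat -> continuous (f i) x) ->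
  continuous (fun y => sum_f_R0 (fun i => f i y) n) x.
Proof.
  induction n as [|n IH]; intros H; simpl.
  - now apply H.
  - apply cont_plus; [apply IH; intros; apply H; lia | now apply H].
Qed.

Create HintDb cont.
#[export] Hint Resolve cont_const cont_id cont_plus cont_opp cont_minus cont_mult
  cont_div cont_pow cont_cos cont_sin cont_exp cont_abs : cont.
Ltac cont := intros; auto 12 with cont.

Lemma continuous_eps (f : R -> R) (x : R) :
  (forall eps, 0 < eps ->
     exists d, 0 < d /\ forall y, Rabs (y - x) < d -> Rabs (f y - f x) <= eps) ->
  continuous f x.
Proof.
  intros H. apply continuity_pt_filterlim. intros eps He.
  destruct (H (eps / 2)) as [d [Hd Hy]]; [lra|].
  exists d. split; [exact Hd|]. intros y [_ Hyd]. simpl in *. unfold R_dist in *.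
  specialize (Hy y Hyd). lra.
Qed.

Lemma eps_continuous (f : R -> R) (x eps : R) :
  continuous f x -> 0 < eps ->
  exists d, 0 < d /\ forall y, Rabs (y - x) < d -> Rabs (f y - f x) < eps.
Proof.
  intros H He. apply continuity_pt_filterlim in H.
  destruct (H eps He) as [d [Hd Hy]]. exists d. split; [exact Hd|].
  intros y Hyd. destruct (Req_dec y x) as [->|Hn].
  - now rewrite Rminus_diag, Rabs_R0.
  - apply Hy. simpl. unfold R_dist, D_x, no_cond. auto.
Qed.

Lemma is_derive_eq (f : R -> R) (x l l' : R) :
  is_derive f x l -> l = l' -> is_derive f x l'.
Proof. now intros H <-. Qed.
Lemma der_const (c x : R) : is_derive (fun _ : R => c) x 0.
Proof. apply (is_derive_const c x). Qed.
Lemma der_id (x : R) : is_derive (fun y : R => y) x 1.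
Proof. apply (is_derive_id x). Qed.
Lemma der_plus (f g : R -> R) (x l m : R) :
  is_derive f x l -> is_derive g x m -> is_derive (fun y => f y + g y) x (l + m).
Proof. intros Hf Hg. now apply (is_derive_plus f g x l m). Qed.
Lemma der_opp (f : R -> R) (x l : R) :
  is_derive f x l -> is_derive (fun y => - f y) x (- l).
Proof. intros Hf. now apply (is_derive_opp f x l). Qed.
Lemma der_minus (f g : R -> R) (x l m : R) :
  is_derive f x l -> is_derive g x m -> is_derive (fun y => f y - g y) x (l - m).
Proof. intros Hf Hg. now apply (is_derive_minus f g x l m). Qed.
Lemma der_mult (f g : R -> R) (x l m : R) :
  is_derive f x l -> is_derive g x m ->
  is_derive (fun y => f y * g y) x (l * g x + f x * m).
Proof.
  intros Hf Hg. apply (is_derive_mult f g x l m); auto.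
  intros; apply Rmult_comm.
Qed.
Lemma der_div (f : R -> R) (c x l : R) :
  is_derive f x l -> is_derive (fun y => f y / c) x (l / c).
Proof.
  intros Hf. eapply is_derive_eq; [apply der_mult; [exact Hf | apply der_const]|].
  simpl. unfold Rdiv. ring.
Qed.
Lemma der_comp (f g : R -> R) (x l m : R) :
  is_derive f x l -> is_derive g (f x) m -> is_derive (fun y => g (f y)) x (l * m).
Proof. intros Hf Hg. now apply (is_derive_comp g f x m l). Qed.
Lemma der_cos (f : R -> R) (x l : R) :
  is_derive f x l -> is_derive (fun y => cos (f y)) x (l * - sin (f x)).
Proof. intros H. apply der_comp; [exact H | apply is_derive_cos]. Qed.
Lemma der_sin (f : R -> R) (x l : R) :
  is_derive f x l -> is_derive (fun y => sin (f y)) x (l * cos (f x)).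
Proof. intros H. apply der_comp; [exact H | apply is_derive_sin]. Qed.
Lemma der_exp (f : R -> R) (x l : R) :
  is_derive f x l -> is_derive (fun y => exp (f y)) x (l * exp (f x)).
Proof. intros H. apply der_comp; [exact H | apply is_derive_exp]. Qed.
Lemma der_sum (f df : nat -> R -> R) (n : nat) (x : R) :
  (forall i, (i <= n)%nat -> is_derive (f i) x (df i x)) ->
  is_derive (fun y => sum_f_R0 (fun i => f i y) n) x (sum_f_R0 (fun i => df i x) n).
Proof.
  induction n as [|n IH]; intros H; simpl.
  - now apply H.
  - apply der_plus; [apply IH; intros; apply H; lia | now apply H].
Qed.

(* Equalities arising from RInt and is_derive live in the carrier of a Coquelicot structure, on which ring and field fail. *)
Ltac to_R := cbv beta; match goal with |- ?a = ?b => change (@eq R a b) end.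
Ltac rring := to_R; ring.
Ltac rfield := to_R; field.
Ltac der_step :=
  lazymatch goal with |- is_derive ?F _ _ =>
  lazymatch F with
  | fun y => y => apply der_id
  | fun _ => ?c => apply (der_const c)
  | fun y => @?f y + @?g y => apply (der_plus f g)
  | fun y => @?f y - @?g y => apply (der_minus f g)
  | fun y => @?f y / ?c => apply (der_div f c)
  | fun y => @?f y * @?g y => apply (der_mult f g)
  | fun y => - @?f y => apply (der_opp f)
  | fun y => cos (@?f y) => apply (der_cos f)
  | fun y => sin (@?f y) => apply (der_sin f)
  | fun y => exp (@?f y) => apply (der_exp f)
  | _ => solve [eauto 2]
  end end.
Ltac der := eapply is_derive_eq;
  [repeat der_step | match goal with |- ?a = ?b => change (@eq R a b); cbv beta end].

Lemma is_derive_eps (f : R -> R) (x l : R) :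
  (forall eps, 0 < eps -> exists d, 0 < d /\
     forall h, Rabs h < d -> Rabs (f (x + h) - f x - h * l) <= eps * Rabs h) ->
  is_derive f x l.
Proof.
  intros H. apply is_derive_Reals. intros eps He.
  destruct (H (eps / 2)) as [d [Hd Hh]]; [lra|].
  exists (mkposreal d Hd). intros h Hn Hhd. simpl in Hhd.
  replace ((f (x + h) - f x) / h - l) with ((f (x + h) - f x - h * l) / h)
    by (field; exact Hn).
  unfold Rdiv. rewrite Rabs_mult, Rabs_inv.
  assert (Hp : 0 < Rabs h) by now apply Rabs_pos_lt.
  apply Rmult_lt_reg_r with (Rabs h); [exact Hp|].
  rewrite Rmult_assoc, Rinv_l, Rmult_1_r by lra.
  specialize (Hh h Hhd). nra.
Qed.

Lemma is_derive_ext_near (f g : R -> R) (x l d : R) : 0 < d ->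
  (forall y, Rabs (y - x) < d -> f y = g y) -> is_derive f x l -> is_derive g x l.
Proof.
  intros Hd H. apply is_derive_ext_loc. exists (mkposreal d Hd). intros y Hy. now apply H.
Qed.

Lemma MVT_is_derive (f df : R -> R) (a b : R) :
  (forall x, Rmin a b <= x <= Rmax a b -> is_derive f x (df x)) ->
  exists c, Rmin a b <= c <= Rmax a b /\ f b - f a = df c * (b - a).
Proof.
  intros H. apply MVT_gen.
  - intros x Hx. apply H. lra.
  - intros x Hx. apply continuity_pt_filterlim. apply (derive_cont f x (df x)), H, Hx.
Qed.

Lemma derive_zero_const (f : R -> R) (a b : R) :
  (forall x, Rmin a b <= x <= Rmax a b -> is_derive f x 0) -> f a = f b.
Proof.
  intros H. destruct (MVT_is_derive f (fun _ => 0) a b H) as [c [_ Hc]]. lra.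
Qed.

Lemma derive_nonneg_le (f df : R -> R) (a b : R) :
  a <= b -> (forall x, a <= x <= b -> is_derive f x (df x)) ->
  (forall x, a <= x <= b -> 0 <= df x) -> f a <= f b.
Proof.
  intros Hab H H0. destruct (MVT_is_derive f df a b) as [c [Hc E]].
  - intros x Hx. apply H. rewrite Rmin_left, Rmax_right in Hx; lra.
  - rewrite Rmin_left, Rmax_right in Hc by lra. specialize (H0 c Hc). nra.
Qed.

Lemma ex_RInt_cont (f : R -> R) (a b : R) :
  (forall x, continuous f x) -> ex_RInt f a b.
Proof. intros H. apply (@ex_RInt_continuous R_CompleteNormedModule). intros; apply H. Qed.

Lemma RInt_add (f g : R -> R) (a b : R) :
  (forall x, continuous f x) -> (forall x, continuous g x) ->
  RInt (fun x => f x + g x) a b = RInt f a b + RInt g a b.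
Proof. intros Hf Hg. apply (RInt_plus f g a b); now apply ex_RInt_cont. Qed.
Lemma RInt_sub (f g : R -> R) (a b : R) :
  (forall x, continuous f x) -> (forall x, continuous g x) ->
  RInt (fun x => f x - g x) a b = RInt f a b - RInt g a b.
Proof. intros Hf Hg. apply (RInt_minus f g a b); now apply ex_RInt_cont. Qed.
Lemma RInt_scale (f : R -> R) (c a b : R) :
  (forall x, continuous f x) -> RInt (fun x => c * f x) a b = c * RInt f a b.
Proof. intros Hf. apply (RInt_scal f a b c); now apply ex_RInt_cont. Qed.
Lemma RInt_eq (f g : R -> R) (a b : R) :
  (forall x, f x = g x) -> RInt f a b = RInt g a b.
Proof. intros H. apply (@RInt_ext R_CompleteNormedModule). intros; apply H. Qed.
Lemma RInt_split (f : R -> R) (a b c : R) :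
  (forall x, continuous f x) -> RInt f a c = RInt f a b + RInt f b c.
Proof. intros Hf. symmetry. apply (RInt_Chasles f a b c); now apply ex_RInt_cont. Qed.
Lemma RInt_same (f : R -> R) (a : R) : RInt f a a = 0.
Proof. apply (RInt_point a f). Qed.
Lemma RInt_antideriv (f df : R -> R) (a b : R) :
  (forall x, is_derive f x (df x)) -> (forall x, continuous df x) ->
  RInt df a b = f b - f a.
Proof.
  intros H Hc. apply (@is_RInt_unique R_CompleteNormedModule).
  apply (@is_RInt_derive R_CompleteNormedModule f df a b); intros; auto.
Qed.
Lemma RInt_const_R (c a b : R) : RInt (fun _ => c) a b = (b - a) * c.
Proof. apply (@RInt_const R_CompleteNormedModule a b c). Qed.
Lemma der_RInt (f : R -> R) (a x : R) :
  (forall y, continuous f y) -> is_derive (fun z => RInt f a z) x (f x).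
Proof.
  intros H. apply (@is_derive_RInt R_NormedModule f (fun z => RInt f a z) a x).
  - apply filter_forall. intros z.
    apply (@RInt_correct R_CompleteNormedModule). now apply ex_RInt_cont.
  - apply H.
Qed.
Lemma RInt_abs_le (f : R -> R) (a b M : R) :
  a <= b -> (forall x, continuous f x) -> (forall x, a <= x <= b -> Rabs (f x) <= M) ->
  Rabs (RInt f a b) <= (b - a) * M.
Proof. intros Hab H HM. apply abs_RInt_le_const; auto. now apply ex_RInt_cont. Qed.
Lemma RInt_nonneg (f : R -> R) (a b : R) :
  a <= b -> (forall x, continuous f x) -> (forall x, a <= x <= b -> 0 <= f x) ->
  0 <= RInt f a b.
Proof.
  intros Hab Hc H. apply RInt_ge_0; auto. now apply ex_RInt_cont.
  intros; apply H; lra.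
Qed.
Lemma RInt_mono (f g : R -> R) (a b : R) :
  a <= b -> (forall x, continuous f x) -> (forall x, continuous g x) ->
  (forall x, a <= x <= b -> f x <= g x) -> RInt f a b <= RInt g a b.
Proof.
  intros Hab Hf Hg H. apply RInt_le; auto; try now apply ex_RInt_cont.
  intros; apply H; lra.
Qed.

(** * Compactness of intervals; series *)

(** Compactness without subcovers: the supremum of the endpoints reachable from [a] is itself
    reachable and cannot lie before [b]. *)
Lemma interval_induction (P : R -> R -> Prop) :
  (forall a b c, a <= b <= c -> P a b -> P b c -> P a c) ->
  (forall t, exists d, 0 < d /\ forall a b, t - d < a <= t -> t <= b < t + d -> P a b) ->
  forall a b, a <= b -> P a b.
Proof.
  intros Htr Hloc a b Hab.
  set (E := fun c => a <= c <= b /\ P a c).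
  assert (Ea : E a).
  { split; [lra|]. destruct (Hloc a) as [d [Hd H]]. apply H; lra. }
  destruct (completeness E) as [s [Hub Hlub]].
  { exists b. intros c [Hc _]. lra. }
  { now exists a. }
  assert (Has : a <= s) by now apply Hub.
  assert (Hsb : s <= b) by (apply Hlub; intros c [Hc _]; lra).
  destruct (Hloc s) as [d [Hd H]].
  assert (Hc : exists c, E c /\ s - d < c).
  { apply NNPP. intros Hn. assert (s <= s - d); [|lra].
    apply Hlub. intros c Hc. apply Rnot_lt_le. intros Hlt. apply Hn. now exists c. }
  destruct Hc as [c [[Hc Pc] Hcs]].
  assert (Hcs' : c <= s) by (apply Hub; split; auto).
  set (e := Rmin b (s + d / 2)).
  assert (He : s <= e /\ e <= b /\ e < s + d).
  { unfold e. pose proof (Rmin_l b (s + d / 2)). pose proof (Rmin_r b (s + d / 2)).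
    split; [apply Rmin_glb|]; lra. }
  assert (Ee : E e).
  { split; [lra|]. apply (Htr a c e); [lra|exact Pc|]. apply H; lra. }
  assert (e <= s) by now apply Hub.
  assert (Eb : e = b).
  { unfold e in *. destruct (Rle_dec b (s + d / 2)).
    - now rewrite Rmin_left by lra.
    - rewrite Rmin_right in * by lra. lra. }
  rewrite <- Eb. apply Ee.
Qed.

Lemma locally_bounded_on_interval (B : R -> R -> Prop) :
  (forall t M M', M <= M' -> B t M -> B t M') ->
  (forall t, exists d M, 0 < d /\ forall s, Rabs (s - t) < d -> B s M) ->
  forall a b, a <= b -> exists M, forall t, a <= t <= b -> B t M.
Proof.
  intros Hmono Hloc. apply interval_induction.
  - intros a b c Habc [M HM] [M' HM']. exists (Rmax M M'). intros t Ht.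
    destruct (Rle_dec t b).
    + apply (Hmono t M); [apply Rmax_l | apply HM; lra].
    + apply (Hmono t M'); [apply Rmax_r | apply HM'; lra].
  - intros t. destruct (Hloc t) as [d [M [Hd H]]]. exists d. split; [exact Hd|].
    intros a b Ha Hb. exists M. intros s Hs. apply H, Rabs_def1; lra.
Qed.

Lemma continuous_bounded_on_bounded (f : R -> R) (M : R) : (forall y, continuous f y) -> 0 <= M ->
  exists K, 0 < K /\ forall y, Rabs y <= M -> Rabs (f y) <= K.
Proof.
  intros Cf HM. destruct (continuity_ab_maj (fun y => Rabs (f y)) (- M) M) as [z [Hz _]]; [lra| |].
  - intros y _. apply continuity_pt_filterlim. apply (cont_abs f), Cf.
  - exists (Rabs (f z) + 1). split; [pose proof (Rabs_pos (f z)); lra|].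
    intros y Hy. apply Rabs_le_between in Hy. specialize (Hz y Hy). lra.
Qed.

Lemma ex_series_dominated (a m : nat -> R) :
  (forall n, Rabs (a n) <= m n) -> ex_series m -> ex_series a.
Proof. intros H. now apply (@ex_series_le R_AbsRing R_CompleteNormedModule a m). Qed.
Lemma ex_series_scale (c : R) (a : nat -> R) : ex_series a -> ex_series (fun n => c * a n).
Proof. apply (@ex_series_scal R_AbsRing R_NormedModule). Qed.
Lemma ex_series_add (a b : nat -> R) : ex_series a -> ex_series b -> ex_series (fun n => a n + b n).
Proof. apply (@ex_series_plus R_AbsRing R_NormedModule). Qed.

(** * Smooth bumps and weak derivatives *)

(** Carrying the derivative as a witness turns closure under products and affine maps into a plain
    induction, with no rewriting under [Derive]. *)
Fixpoint smooth_upto (n : nat) (f : R -> R) : Prop :=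
  match n with
  | O => forall x, continuous f x
  | S m => exists df, (forall x, is_derive f x (df x)) /\ smooth_upto m df
  end.

Lemma smooth_upto_cont (n : nat) (f : R -> R) :
  smooth_upto n f -> forall x, continuous f x.
Proof.
  destruct n as [|n]; simpl; [auto|]. intros [df [H _]] x. now apply (derive_cont f x (df x)).
Qed.

Lemma smooth_upto_pred (n : nat) : forall f, smooth_upto (S n) f -> smooth_upto n f.
Proof.
  induction n as [|n IH]; intros f Hf.
  - intros x. now apply (smooth_upto_cont 1 f Hf).
  - destruct Hf as [df [H Hdf]]. exists df. split; [exact H|]. now apply IH.
Qed.

Lemma smooth_upto_plus (n : nat) :
  forall f g, smooth_upto n f -> smooth_upto n g -> smooth_upto n (fun x => f x + g x).
Proof.
  induction n as [|n IH]; intros f g Hf Hg.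
  - simpl in *. cont.
  - destruct Hf as [df [H Hdf]], Hg as [dg [H' Hdg]].
    exists (fun x => df x + dg x). split; [|now apply IH].
    intros x. now apply der_plus.
Qed.

Lemma smooth_upto_mult (n : nat) :
  forall f g, smooth_upto n f -> smooth_upto n g -> smooth_upto n (fun x => f x * g x).
Proof.
  induction n as [|n IH]; intros f g Hf Hg.
  - simpl in *. cont.
  - pose proof (smooth_upto_pred _ _ Hf). pose proof (smooth_upto_pred _ _ Hg).
    destruct Hf as [df [H1 Hdf]], Hg as [dg [H2 Hdg]].
    exists (fun x => df x * g x + f x * dg x). split.
    + intros x. now apply der_mult.
    + apply smooth_upto_plus; now apply IH.
Qed.

Lemma smooth_upto_const (n : nat) : forall c, smooth_upto n (fun _ => c).
Proof.
  induction n as [|n IH]; intros c.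
  - intros x. apply cont_const.
  - exists (fun _ => 0). split; [intros x; apply der_const | apply IH].
Qed.

Lemma smooth_upto_affine (n : nat) : forall f a b,
  smooth_upto n f -> smooth_upto n (fun x => f (a * x + b)).
Proof.
  induction n as [|n IH]; intros f a b Hf.
  - intros x. apply (cont_comp (fun x => a * x + b) f); [cont | apply Hf].
  - destruct Hf as [df [H Hdf]]. exists (fun x => a * df (a * x + b)). split.
    + intros x. eapply is_derive_eq.
      * apply (der_comp (fun x => a * x + b) f x a); [|apply H]. der. rring.
      * reflexivity.
    + apply smooth_upto_mult; [apply smooth_upto_const | now apply IH].
Qed.

(** For j = 0 this is the usual flat function; the powers of 1 / x are there to make the family
    closed under differentiation up to linear combinations. *)
Definition flat (j : nat) (x : R) : R :=
  if Rlt_dec 0 x then (/ x) ^ j * exp (- / x) else 0.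

(** With y = 1 / h and N = j + 2 one has exp y = exp (y / N) ^ N >= (y / N) ^ N. The quadratic rate
    is what makes the derivative at 0 exist and vanish. *)
Lemma flat_quadratic (j : nat) (h : R) : Rabs (flat j h) <= INR (j + 2) ^ (j + 2) * h ^ 2.
Proof.
  assert (Hn : 0 < INR (j + 2)) by (apply lt_0_INR; lia).
  assert (Hc : 0 <= INR (j + 2) ^ (j + 2)) by (apply pow_le; lra).
  unfold flat. destruct (Rlt_dec 0 h) as [Hh|Hh].
  2:{ rewrite Rabs_R0. apply Rmult_le_pos; [exact Hc|]. nra. }
  assert (Hy : 0 < / h) by now apply Rinv_0_lt_compat.
  set (y := / h) in *. set (N := (j + 2)%nat) in *.
  assert (Hexp : (y / INR N) ^ N <= exp y).
  { replace y with (INR N * (y / INR N)) at 2 by (rfield; lra).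

    assert (E : forall k z, exp (INR k * z) = exp z ^ k).
    { intros k z. induction k as [|k IHk]; [simpl; now rewrite Rmult_0_l, exp_0|].
      rewrite S_INR. replace ((INR k + 1) * z) with (z + INR k * z) by rring.
      rewrite exp_plus, IHk. reflexivity. }
    rewrite E. apply pow_incr. split.
    - apply Rlt_le, Rdiv_lt_0_compat; lra.
    - pose proof (exp_ineq1_le (y / INR N)). lra. }
  assert (Hj : 0 < y ^ j * exp (- y)) by (apply Rmult_lt_0_compat; [now apply pow_lt | apply exp_pos]).
  rewrite Rabs_pos_eq by lra.
  replace h with (/ y) by (unfold y; rfield; lra).
  apply Rmult_le_reg_r with (exp y * y ^ 2).
  { apply Rmult_lt_0_compat; [apply exp_pos | nra]. }
  replace (y ^ j * exp (- y) * (exp y * y ^ 2)) with (y ^ N * (exp (- y) * exp y))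
    by (unfold N; rewrite pow_add; rring).
  rewrite <- exp_plus, Rplus_opp_l, exp_0, Rmult_1_r.
  replace (INR N ^ N * (/ y) ^ 2 * (exp y * y ^ 2)) with (INR N ^ N * exp y) by (rfield; lra).
  unfold Rdiv in Hexp. rewrite Rpow_mult_distr, pow_inv in Hexp.
  assert (Hp : 0 < INR N ^ N) by now apply pow_lt.
  apply Rmult_le_compat_l with (r := INR N ^ N) in Hexp; [|lra].
  replace (INR N ^ N * (y ^ N * / INR N ^ N)) with (y ^ N) in Hexp by (rfield; lra).
  exact Hexp.
Qed.

Lemma flat_derive (j : nat) (x : R) :
  is_derive (flat j) x (flat (j + 2) x - INR j * flat (j + 1) x).
Proof.
  destruct (Rtotal_order x 0) as [Hx|[->|Hx]].
  - replace (flat (j + 2) x - INR j * flat (j + 1) x) with 0.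
    + apply (is_derive_ext_near (fun _ => 0) _ x 0 (- x)); [lra | | apply der_const].
      intros y Hy. apply Rabs_def2 in Hy. unfold flat. destruct (Rlt_dec 0 y); lra.
    + unfold flat. destruct (Rlt_dec 0 x); lra.
  - replace (flat (j + 2) 0 - INR j * flat (j + 1) 0) with 0
      by (unfold flat; destruct (Rlt_dec 0 0); lra).
    apply is_derive_eps. intros eps He.
    set (c := INR (j + 2) ^ (j + 2)).
    assert (Hc : 0 < c) by (apply pow_lt, lt_0_INR; lia).
    exists (eps / c). split; [now apply Rdiv_lt_0_compat|]. intros h Hh.
    rewrite Rplus_0_l. replace (flat j 0) with 0 by (unfold flat; destruct (Rlt_dec 0 0); lra).
    rewrite Rmult_0_r, !Rminus_0_r.
    apply Rle_trans with (c * h ^ 2); [apply flat_quadratic|].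
    rewrite <- (pow2_abs h).
    assert (c * Rabs h <= eps).
    { apply Rlt_le in Hh. apply (Rmult_le_compat_l c) in Hh; [|lra].
      replace (c * (eps / c)) with eps in Hh by (rfield; lra). exact Hh. }
    pose proof (Rabs_pos h). nra.
  - apply (is_derive_ext_near (fun y => (/ y) ^ j * exp (- / y)) _ x _ x Hx).
    + intros y Hy. apply Rabs_def2 in Hy. unfold flat. destruct (Rlt_dec 0 y); lra.
    + eapply is_derive_eq; [auto_derive; [repeat split; lra|reflexivity]|].
      unfold flat. destruct (Rlt_dec 0 x) as [_|]; [|lra].
      destruct j as [|j].
      * simpl. rfield. lra.
      * rewrite !pow_add. simpl pred. rewrite S_INR. simpl. rfield. lra.
Qed.

Lemma flat_smooth (n : nat) : forall j, smooth_upto n (flat j).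
Proof.
  induction n as [|n IH]; intros j.
  - intros x. eapply derive_cont, flat_derive.
  - exists (fun x => flat (j + 2) x + (- INR j) * flat (j + 1) x). split.
    + intros x. eapply is_derive_eq; [apply flat_derive | rring].
    + apply smooth_upto_plus; [apply IH|].
      apply smooth_upto_mult; [apply smooth_upto_const | apply IH].
Qed.

Definition bump (x : R) : R := flat 0 (1 + x) * flat 0 (1 - x).

Lemma bump_smooth (n : nat) : smooth_upto n bump.
Proof.
  apply smooth_upto_mult.
  - replace (fun x => flat 0 (1 + x)) with (fun x => flat 0 (1 * x + 1))
      by (apply functional_extensionality; intros; f_equal; rring).
    apply smooth_upto_affine, flat_smooth.
  - replace (fun x => flat 0 (1 - x)) with (fun x => flat 0 ((-1) * x + 1))
      by (apply functional_extensionality; intros; f_equal; rring).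
    apply smooth_upto_affine, flat_smooth.
Qed.

Lemma flat0_pos (x : R) : 0 < x -> 0 < flat 0 x.
Proof.
  intros H. unfold flat. destruct (Rlt_dec 0 x); [|lra]. simpl.
  rewrite Rmult_1_l. apply exp_pos.
Qed.
Lemma flat0_nonneg (x : R) : 0 <= flat 0 x.
Proof.
  destruct (Rlt_dec 0 x); [now apply Rlt_le, flat0_pos|].
  unfold flat. destruct (Rlt_dec 0 x); lra.
Qed.
Lemma bump_pos (x : R) : Rabs x < 1 -> 0 < bump x.
Proof.
  intros H. apply Rabs_def2 in H. apply Rmult_lt_0_compat; apply flat0_pos; lra.
Qed.
Lemma bump_nonneg (x : R) : 0 <= bump x.
Proof. apply Rmult_le_pos; apply flat0_nonneg. Qed.
Lemma bump_zero (x : R) : 1 <= Rabs x -> bump x = 0.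
Proof.
  intros H. unfold bump, flat.
  destruct (Rlt_dec 0 (1 + x)), (Rlt_dec 0 (1 - x)); try rring.
  exfalso. unfold Rabs in H. destruct (Rcase_abs x); lra.
Qed.

Definition bump_prim (x : R) : R := RInt bump (-1) x.

Lemma bump_prim_derive (x : R) : is_derive bump_prim x (bump x).
Proof. apply der_RInt. apply (bump_smooth 0). Qed.

Lemma bump_prim_smooth (n : nat) : smooth_upto n bump_prim.
Proof.
  apply smooth_upto_pred. exists bump. split; [apply bump_prim_derive | apply bump_smooth].
Qed.

Lemma bump_prim_left (x : R) : x <= -1 -> bump_prim x = 0.
Proof.
  intros H. rewrite <- (RInt_same bump (-1)). unfold bump_prim.
  apply (derive_zero_const bump_prim). intros y Hy.
  rewrite Rmin_left, Rmax_right in Hy by lra.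
  eapply is_derive_eq; [apply bump_prim_derive|]. apply bump_zero.
  rewrite Rabs_left; lra.
Qed.

Lemma bump_prim_right (x : R) : 1 <= x -> bump_prim x = bump_prim 1.
Proof.
  intros H. symmetry. apply (derive_zero_const bump_prim). intros y Hy.
  rewrite Rmin_left, Rmax_right in Hy by lra.
  eapply is_derive_eq; [apply bump_prim_derive|]. apply bump_zero.
  rewrite Rabs_right; lra.
Qed.

Lemma bump_prim_mass : 0 < bump_prim 1.
Proof.
  apply RInt_gt_0; [lra| |].
  - intros x Hx. apply bump_pos. apply Rabs_def1; lra.
  - intros x _. apply (bump_smooth 0).
Qed.

(* The antiderivative of the difference of two narrow bumps is a compactly supported test function; testing against it compares the averages of D near a and near b. *)
Lemma weak_derivative_zero_const (D : R -> R) :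
  (forall x, continuous D x) ->
  (forall M chi dchi, (forall n, smooth_upto n chi) ->
     (forall t, is_derive chi t (dchi t)) ->
     (forall t, continuous dchi t) ->
     (forall t, M <= Rabs t -> chi t = 0) ->
     RInt (fun t => dchi t * D t) (- M) M = 0) ->
  forall a b, D a = D b.
Proof.
  intros Dc H a b. apply NNPP. intros Hab.
  (* A quarter of the gap: each local average errs by at most [e], so equal averages would bound the
     gap by [2 * e], half of itself. *)
  set (e := Rabs (D a - D b) / 4).
  assert (He : 0 < e).
  { assert (0 < Rabs (D a - D b)) by (apply Rabs_pos_lt; lra). unfold e. lra. }
  destruct (eps_continuous D a e (Dc a) He) as [da [Hda Ha]].
  destruct (eps_continuous D b e (Dc b) He) as [db [Hdb Hb]].
  set (r := Rmin 1 (Rmin da db)).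
  assert (Hr : 0 < r /\ r <= 1 /\ r <= da /\ r <= db).
  { unfold r. pose proof (Rmin_l 1 (Rmin da db)). pose proof (Rmin_r 1 (Rmin da db)).
    pose proof (Rmin_l da db). pose proof (Rmin_r da db).
    split; [repeat apply Rmin_glb_lt; lra | lra]. }
  set (M := Rabs a + Rabs b + 1).
  set (step := fun p t => bump_prim ((/ r) * t + - p / r)).
  set (peak := fun p t => bump ((/ r) * t + - p / r) / r).
  assert (Hstep : forall p t, is_derive (step p) t (peak p t)).
  { intros p t. unfold step, peak. eapply is_derive_eq.
    - apply (der_comp (fun t => / r * t + - p / r) bump_prim t (/ r)); [|apply bump_prim_derive].
      der. rring.
    - unfold Rdiv. rring. }
  assert (Hpc : forall p t, continuous (peak p) t).
  { intros p t. unfold peak. apply cont_div.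
    apply (smooth_upto_affine 0 bump (/ r) (- p / r)), (bump_smooth 0). }
  assert (Hpn : forall p t, 0 <= peak p t).
  { intros p t. apply Rmult_le_pos; [apply bump_nonneg | apply Rlt_le, Rinv_0_lt_compat; lra]. }
  assert (Hsl : forall p t, t <= p - r -> step p t = 0).
  { intros p t Ht. apply bump_prim_left.
    replace (/ r * t + - p / r) with ((t - p) / r) by (rfield; lra).
    apply Rmult_le_reg_r with r; [lra|]. unfold Rdiv. rewrite Rmult_assoc, Rinv_l; lra. }
  assert (Hsr : forall p t, p + r <= t -> step p t = bump_prim 1).
  { intros p t Ht. apply bump_prim_right.
    replace (/ r * t + - p / r) with ((t - p) / r) by (rfield; lra).
    apply Rmult_le_reg_r with r; [lra|]. unfold Rdiv. rewrite Rmult_assoc, Rinv_l; lra. }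
  assert (Hpz : forall p t, r <= Rabs (t - p) -> peak p t = 0).
  { intros p t Ht. unfold peak. rewrite bump_zero; [unfold Rdiv; rring|].
    replace (/ r * t + - p / r) with ((t - p) / r) by (rfield; lra).
    unfold Rdiv. rewrite Rabs_mult, (Rabs_pos_eq (/ r)) by (apply Rlt_le, Rinv_0_lt_compat; lra).
    apply Rmult_le_reg_r with r; [lra|]. rewrite Rmult_assoc, Rinv_l; lra. }
  assert (Hab' : - M <= a - r /\ a + r <= M /\ - M <= b - r /\ b + r <= M).
  { unfold M. pose proof (Rle_abs a). pose proof (Rle_abs b).
    pose proof (Rle_abs (- a)). pose proof (Rle_abs (- b)). rewrite Rabs_Ropp in *. 
    pose proof (Rabs_pos a). pose proof (Rabs_pos b). lra. }
  assert (Hmass : forall p, - M <= p - r -> p + r <= M -> RInt (peak p) (- M) M = bump_prim 1).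
  { intros p H1 H2. rewrite (RInt_antideriv (step p) (peak p)); [|apply Hstep|apply Hpc].
    rewrite (Hsr p M), (Hsl p (- M)) by lra. rring. }
  assert (Havg : forall p, - M <= p - r -> p + r <= M ->
      (forall t, Rabs (t - p) < r -> Rabs (D t - D p) < e) ->
      Rabs (RInt (fun t => peak p t * D t) (- M) M - bump_prim 1 * D p) <= e * bump_prim 1).
  { intros p H1 H2 Hp. rewrite <- (Hmass p H1 H2).
    replace (RInt (peak p) (- M) M * D p) with (RInt (fun t => D p * peak p t) (- M) M)
      by (rewrite RInt_scale; [rring | apply Hpc]).
    rewrite <- RInt_sub; [ | intros; apply cont_mult; auto | intros; apply cont_mult; auto with cont].
    eapply Rle_trans; [apply abs_RInt_le|].
    - lra.
    - apply ex_RInt_cont. intros. apply cont_minus; apply cont_mult; auto with cont.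
    - rewrite <- RInt_scale by apply Hpc. apply RInt_mono.
      + lra.
      + intros. apply cont_abs, cont_minus; apply cont_mult; auto with cont.
      + intros. apply cont_mult; auto with cont.
      + intros t _. replace (peak p t * D t - D p * peak p t) with (peak p t * (D t - D p)) by rring.
        rewrite Rabs_mult, (Rabs_pos_eq (peak p t)) by apply Hpn.
        destruct (Rlt_dec (Rabs (t - p)) r) as [Hlt|Hge].
        * specialize (Hp t Hlt). specialize (Hpn p t). nra.
        * rewrite Hpz by lra. lra. }
  assert (Hz : RInt (fun t => (peak a t - peak b t) * D t) (- M) M = 0).
  { apply (H M (fun t => step a t - step b t)).
    - intros n. apply (smooth_upto_plus n (step a) (fun t => - step b t)).
      + apply smooth_upto_affine, bump_prim_smooth.
      + replace (fun t => - step b t) with (fun t => (-1) * step b t)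
          by (apply functional_extensionality; intros; rring).
        apply smooth_upto_mult; [apply smooth_upto_const|].
        apply smooth_upto_affine, bump_prim_smooth.
    - intros t. apply der_minus; apply Hstep.
    - intros t. apply cont_minus; apply Hpc.
    - intros t Ht. destruct (Rcase_abs t) as [Hneg|Hpos].
      + rewrite Rabs_left in Ht by lra. rewrite !Hsl by lra. rring.
      + rewrite Rabs_right in Ht by lra. rewrite !Hsr by lra. rring. }
  replace (RInt (fun t => (peak a t - peak b t) * D t) (- M) M)
    with (RInt (fun t => peak a t * D t) (- M) M - RInt (fun t => peak b t * D t) (- M) M) in Hz.
  2:{ rewrite <- RInt_sub; [ | intros; apply cont_mult; auto | intros; apply cont_mult; auto].
      apply RInt_eq. intros; rring. }
  assert (A1 := Havg a ltac:(lra) ltac:(lra) ltac:(intros; apply Ha; lra)).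
  assert (A2 := Havg b ltac:(lra) ltac:(lra) ltac:(intros; apply Hb; lra)).
  pose proof bump_prim_mass as Hm. set (m := bump_prim 1) in *.
  assert (Rabs (m * D a - m * D b) <= 2 * e * m).
  { unfold Rabs in A1, A2 |- *. repeat destruct Rcase_abs; lra. }
  replace (m * D a - m * D b) with (m * (D a - D b)) in H0 by rring.
  rewrite Rabs_mult, (Rabs_pos_eq m) in H0 by lra.
  replace (Rabs (D a - D b)) with (4 * e) in H0 by (unfold e; rfield). nra.
Qed.

(** Subtracting a primitive [I] of [B] leaves a function with zero weak derivative, because testing
    [I] is an honest integration by parts. *)
Lemma weak_derivative_strong (A B : R -> R) :
  (forall x, continuous A x) -> (forall x, continuous B x) ->
  (forall M chi dchi, (forall n, smooth_upto n chi) ->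
     (forall t, is_derive chi t (dchi t)) ->
     (forall t, continuous dchi t) ->
     (forall t, M <= Rabs t -> chi t = 0) ->
     RInt (fun t => dchi t * A t + chi t * B t) (- M) M = 0) ->
  forall t, is_derive A t (B t).
Proof.
  intros Ac Bc H t.
  set (I := fun t => RInt B 0 t).
  assert (HI : forall t, is_derive I t (B t)) by (intros; now apply der_RInt).
  assert (Ic : forall t, continuous I t) by (intros s; apply (derive_cont I s (B s)), HI).
  assert (HD : forall a b, A a - I a = A b - I b).
  { apply (weak_derivative_zero_const (fun s => A s - I s)); [intros; auto with cont|].
    intros M chi dchi H1 H2 H3 H4. specialize (H M chi dchi H1 H2 H3 H4).
    pose proof (smooth_upto_cont 0 chi (H1 0%nat)) as Hc.
    rewrite (RInt_eq _ (fun s => (dchi s * A s + chi s * B s) - (dchi s * I s + chi s * B s)))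
      by (intros; rring).
    rewrite RInt_sub by (intros; auto with cont).
    rewrite H, (RInt_antideriv (fun s => chi s * I s)).
    (* For negative [M] the vanishing condition on [chi] covers all times, so the boundary terms are
       zero in that case too. *)
    - destruct (Rle_dec 0 M) as [HM|HM].
      + rewrite !H4; [rring | |]; rewrite ?Rabs_Ropp; apply Rle_abs.
      + rewrite !H4; [rring | |]; pose proof (Rabs_pos M); pose proof (Rabs_pos (-M)); lra.
    - intros s. apply der_mult; auto.
    - intros; auto with cont. }
  apply (is_derive_ext (fun s => (A 0 - I 0) + I s)).
  - intros s. rewrite (HD 0 s). rring.
  - der. rring.
Qed.

(** * Periodic functions and bounded linear functionals *)

Definition cper (g : R -> R) : Prop := periodic g /\ forall x, continuous g x.

Lemma cper_const (c : R) : cper (fun _ => c).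
Proof. split; [intros x; reflexivity | intros; apply cont_const]. Qed.
Lemma cper_plus (g h : R -> R) : cper g -> cper h -> cper (fun x => g x + h x).
Proof.
  intros [Pg Cg] [Ph Ch]. split; [|cont]. intros x. now rewrite (Pg x), (Ph x).
Qed.
Lemma cper_mult (g h : R -> R) : cper g -> cper h -> cper (fun x => g x * h x).
Proof.
  intros [Pg Cg] [Ph Ch]. split; [|cont]. intros x. now rewrite (Pg x), (Ph x).
Qed.
Lemma cper_minus (g h : R -> R) : cper g -> cper h -> cper (fun x => g x - h x).
Proof.
  intros [Pg Cg] [Ph Ch]. split; [|cont]. intros x. now rewrite (Pg x), (Ph x).
Qed.
Lemma cper_scal (c : R) (g : R -> R) : cper g -> cper (fun x => c * g x).
Proof. intros Hg. apply cper_mult; [apply cper_const | exact Hg]. Qed.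
Lemma cper_comp (f g : R -> R) :
  (forall y, continuous f y) -> cper g -> cper (fun x => f (g x)).
Proof.
  intros Hf [Pg Cg]. split.
  - intros x. now rewrite (Pg x).
  - intros x. now apply cont_comp.
Qed.
Lemma periodic_nat (g : R -> R) : periodic g ->
  forall (n : nat) x, g (x + INR n * (2 * PI)) = g x.
Proof.
  intros H n. induction n as [|n IH]; intros x.
  - simpl. f_equal. rring.
  - rewrite S_INR. replace (x + (INR n + 1) * (2 * PI)) with (x + INR n * (2 * PI) + 2 * PI) by rring.
    now rewrite H.
Qed.

Lemma periodic_Z (g : R -> R) : periodic g ->
  forall (k : Z) x, g (x + IZR k * (2 * PI)) = g x.
Proof.
  intros H k x. destruct (Z_le_gt_dec 0 k) as [Hk|Hk].
  - rewrite <- (Z2Nat.id k Hk), <- INR_IZR_INZ. now apply periodic_nat.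
  - rewrite <- (periodic_nat g H (Z.to_nat (- k)) (x + IZR k * (2 * PI))).
    rewrite INR_IZR_INZ, Z2Nat.id, opp_IZR by lia. f_equal. rring.
Qed.

Lemma period_representative (a x : R) :
  exists (k : Z) (y : R), a <= y < a + 2 * PI /\ x = y + IZR k * (2 * PI).
Proof.
  assert (Hpi := PI_RGT_0).
  set (r := (x - a) / (2 * PI)).
  exists (up r - 1)%Z, (x - IZR (up r - 1) * (2 * PI)). split; [|rring].
  destruct (archimed r) as [H1 H2]. rewrite minus_IZR.
  assert (Hx : x = a + r * (2 * PI)) by (unfold r; rfield; lra).
  rewrite Hx. nra.
Qed.

Lemma cper_bounded (g : R -> R) : cper g -> exists M, 0 < M /\ forall x, Rabs (g x) <= M.
Proof.
  intros [Pg Cg]. assert (Hpi := PI_RGT_0).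
  destruct (continuous_bounded_on_bounded g (2 * PI) Cg) as [M [HM H]]; [lra|].
  exists M. split; [exact HM|]. intros x.
  destruct (period_representative 0 x) as [k [y [Hy ->]]].
  rewrite (periodic_Z g Pg). apply H. rewrite Rabs_pos_eq; lra.
Qed.

(* C(R; C(T)): continuous in t uniformly in x. *)
Definition CT (W : R -> R -> R) : Prop :=
  (forall t, cper (fun x => W x t)) /\
  (forall t0 eps, 0 < eps -> exists d, 0 < d /\
     forall t, Rabs (t - t0) < d -> forall x, Rabs (W x t - W x t0) <= eps).

Lemma CT_plus (V W : R -> R -> R) : CT V -> CT W -> CT (fun x t => V x t + W x t).
Proof.
  intros [CV HV] [CW HW]. split; [intros t; now apply (cper_plus (fun x => V x t) (fun x => W x t))|].
  intros t0 eps He.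
  destruct (HV t0 (eps / 2)) as [d [Hd H]]; [lra|].
  destruct (HW t0 (eps / 2)) as [d' [Hd' H']]; [lra|].
  exists (Rmin d d'). split; [now apply Rmin_glb_lt|]. intros t Ht x.
  pose proof (Rmin_l d d'). pose proof (Rmin_r d d').
  specialize (H t ltac:(lra) x). specialize (H' t ltac:(lra) x).
  replace (V x t + W x t - (V x t0 + W x t0)) with ((V x t - V x t0) + (W x t - W x t0)) by rring.
  eapply Rle_trans; [apply Rabs_triang|]. lra.
Qed.

Lemma CT_mult (V W : R -> R -> R) : CT V -> CT W -> CT (fun x t => V x t * W x t).
Proof.
  intros [CV HV] [CW HW]. split; [intros t; now apply (cper_mult (fun x => V x t) (fun x => W x t))|].
  intros t0 eps He.
  destruct (cper_bounded _ (CV t0)) as [A [HA HAV]].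
  destruct (cper_bounded _ (CW t0)) as [B [HB HBW]].
  set (r := Rmin 1 (eps / (A + B + 1))).
  assert (Hr : 0 < r).
  { apply Rmin_glb_lt; [lra|]. apply Rdiv_lt_0_compat; lra. }
  destruct (HV t0 r Hr) as [d [Hd H]]. destruct (HW t0 r Hr) as [d' [Hd' H']].
  exists (Rmin d d'). split; [now apply Rmin_glb_lt|]. intros t Ht x.
  pose proof (Rmin_l d d'). pose proof (Rmin_r d d').
  specialize (H t ltac:(lra) x). specialize (H' t ltac:(lra) x).
  specialize (HAV x). specialize (HBW x). simpl in HAV, HBW.
  set (a := V x t - V x t0) in *. set (b := W x t - W x t0) in *.
  replace (V x t * W x t - V x t0 * W x t0)
    with (a * b + (a * W x t0 + V x t0 * b)) by (unfold a, b; rring).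
  assert (Hr1 : r <= 1) by apply Rmin_l.
  assert (Hre : r * (A + B + 1) <= eps).
  { apply Rle_trans with (eps / (A + B + 1) * (A + B + 1)).
    - apply Rmult_le_compat_r; [lra | apply Rmin_r].
    - right. rfield. lra. }
  eapply Rle_trans; [apply Rabs_triang|].
  eapply Rle_trans; [apply Rplus_le_compat_l, Rabs_triang|].
  rewrite !Rabs_mult.
  pose proof (Rabs_pos a). pose proof (Rabs_pos b).
  pose proof (Rabs_pos (V x t0)). pose proof (Rabs_pos (W x t0)). nra.
Qed.

Lemma CT_const (c : R) : CT (fun _ _ => c).
Proof.
  split; [intros; apply cper_const|]. intros t0 eps He. exists 1.
  split; [lra|]. intros. rewrite Rminus_diag, Rabs_R0. lra.
Qed.
Lemma CT_scal (c : R) (W : R -> R -> R) : CT W -> CT (fun x t => c * W x t).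
Proof. intros H. apply (CT_mult (fun _ _ => c)); [apply CT_const | exact H]. Qed.
Lemma CT_minus (V W : R -> R -> R) : CT V -> CT W -> CT (fun x t => V x t - W x t).
Proof.
  intros HV HW.
  replace (fun x t => V x t - W x t) with (fun x t => V x t + (-1) * W x t).
  - apply CT_plus; [exact HV | now apply (CT_scal (-1))].
  - do 2 (apply functional_extensionality; intros). rring.
Qed.
Lemma CT_pow (W : R -> R -> R) (n : nat) : CT W -> CT (fun x t => W x t ^ n).
Proof.
  intros H. induction n as [|n IH]; simpl; [apply CT_const | now apply CT_mult].
Qed.
Lemma CT_sum (W : nat -> R -> R -> R) (n : nat) :
  (forall i, (i <= n)%nat -> CT (W i)) -> CT (fun x t => sum_f_R0 (fun i => W i x t) n).
Proof.
  induction n as [|n IH]; intros H; simpl.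
  - now apply H.
  - apply CT_plus; [apply IH; intros; apply H; lia | now apply H].
Qed.

Definition polyval (a : nat -> R) (d : nat) (y : R) : R := sum_f_R0 (fun i => a i * y ^ i) d.

Lemma polyval_cont (a : nat -> R) (d : nat) (y : R) : continuous (polyval a d) y.
Proof. apply cont_sum. intros. auto with cont. Qed.

Lemma CT_polyval (a : nat -> R) (d : nat) (W : R -> R -> R) :
  CT W -> CT (fun x t => polyval a d (W x t)).
Proof.
  intros H. apply (CT_sum (fun i x t => a i * W x t ^ i)).
  intros i _. apply CT_scal. now apply CT_pow.
Qed.

Lemma CT_cont_x (W : R -> R -> R) (t : R) : CT W -> forall x, continuous (fun x => W x t) x.
Proof. intros [H _]. apply H. Qed.

Lemma CT_cont_t (W : R -> R -> R) (x : R) : CT W -> forall t, continuous (fun t => W x t) t.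
Proof.
  intros [_ H] t. apply continuous_eps. intros eps He.
  destruct (H t eps He) as [d [Hd H']]. exists d. split; [exact Hd|].
  intros s Hs. now apply H'.
Qed.

Lemma CT_locally_bounded (W : R -> R -> R) : CT W ->
  forall T, exists M, 0 < M /\ forall t x, Rabs t <= T -> Rabs (W x t) <= M.
Proof.
  intros [C H] T.
  assert (HM : exists M, forall t, - Rabs T <= t <= Rabs T -> forall x, Rabs (W x t) <= M).
  { apply (locally_bounded_on_interval (fun t M => forall x, Rabs (W x t) <= M)).
    - intros t M M' HMM HM x. specialize (HM x). lra.
    - intros t. destruct (H t 1) as [d [Hd Hd']]; [lra|].
      destruct (cper_bounded _ (C t)) as [M [_ HM]].
      exists d, (M + 1). split; [exact Hd|]. intros s Hs x.
      specialize (Hd' s Hs x). specialize (HM x). simpl in HM.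
      pose proof (Rabs_triang_inv (W x s) (W x t)). lra.
    - pose proof (Rabs_pos T). lra. }
  destruct HM as [M HM]. exists (Rmax M 1).
  pose proof (Rmax_l M 1). pose proof (Rmax_r M 1). split; [lra|].
  intros t x Ht. assert (Rabs (W x t) <= M); [|lra]. apply HM.
  pose proof (Rle_abs T). pose proof (Rabs_le_between t (Rabs T)) as [Hb _].
  apply Hb. lra.
Qed.

(** Continuity in t comes from a local bound on [V]; continuity in x needs a modulus that is uniform
    over the time interval of integration. *)
Lemma CT_time_integral (V : R -> R -> R) : CT V -> CT (fun x t => RInt (fun s => V x s) 0 t).
Proof.
  intros HV. pose proof HV as [C H].
  assert (Hct : forall x s, continuous (fun s => V x s) s) by (intros; now apply CT_cont_t).
  split.
  - intros t. split.
    + intros x. apply RInt_eq. intros s. apply (C s).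
    + intros x. apply continuous_eps. intros eps He.
      assert (He' : 0 < eps / (Rabs t + 1)).
      { apply Rdiv_lt_0_compat; [lra|]. pose proof (Rabs_pos t). lra. }
      (* The modulus is found near each time by comparison with that one time, an [e / 3] argument,
         and is glued by [interval_induction]. The symmetric range serves both signs of [t]. *)
      assert (Hd : exists d, 0 < d /\ forall s y, - Rabs t <= s <= Rabs t ->
                Rabs (y - x) < d -> Rabs (V y s - V x s) <= eps / (Rabs t + 1)).
      { apply (interval_induction (fun a b => exists d, 0 < d /\ forall s y, a <= s <= b ->
                Rabs (y - x) < d -> Rabs (V y s - V x s) <= eps / (Rabs t + 1))).
        - intros a b c Habc [d [Hd H1]] [d' [Hd' H2]]. exists (Rmin d d').
          split; [now apply Rmin_glb_lt|]. intros s y Hs Hy.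
          pose proof (Rmin_l d d'). pose proof (Rmin_r d d').
          destruct (Rle_dec s b); [apply H1 | apply H2]; lra.
        - intros s. set (e := eps / (Rabs t + 1)) in *.
          destruct (H s (e / 3)) as [d [Hd H1]]; [lra|].
          destruct (C s) as [_ Cs].
          destruct (eps_continuous _ x (e / 3) (Cs x)) as [d' [Hd' H2]]; [lra|].
          exists d. split; [exact Hd|]. intros a b Ha Hb. exists d'. split; [exact Hd'|].
          intros r y Hr Hy. specialize (H2 y Hy).
          assert (Hrs : Rabs (r - s) < d) by (apply Rabs_def1; lra).
          pose proof (H1 r Hrs x). pose proof (H1 r Hrs y).
          simpl in H2.
          replace (V y r - V x r) with ((V y r - V y s) + ((V y s - V x s) + - (V x r - V x s))) by rring.
          eapply Rle_trans; [apply Rabs_triang|].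
          eapply Rle_trans; [apply Rplus_le_compat_l, Rabs_triang|].
          rewrite Rabs_Ropp. lra.
        - pose proof (Rabs_pos t). lra. }
      destruct Hd as [d [Hd H1]]. exists d. split; [exact Hd|]. intros y Hy.
      rewrite <- RInt_sub by auto.
      assert (Hb : forall a b, a <= b -> - Rabs t <= a -> b <= Rabs t -> b - a <= Rabs t ->
          Rabs (RInt (fun s => V y s - V x s) a b) <= eps).
      { intros a b Hab Ha Hb Hl. eapply Rle_trans.
        - apply RInt_abs_le; [exact Hab | intros; auto with cont |].
          intros s Hs. apply (H1 s y); [lra | exact Hy].
        - apply Rle_trans with ((Rabs t + 1) * (eps / (Rabs t + 1))).
          + apply Rmult_le_compat_r; lra.
          + right. rfield. pose proof (Rabs_pos t). lra. }
      destruct (Rle_dec 0 t) as [Ht|Ht].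
      * apply Hb; try lra; rewrite Rabs_pos_eq by lra; lra.
      * assert (Hsw : RInt (fun s => V y s - V x s) 0 t = - RInt (fun s => V y s - V x s) t 0).
        { symmetry. apply (@opp_RInt_swap R_CompleteNormedModule (fun s => V y s - V x s)).
          apply ex_RInt_cont. auto with cont. }
        rewrite Hsw, Rabs_Ropp.
        apply Hb; try lra; rewrite Rabs_left by lra; lra.
  - intros t0 eps He. destruct (CT_locally_bounded V HV (Rabs t0 + 1)) as [M [HM HMV]].
    exists (Rmin 1 (eps / M)). split; [apply Rmin_glb_lt; [lra | now apply Rdiv_lt_0_compat]|].
    intros t Ht x. pose proof (Rmin_l 1 (eps / M)). pose proof (Rmin_r 1 (eps / M)).
    assert (HI : forall s, is_derive (fun t => RInt (fun s => V x s) 0 t) s (V x s))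
      by (intros s; apply (der_RInt (fun s => V x s)); auto).
    destruct (MVT_is_derive _ _ t0 t (fun s _ => HI s)) as [c [Hc ->]].
    assert (Hct0 : Rabs c <= Rabs t0 + 1).
    { apply Rabs_def2 in Ht. unfold Rmin, Rmax in Hc. destruct (Rle_dec t0 t);
      unfold Rabs; repeat destruct Rcase_abs; lra. }
    rewrite Rabs_mult. specialize (HMV c x Hct0).
    apply Rle_trans with (M * (eps / M)); [|right; rfield; lra].
    apply Rmult_le_compat; try apply Rabs_pos; lra.
Qed.

(** A functional on C(T) of norm at most [kappa]. Fourier moments, weighted integrals and point
    values of the Green operator are all of this kind, so one rule for differentiating in time
    serves them all. *)
Definition bounded_linear (kappa : R) (Lam : (R -> R) -> R) : Prop :=
  0 <= kappa /\
  (forall g h c, cper g -> cper h -> Lam (fun x => g x + c * h x) = Lam g + c * Lam h) /\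
  (forall g M, cper g -> (forall x, Rabs (g x) <= M) -> Rabs (Lam g) <= kappa * M).

Lemma bounded_linear_minus (kappa : R) (Lam : (R -> R) -> R) (g h : R -> R) :
  bounded_linear kappa Lam -> cper g -> cper h ->
  Lam (fun x => g x - h x) = Lam g - Lam h.
Proof.
  intros [_ [HL _]] Hg Hh.
  replace (fun x => g x - h x) with (fun x => g x + (-1) * h x)
    by (apply functional_extensionality; intros; rring).
  rewrite HL by auto. rring.
Qed.

Lemma bounded_linear_scal (kappa : R) (Lam : (R -> R) -> R) (c : R) (g : R -> R) :
  bounded_linear kappa Lam -> cper g -> Lam (fun x => c * g x) = c * Lam g.
Proof.
  intros [Hk [HL HB]] Hg.
  assert (H0 : Lam (fun _ => 0) = 0).
  { specialize (HB (fun _ => 0) 0 (cper_const 0)).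
    rewrite Rmult_0_r in HB. assert (Rabs (Lam (fun _ => 0)) <= 0).
    { apply HB. intros. rewrite Rabs_R0. lra. }
    pose proof (Rabs_pos (Lam (fun _ => 0))).
    apply Rabs_eq_0. lra. }
  replace (fun x => c * g x) with (fun x => 0 + c * g x)
    by (apply functional_extensionality; intros; rring).
  rewrite HL by (auto using cper_const). rewrite H0. rring.
Qed.

Lemma bounded_linear_cont (kappa : R) (Lam : (R -> R) -> R) (W : R -> R -> R) :
  bounded_linear kappa Lam -> CT W -> forall t, continuous (fun t => Lam (fun x => W x t)) t.
Proof.
  intros HL [C H] t. apply continuous_eps. intros eps He.
  pose proof HL as [Hk [_ HB]].
  destruct (H t (eps / (kappa + 1))) as [d [Hd Hd']]; [apply Rdiv_lt_0_compat; lra|].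
  exists d. split; [exact Hd|]. intros s Hs.
  rewrite <- (bounded_linear_minus kappa Lam (fun x => W x s) (fun x => W x t)) by auto.
  eapply Rle_trans; [apply (HB _ (eps / (kappa + 1)))|].
  - now apply (cper_minus (fun x => W x s) (fun x => W x t)).
  - intros x. now apply Hd'.
  - assert (kappa * (eps / (kappa + 1)) = eps - eps / (kappa + 1)) by (rfield; lra).
    assert (0 < eps / (kappa + 1)) by (apply Rdiv_lt_0_compat; lra). lra.
Qed.

(** By the mean value theorem the difference quotients of [W] are values of [W'] at nearby times,
    which converge uniformly in x; the bound on [Lam] does the rest. *)
Lemma bounded_linear_derive (kappa : R) (Lam : (R -> R) -> R) (W W' : R -> R -> R) :
  bounded_linear kappa Lam -> CT W -> CT W' ->
  (forall x t, is_derive (fun t => W x t) t (W' x t)) ->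
  forall t, is_derive (fun t => Lam (fun x => W x t)) t (Lam (fun x => W' x t)).
Proof.
  intros HL [C _] [C' H'] HD t. apply is_derive_eps. intros eps He.
  pose proof HL as [Hk [_ HB]].
  destruct (H' t (eps / (kappa + 1))) as [d [Hd Hd']]; [apply Rdiv_lt_0_compat; lra|].
  exists d. split; [exact Hd|]. intros h Hh.
  rewrite <- (bounded_linear_scal kappa Lam h (fun x => W' x t)) by auto.
  rewrite <- (bounded_linear_minus kappa Lam (fun x => W x (t + h)) (fun x => W x t)) by auto.
  rewrite <- (bounded_linear_minus kappa Lam (fun x => W x (t + h) - W x t)
               (fun x => h * W' x t)); auto.
  2:{ now apply (cper_minus (fun x => W x (t + h)) (fun x => W x t)). }
  2:{ now apply cper_scal. }
  eapply Rle_trans; [apply (HB _ (eps / (kappa + 1) * Rabs h))|].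
  - apply (cper_minus (fun x => W x (t + h) - W x t) (fun x => h * W' x t)).
    + now apply (cper_minus (fun x => W x (t + h)) (fun x => W x t)).
    + now apply cper_scal.
  - intros x. destruct (MVT_is_derive _ _ t (t + h) (fun s _ => HD x s)) as [c [Hc ->]].
    replace (W' x c * (t + h - t) - h * W' x t) with ((W' x c - W' x t) * h) by rring.
    rewrite Rabs_mult. apply Rmult_le_compat_r; [apply Rabs_pos|]. apply Hd'.
    apply Rabs_def2 in Hh. unfold Rmin, Rmax in Hc.
    destruct (Rle_dec t (t + h)); apply Rabs_def1; lra.
  - assert (kappa * (eps / (kappa + 1)) = eps - eps / (kappa + 1)) by (rfield; lra).
    assert (0 < eps / (kappa + 1)) by (apply Rdiv_lt_0_compat; lra).
    rewrite <- Rmult_assoc. apply Rmult_le_compat_r; [apply Rabs_pos | lra].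
Qed.

Lemma bounded_linear_weighted_RInt (w : R -> R) (a b : R) :
  a <= b -> (forall x, continuous w x) ->
  exists kappa, bounded_linear kappa (fun g => RInt (fun x => g x * w x) a b).
Proof.
  intros Hab Hw.
  exists (RInt (fun x => Rabs (w x)) a b). repeat split.
  - apply RInt_nonneg; auto with cont. intros; apply Rabs_pos.
  - intros g h c [_ Hg] [_ Hh].
    rewrite (RInt_eq _ (fun x => g x * w x + c * (h x * w x))) by (intros; rring).
    rewrite RInt_add, RInt_scale; auto with cont.
  - intros g M [_ Hg] HM.
    eapply Rle_trans; [apply abs_RInt_le; [exact Hab | apply ex_RInt_cont; auto with cont]|].
    rewrite (Rmult_comm _ M), <- RInt_scale by auto with cont.
    apply RInt_mono; auto with cont. intros x _. rewrite Rabs_mult.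
    apply Rmult_le_compat_r; [apply Rabs_pos | apply HM].
Qed.

(** * Fourier coefficients of the solution *)

(** Products of a function of x and a function of t are the only test functions that the proof feeds
    into the equation. *)
Lemma ex_diff_n_separated (n : nat) : forall a b,
  smooth_upto n a -> smooth_upto n b ->
  forall x t, ex_diff_n (fun x t => a x * b t) n x t.
Proof.
  assert (C2 : forall a b, (forall x, continuous a x) -> (forall x, continuous b x) ->
             forall x t, continuity_2d_pt (fun x t => a x * b t) x t).
  { intros a b Ha Hb x t. apply continuity_2d_pt_mult.
    - apply continuity_1d_2d_pt_comp; [apply continuity_pt_filterlim, Ha | apply continuity_2d_pt_id1].
    - apply continuity_1d_2d_pt_comp; [apply continuity_pt_filterlim, Hb | apply continuity_2d_pt_id2]. }
  induction n as [|n IH]; intros a b Ha Hb x t.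
  - split; [now apply C2 | exact I].
  - pose proof (smooth_upto_cont _ _ Ha) as Ca. pose proof (smooth_upto_cont _ _ Hb) as Cb.
    pose proof (smooth_upto_pred _ _ Ha) as Pa. pose proof (smooth_upto_pred _ _ Hb) as Pb.
    destruct Ha as [da [Da Sa]], Hb as [db [Db Sb]].
    assert (D1 : forall u v, is_derive (fun z => a z * b v) u (da u * b v)).
    { intros u v. eapply is_derive_eq; [apply der_mult; [apply Da | apply der_const]|]. simpl; rring. }
    assert (D2 : forall u v, is_derive (fun z => a u * b z) v (a u * db v)).
    { intros u v. eapply is_derive_eq; [apply der_mult; [apply der_const | apply Db]|]. simpl; rring. }
    split; [now apply C2|]. repeat split.
    + exists (da x * b t). apply D1.
    + exists (a x * db t). apply D2.
    + replace (fun u v => Derive (fun z => a z * b v) u) with (fun u v => da u * b v).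
      * now apply IH.
      * do 2 (apply functional_extensionality; intros). symmetry. apply is_derive_unique, D1.
    + replace (fun u v => Derive (fun z => a u * b z) v) with (fun u v => a u * db v).
      * now apply IH.
      * do 2 (apply functional_extensionality; intros). symmetry. apply is_derive_unique, D2.
Qed.

(** Testing with a(x) chi(t) leaves a weak ordinary differential equation in t for the moment of u
    against a - a''. Its right side is continuous in t, so it holds classically. *)
Lemma weak_solution_projection (f : R -> R) (u : R -> R -> R) (a da dda : R -> R) :
  CT u -> CT (fun x t => f (u x t)) -> distributional_solution f u ->
  (forall n, smooth_upto n a) -> periodic a ->
  (forall x, is_derive a x (da x)) -> (forall x, is_derive da x (dda x)) ->
  (forall x, continuous dda x) ->
  forall t, is_derive (fun t => RInt (fun x => u x t * (a x - dda x)) 0 (2 * PI)) t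
              (RInt (fun x => f (u x t) * da x) 0 (2 * PI)).
Proof.
  intros Hu Hf Hsol Sa Pa Da Dda Cdda.
  assert (Hpi := PI_RGT_0).
  assert (Ca : forall x, continuous a x) by (intros x; apply (derive_cont a x (da x)), Da).
  assert (Cda : forall x, continuous da x) by (intros x; apply (derive_cont da x (dda x)), Dda).
  apply weak_derivative_strong.
  - destruct (bounded_linear_weighted_RInt (fun x => a x - dda x) 0 (2 * PI)) as [k Hk];
      [lra | intros; auto with cont |].
    apply (bounded_linear_cont _ _ u Hk Hu).
  - destruct (bounded_linear_weighted_RInt da 0 (2 * PI)) as [k Hk]; [lra | auto |].
    apply (bounded_linear_cont _ _ _ Hk Hf).
  - intros M chi dchi Schi Dchi Cdchi Zchi.
    eapply eq_trans; [|apply (Hsol M (fun x t => a x * chi t))].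
    2:{ split; [|split].
        - intros n x t. now apply ex_diff_n_separated.
        - intros t x. now rewrite (Pa x).
        - intros x t Ht. rewrite Zchi by exact Ht. rring. }
    apply RInt_eq. intros t.
    assert (E0 : forall x, Derive (fun z => a x * chi z) t = a x * dchi t).
    { intros x. apply is_derive_unique. eapply is_derive_eq;
        [apply der_mult; [apply der_const | apply Dchi]|]. simpl; rring. }
    assert (E1 : forall c x, Derive (fun z => a z * c) x = da x * c).
    { intros c x. apply is_derive_unique. eapply is_derive_eq;
        [apply der_mult; [apply Da | apply der_const]|]. simpl; rring. }
    assert (E2 : forall c x, Derive (fun z => da z * c) x = dda x * c).
    { intros c x. apply is_derive_unique. eapply is_derive_eq;
        [apply der_mult; [apply Dda | apply der_const]|]. simpl; rring. }
    rewrite (RInt_eq (fun x => u x t * (partial_derive 0 1 (fun x0 t0 => a x0 * chi t0) x t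
        - partial_derive 2 1 (fun x0 t0 => a x0 * chi t0) x t)
        + f (u x t) * partial_derive 1 0 (fun x0 t0 => a x0 * chi t0) x t)
      (fun x => dchi t * (u x t * (a x - dda x)) + chi t * (f (u x t) * da x))).
    + assert (Cu := CT_cont_x u t Hu). assert (Cf := CT_cont_x _ t Hf). simpl in Cf.
      rewrite RInt_add, !RInt_scale; auto with cont.
    + intros x. unfold partial_derive. simpl.
      rewrite E0.
      replace (fun y => Derive (fun z => a y * chi z) t) with (fun y => a y * dchi t).
      * replace (Derive (fun y => a y * dchi t)) with (fun x => da x * dchi t).
        -- rewrite E2, E1. rring.
        -- apply functional_extensionality. intros y. now rewrite E1.
      * apply functional_extensionality. intros y. symmetry. apply is_derive_unique.
        eapply is_derive_eq; [apply der_mult; [apply der_const | apply Dchi]|]. simpl; rring.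
Qed.

(** Up to the factor [2 * PI], [cosc] is the real part and [sinc] the negated imaginary part of
    [fourier_coeff]; working with the pair avoids complex arithmetic. *)
Definition cosc (g : R -> R) (k : Z) : R := RInt (fun x => g x * cos (IZR k * x)) 0 (2 * PI).
Definition sinc (g : R -> R) (k : Z) : R := RInt (fun x => g x * sin (IZR k * x)) 0 (2 * PI).

Lemma trig_smooth (n : nat) : forall a b c,
  smooth_upto n (fun x => a * cos (c * x) + b * sin (c * x)).
Proof.
  induction n as [|n IH]; intros a b c.
  - intros x. auto 15 with cont.
  - exists (fun x => (b * c) * cos (c * x) + (- a * c) * sin (c * x)). split; [|apply IH].
    intros x. der. rring.
Qed.

Lemma cos_k_periodic (k : Z) : periodic (fun x => cos (IZR k * x)).
Proof.
  intros x. replace (IZR k * (x + 2 * PI)) with (IZR k * x + IZR k * (2 * PI)) by rring.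
  apply (periodic_Z cos). intros y. rewrite cos_plus, cos_2PI, sin_2PI. rring.
Qed.
Lemma sin_k_periodic (k : Z) : periodic (fun x => sin (IZR k * x)).
Proof.
  intros x. replace (IZR k * (x + 2 * PI)) with (IZR k * x + IZR k * (2 * PI)) by rring.
  apply (periodic_Z sin). intros y. rewrite sin_plus, cos_2PI, sin_2PI. rring.
Qed.

Lemma cper_cos_k (k : Z) : cper (fun x => cos (IZR k * x)).
Proof. split; [apply cos_k_periodic | intros; auto with cont]. Qed.
Lemma cper_sin_k (k : Z) : cper (fun x => sin (IZR k * x)).
Proof. split; [apply sin_k_periodic | intros; auto with cont]. Qed.

Lemma bounded_linear_moment (w : R -> R) :
  (forall x, continuous w x) -> (forall x, -1 <= w x <= 1) ->
  bounded_linear (2 * PI) (fun g => RInt (fun x => g x * w x) 0 (2 * PI)).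
Proof.
  intros Cw Hw. assert (Hpi := PI_RGT_0). repeat split; [lra| |].
  - intros g h c [_ Hg] [_ Hh].
    rewrite (RInt_eq _ (fun x => g x * w x + c * (h x * w x))) by (intros; rring).
    rewrite RInt_add, RInt_scale; auto 10 with cont.
  - intros g M [_ Hg] HM. replace (2 * PI * M) with ((2 * PI - 0) * M) by rring.
    apply RInt_abs_le; [lra | auto with cont |]. intros x _. rewrite Rabs_mult.
    specialize (HM x). assert (Rabs (w x) <= 1) by (apply Rabs_le, Hw).
    pose proof (Rabs_pos (w x)). pose proof (Rabs_pos (g x)). nra.
Qed.
Lemma bounded_linear_cosc (k : Z) : bounded_linear (2 * PI) (fun g => cosc g k).
Proof. apply bounded_linear_moment; [auto with cont | intros; apply COS_bound]. Qed.
Lemma bounded_linear_sinc (k : Z) : bounded_linear (2 * PI) (fun g => sinc g k).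
Proof. apply bounded_linear_moment; [auto with cont | intros; apply SIN_bound]. Qed.

Lemma cos_k_derive (k : Z) (x : R) : is_derive (fun x => cos (IZR k * x)) x (- IZR k * sin (IZR k * x)).
Proof. der. ring. Qed.
Lemma sin_k_derive (k : Z) (x : R) : is_derive (fun x => sin (IZR k * x)) x (IZR k * cos (IZR k * x)).
Proof. der. ring. Qed.

Lemma one_plus_sq_pos (z : R) : 0 < 1 + z ^ 2.
Proof. pose proof (pow2_ge_0 z). lra. Qed.

(** For an eigenfunction e'' = - z^2 e the weight e - e'' is (1 + z^2) e, so inverting 1 - d_x^2 on
    this mode is a division. One statement covers cosines and sines. *)
Lemma moment_derive (f : R -> R) (u : R -> R -> R) (z : R) (e de : R -> R) :
  CT u -> CT (fun x t => f (u x t)) -> distributional_solution f u ->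
  (forall n, smooth_upto n e) -> periodic e ->
  (forall x, is_derive e x (de x)) -> (forall x, is_derive de x (- z ^ 2 * e x)) ->
  forall t, is_derive (fun t => RInt (fun x => u x t * e x) 0 (2 * PI)) t
              (RInt (fun x => f (u x t) * de x) 0 (2 * PI) / (1 + z ^ 2)).
Proof.
  intros Hu Hf Hsol Se Pe De Dde t. pose proof (one_plus_sq_pos z) as Hz.
  assert (Ce : forall x, continuous e x) by apply (Se 0%nat).
  apply (is_derive_ext (fun t => RInt (fun x => u x t * (e x - - z ^ 2 * e x)) 0 (2 * PI) / (1 + z ^ 2))).
  { intros s. assert (Cu := CT_cont_x u s Hu). simpl in Cu.
    rewrite (RInt_eq _ (fun x => (1 + z ^ 2) * (u x s * e x))) by (intros; rring).
    rewrite RInt_scale by auto with cont. rfield. lra. }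
  apply der_div. apply (weak_solution_projection f u e de (fun x => - z ^ 2 * e x)); auto with cont.
Qed.

Lemma cosc_derive (f : R -> R) (u : R -> R -> R) (k : Z) :
  CT u -> CT (fun x t => f (u x t)) -> distributional_solution f u ->
  forall t, is_derive (fun t => cosc (fun x => u x t) k) t
              (- IZR k * sinc (fun x => f (u x t)) k / (1 + IZR k ^ 2)).
Proof.
  intros Hu Hf Hsol t. assert (Cf := CT_cont_x _ t Hf). simpl in Cf.
  eapply is_derive_eq; [apply (moment_derive f u (IZR k) _ (fun x => - IZR k * sin (IZR k * x)) Hu Hf Hsol)|].
  - intros n. replace (fun x => cos (IZR k * x)) with (fun x => 1 * cos (IZR k * x) + 0 * sin (IZR k * x))
      by (apply functional_extensionality; intros; rring). apply trig_smooth.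
  - apply cos_k_periodic.
  - apply cos_k_derive.
  - intros x. der. rring.
  - rewrite (RInt_eq _ (fun x => - IZR k * (f (u x t) * sin (IZR k * x)))) by (intros; rring).
    rewrite RInt_scale by auto with cont. reflexivity.
Qed.

Lemma sinc_derive (f : R -> R) (u : R -> R -> R) (k : Z) :
  CT u -> CT (fun x t => f (u x t)) -> distributional_solution f u ->
  forall t, is_derive (fun t => sinc (fun x => u x t) k) t
              (IZR k * cosc (fun x => f (u x t)) k / (1 + IZR k ^ 2)).
Proof.
  intros Hu Hf Hsol t. assert (Cf := CT_cont_x _ t Hf). simpl in Cf.
  eapply is_derive_eq; [apply (moment_derive f u (IZR k) _ (fun x => IZR k * cos (IZR k * x)) Hu Hf Hsol)|].
  - intros n. replace (fun x => sin (IZR k * x)) with (fun x => 0 * cos (IZR k * x) + 1 * sin (IZR k * x))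
      by (apply functional_extensionality; intros; rring). apply trig_smooth.
  - apply sin_k_periodic.
  - apply sin_k_derive.
  - intros x. der. rring.
  - rewrite (RInt_eq _ (fun x => IZR k * (f (u x t) * cos (IZR k * x)))) by (intros; rring).
    rewrite RInt_scale by auto with cont. reflexivity.
Qed.

(** * Fourier series *)

Lemma RInt_period_shift (g : R -> R) (a : R) :
  cper g -> RInt g a (a + 2 * PI) = RInt g 0 (2 * PI).
Proof.
  intros [Pg Cg]. set (G := fun x => RInt g 0 x).
  assert (DG : forall x, is_derive G x (g x)) by (intros; now apply der_RInt).
  assert (E : forall a, RInt g a (a + 2 * PI) = G (a + 2 * PI) - G a)
    by (intros b; apply RInt_antideriv; auto).
  transitivity (G (a + 2 * PI) - G a); [apply E|].
  assert (E0 : RInt g 0 (2 * PI) = G (0 + 2 * PI) - G 0) by (rewrite Rplus_0_l; now apply RInt_antideriv).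
  transitivity (G (0 + 2 * PI) - G 0); [|symmetry; exact E0].
  apply (derive_zero_const (fun x => G (x + 2 * PI) - G x)).
  intros x _. eapply is_derive_eq.
  - apply der_minus; [|apply DG].
    apply (der_comp (fun x => x + 2 * PI) G x 1); [der; rring | apply DG].
  - rewrite (Pg x). rring.
Qed.

Definition coefs_vanish (g : R -> R) : Prop := forall k, cosc g k = 0 /\ sinc g k = 0.

(** A factor of degree one only mixes the frequencies k - 1, k and k + 1. Iteration handles all
    powers of a peaked kernel without expanding them. *)
Lemma coefs_vanish_mult_trig (g : R -> R) (al c s : R) :
  cper g -> coefs_vanish g -> coefs_vanish (fun x => g x * (al + c * cos x + s * sin x)).
Proof.
  intros [_ Cg] V k.
  destruct (V k) as [C0 S0]. destruct (V (k + 1)%Z) as [C1 S1]. destruct (V (k - 1)%Z) as [C2 S2].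
  unfold cosc, sinc in *. rewrite plus_IZR in *. rewrite minus_IZR in *.
  set (z := IZR k) in *.
  assert (Tp : forall x, cos ((z + 1) * x) = cos (z * x) * cos x - sin (z * x) * sin x).
  { intros x. rewrite <- cos_plus. f_equal. ring. }
  assert (Tm : forall x, cos ((z - 1) * x) = cos (z * x) * cos x + sin (z * x) * sin x).
  { intros x. rewrite <- cos_minus. f_equal. ring. }
  assert (Up : forall x, sin ((z + 1) * x) = sin (z * x) * cos x + cos (z * x) * sin x).
  { intros x. rewrite <- sin_plus. f_equal. ring. }
  assert (Um : forall x, sin ((z - 1) * x) = sin (z * x) * cos x - cos (z * x) * sin x).
  { intros x. rewrite <- sin_minus. f_equal. ring. }
  assert (K : forall (a0 a1 a2 : R) (f0 f1 f2 : R -> R),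
     (forall x, continuous f0 x) -> (forall x, continuous f1 x) -> (forall x, continuous f2 x) ->
     RInt (fun x => a0 * f0 x + (a1 * f1 x + a2 * f2 x)) 0 (2 * PI)
     = a0 * RInt f0 0 (2 * PI) + (a1 * RInt f1 0 (2 * PI) + a2 * RInt f2 0 (2 * PI))).
  { intros. rewrite RInt_add, RInt_add, !RInt_scale; auto 10 with cont. }
  split.
  - rewrite (RInt_eq _ (fun x => 1 * (al * (g x * cos (z * x)) +
       (c / 2 * (g x * cos ((z + 1) * x)) + c / 2 * (g x * cos ((z - 1) * x)))) +
       (s / 2 * (g x * sin ((z + 1) * x)) + (- s / 2) * (g x * sin ((z - 1) * x))))).
    + rewrite (K 1 (s / 2) (- s / 2)), K, C0, C1, C2, S1, S2; [rring | ..]; auto 15 with cont.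
    + intros x. rewrite Tp, Tm, Up, Um. rfield.
  - rewrite (RInt_eq _ (fun x => 1 * (al * (g x * sin (z * x)) +
       (c / 2 * (g x * sin ((z + 1) * x)) + c / 2 * (g x * sin ((z - 1) * x)))) +
       ((- s / 2) * (g x * cos ((z + 1) * x)) + (s / 2) * (g x * cos ((z - 1) * x))))).
    + rewrite (K 1 (- s / 2) (s / 2)), K, S0, C1, C2, S1, S2; [rring | ..]; auto 15 with cont.
    + intros x. rewrite Tp, Tm, Up, Um. rfield.
Qed.

Lemma cos_Rabs (y : R) : cos (Rabs y) = cos y.
Proof. unfold Rabs. destruct (Rcase_abs y); [apply cos_neg | reflexivity]. Qed.

(* The powers of T = 1 + cos (x - x0) - cos d blow up near x0 and stay bounded by 1 at distance >= d. *)
Lemma coefs_vanish_nonpos (g : R -> R) (x0 : R) :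
  cper g -> coefs_vanish g -> g x0 <= 0.
Proof.
  intros Hg V. apply Rnot_lt_le. intros Hpos. assert (Hpi := PI_RGT_0).
  pose proof Hg as [Pg Cg].
  destruct (cper_bounded g Hg) as [M [HM HgM]].
  destruct (eps_continuous g x0 (g x0 / 2) (Cg x0)) as [d0 [Hd0 Hnear]]; [lra|].
  set (d := Rmin (d0 / 2) 1).
  assert (Hd : 0 < d /\ d < d0 /\ d <= 1).
  { unfold d. pose proof (Rmin_l (d0 / 2) 1). pose proof (Rmin_r (d0 / 2) 1).
    split; [apply Rmin_glb_lt; lra | lra]. }
  assert (Hd1 : d < PI) by (pose proof PI2_3_2; lra).
  set (eta := g x0 / 2).
  assert (Hge : forall x, Rabs (x - x0) <= d -> eta <= g x).
  { intros x Hx. specialize (Hnear x ltac:(lra)). apply Rabs_def2 in Hnear. unfold eta. lra. }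
  set (T := fun x => (1 - cos d) + cos x0 * cos x + sin x0 * sin x).
  assert (HT : forall x, T x = 1 + cos (x - x0) - cos d).
  { intros x. unfold T. rewrite cos_minus. ring. }
  assert (CT' : cper T).
  { split; [|intros; unfold T; auto 10 with cont]. intros x. rewrite !HT.
    replace (x + 2 * PI - x0) with ((x - x0) + 2 * PI) by ring.
    rewrite cos_plus, cos_2PI, sin_2PI. ring. }
  assert (Hn : forall n, cper (fun x => g x * T x ^ n) /\ coefs_vanish (fun x => g x * T x ^ n)).
  { induction n as [|n [IH1 IH2]].
    - simpl. replace (fun x => g x * 1) with g by (apply functional_extensionality; intros; ring).
      now split.
    - replace (fun x => g x * T x ^ S n) with (fun x => (g x * T x ^ n) * T x)
        by (apply functional_extensionality; intros; simpl; ring).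
      split; [now apply (cper_mult (fun x => g x * T x ^ n))|].
      now apply (coefs_vanish_mult_trig (fun x => g x * T x ^ n)). }
  set (rho := 1 + cos (d / 2) - cos d).
  assert (Hrho : 1 < rho).
  { assert (cos d < cos (d / 2)) by (apply cos_decreasing_1; lra). unfold rho. lra. }
  assert (Tbig : forall x, Rabs (x - x0) <= d / 2 -> rho <= T x).
  { intros x Hx. rewrite HT, <- cos_Rabs. unfold rho.
    assert (cos (d / 2) <= cos (Rabs (x - x0))); [|lra].
    pose proof (Rabs_pos (x - x0)). apply cos_decr_1; lra. }
  assert (Tpos : forall x, Rabs (x - x0) <= d -> 0 <= T x).
  { intros x Hx. rewrite HT, <- cos_Rabs.
    assert (cos d <= cos (Rabs (x - x0))); [|lra].
    pose proof (Rabs_pos (x - x0)). apply cos_decr_1; lra. }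
  assert (Tsmall : forall x, d <= Rabs (x - x0) <= PI -> Rabs (T x) <= 1).
  { intros x Hx. rewrite HT, <- cos_Rabs.
    assert (cos (Rabs (x - x0)) <= cos d) by (apply cos_decr_1; lra).
    pose proof (COS_bound (Rabs (x - x0))). 
    assert (0 < cos d) by (apply cos_gt_0; pose proof PI2_3_2; lra).
    pose proof (COS_bound d). apply Rabs_le. lra. }
  assert (Hlow : forall n x, x0 - PI <= x <= x0 + PI -> - M <= g x * T x ^ n).
  { intros n x Hx. destruct (Rle_dec (Rabs (x - x0)) d) as [Hle|Hgt].
    - assert (0 <= g x * T x ^ n); [|lra]. specialize (Hge x Hle).
      apply Rmult_le_pos; [unfold eta in Hge; lra | apply pow_le; now apply Tpos].
    - assert (Hx' : Rabs (x - x0) <= PI) by (apply Rabs_le; lra).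
      specialize (Tsmall x ltac:(lra)).
      assert (Rabs (g x * T x ^ n) <= M * 1).
      { rewrite Rabs_mult, <- RPow_abs. apply Rmult_le_compat; try apply Rabs_pos; auto.
        - apply pow_le, Rabs_pos.
        - rewrite <- (pow1 n). apply pow_incr. split; [apply Rabs_pos | exact Tsmall]. }
      apply Rabs_le_between in H. lra. }
  assert (Hmid : forall n x, x0 - d / 2 <= x <= x0 + d / 2 -> eta * rho ^ n <= g x * T x ^ n).
  { intros n x Hx. assert (Hx' : Rabs (x - x0) <= d / 2) by (apply Rabs_le; lra).
    apply Rmult_le_compat.
    - unfold eta; lra.
    - apply pow_le; lra.
    - apply Hge; lra.
    - apply pow_incr. specialize (Tbig x Hx'). lra. }
  (* Over one period [g * T ^ n] integrates to its zeroth coefficient, which is 0. The middle piece,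
     of length [d], contributes at least [eta * rho ^ n * d], and the outer pieces lose at most [M]
     per unit length. *)
  assert (Hint : forall n, eta * rho ^ n * d <= 2 * PI * M).
  { intros n. destruct (Hn n) as [[P' C'] V'].
    set (h := fun x => g x * T x ^ n) in *.
    assert (Z : RInt h (x0 - PI) (x0 + PI) = 0).
    { replace (x0 + PI) with (x0 - PI + 2 * PI) by ring. rewrite RInt_period_shift by (now split).
      destruct (V' 0%Z) as [Z _]. eapply eq_trans; [|exact Z]. apply RInt_eq.
      intros x. rewrite Rmult_0_l, cos_0. rring. }
    rewrite (RInt_split h _ (x0 - d / 2)), (RInt_split h (x0 - d / 2) (x0 + d / 2)) in Z by auto.
    assert (A1 : RInt (fun _ => - M) (x0 - PI) (x0 - d / 2) <= RInt h (x0 - PI) (x0 - d / 2)).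
    { apply RInt_mono; auto with cont; [lra|]. intros; apply Hlow; lra. }
    assert (A2 : RInt (fun _ => - M) (x0 + d / 2) (x0 + PI) <= RInt h (x0 + d / 2) (x0 + PI)).
    { apply RInt_mono; auto with cont; [lra|]. intros; apply Hlow; lra. }
    assert (A3 : RInt (fun _ => eta * rho ^ n) (x0 - d / 2) (x0 + d / 2) <= RInt h (x0 - d / 2) (x0 + d / 2)).
    { apply RInt_mono; auto with cont; [lra|]. intros; apply Hmid; lra. }
    rewrite RInt_const_R in A1, A2, A3.
    nra. }
  assert (He : 0 < eta) by (unfold eta; lra).
  (* Bernoulli gives rho^n >= 1 + n (rho - 1), so this [n] contradicts [Hint]. *)
  destruct (INR_unbounded (2 * PI * M / (eta * d * (rho - 1)))) as [n Hn'].
  specialize (Hint n).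
  pose proof (poly n (rho - 1) ltac:(lra)) as Hb. replace (1 + (rho - 1)) with rho in Hb by ring.
  assert (Hp : 0 < eta * d * (rho - 1)) by (apply Rmult_lt_0_compat; [apply Rmult_lt_0_compat|]; lra).
  apply (Rmult_lt_compat_r _ _ _ Hp) in Hn'.
  replace (2 * PI * M / (eta * d * (rho - 1)) * (eta * d * (rho - 1))) with (2 * PI * M) in Hn'
    by (field; repeat split; lra).
  assert (Hed : 0 < eta * d) by (apply Rmult_lt_0_compat; lra).
  nra.
Qed.

Theorem fourier_uniqueness (g : R -> R) :
  cper g -> coefs_vanish g -> forall x, g x = 0.
Proof.
  intros Hg V x.
  assert (H1 := coefs_vanish_nonpos g x Hg V).
  assert (V' : coefs_vanish (fun x => -1 * g x)).
  { intros k. destruct (V k) as [Vc Vs].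
    rewrite (bounded_linear_scal _ (fun h => cosc h k) (-1) g (bounded_linear_cosc k) Hg).
    rewrite (bounded_linear_scal _ (fun h => sinc h k) (-1) g (bounded_linear_sinc k) Hg).
    rewrite Vc, Vs. split; ring. }
  assert (H2 := coefs_vanish_nonpos _ x (cper_scal (-1) g Hg) V'). simpl in H2. lra.
Qed.

Lemma cosc_opp (g : R -> R) (k : Z) : cosc g (- k) = cosc g k.
Proof.
  apply RInt_eq. intros x. rewrite opp_IZR.
  replace (- IZR k * x) with (- (IZR k * x)) by ring. now rewrite cos_neg.
Qed.
Lemma sinc_opp (g : R -> R) (k : Z) : cper g -> sinc g (- k) = - sinc g k.
Proof.
  intros [_ Cg]. unfold sinc. replace (- RInt (fun x => g x * sin (IZR k * x)) 0 (2 * PI))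
    with (-1 * RInt (fun x => g x * sin (IZR k * x)) 0 (2 * PI)) by rring.
  rewrite <- RInt_scale by auto with cont. apply RInt_eq. intros x. rewrite opp_IZR.
  replace (- IZR k * x) with (- (IZR k * x)) by ring. rewrite sin_neg. rring.
Qed.

Lemma coefs_vanish_nat (g : R -> R) : cper g ->
  (forall n : nat, cosc g (Z.of_nat n) = 0 /\ sinc g (Z.of_nat n) = 0) -> coefs_vanish g.
Proof.
  intros Hg H k. destruct (Z_le_gt_dec 0 k) as [Hk|Hk].
  - rewrite <- (Z2Nat.id k) by lia. apply H.
  - replace k with (- Z.of_nat (Z.to_nat (- k)))%Z by lia.
    rewrite cosc_opp, sinc_opp by exact Hg.
    destruct (H (Z.to_nat (- k))) as [-> ->]. split; ring.
Qed.

Lemma RInt_cos_k (k : Z) :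
  RInt (fun x => cos (IZR k * x)) 0 (2 * PI) = if Z.eq_dec k 0 then 2 * PI else 0.
Proof.
  destruct (Z.eq_dec k 0) as [->|Hk].
  - rewrite (RInt_eq _ (fun _ => 1)).
    + rewrite RInt_const_R. rring.
    + intros x. now rewrite Rmult_0_l, cos_0.
  - assert (IZR k <> 0) by (now apply not_0_IZR).
    rewrite (RInt_antideriv (fun x => sin (IZR k * x) / IZR k)).
    + assert (E := sin_k_periodic k 0). simpl in E. rewrite Rplus_0_l in E. rewrite E. rring.
    + intros x. der. field. auto.
    + intros; auto with cont.
Qed.
Lemma RInt_sin_k (k : Z) : RInt (fun x => sin (IZR k * x)) 0 (2 * PI) = 0.
Proof.
  destruct (Z.eq_dec k 0) as [->|Hk].
  - rewrite (RInt_eq _ (fun _ => 0)).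
    + rewrite RInt_const_R. rring.
    + intros x. now rewrite Rmult_0_l, sin_0.
  - assert (IZR k <> 0) by (now apply not_0_IZR).
    rewrite (RInt_antideriv (fun x => - cos (IZR k * x) / IZR k)).
    + assert (E := cos_k_periodic k 0). simpl in E. rewrite Rplus_0_l in E. rewrite E. rring.
    + intros x. der. field. auto.
    + intros; auto with cont.
Qed.

Lemma trig_orthogonality (m n : nat) : (0 < m)%nat ->
  cosc (fun x => cos (IZR (Z.of_nat m) * x)) (Z.of_nat n) = (if Nat.eq_dec m n then PI else 0) /\
  sinc (fun x => sin (IZR (Z.of_nat m) * x)) (Z.of_nat n) = (if Nat.eq_dec m n then PI else 0) /\
  sinc (fun x => cos (IZR (Z.of_nat m) * x)) (Z.of_nat n) = 0 /\
  cosc (fun x => sin (IZR (Z.of_nat m) * x)) (Z.of_nat n) = 0.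
Proof.
  intros Hm. unfold cosc, sinc.
  assert (K : forall (c1 c2 : R) (h1 h2 h : R -> R), (forall x, continuous h1 x) -> (forall x, continuous h2 x) ->
    (forall x, h x = c1 * h1 x + c2 * h2 x) ->
    RInt h 0 (2 * PI) = c1 * RInt h1 0 (2 * PI) + c2 * RInt h2 0 (2 * PI)).
  { intros c1 c2 h1 h2 h C1 C2 H. rewrite (RInt_eq h _ _ _ H), RInt_add, !RInt_scale; auto with cont. }
  set (cp := fun x => cos (IZR (Z.of_nat m + Z.of_nat n) * x)).
  set (cm := fun x => cos (IZR (Z.of_nat m - Z.of_nat n) * x)).
  set (sp := fun x => sin (IZR (Z.of_nat m + Z.of_nat n) * x)).
  set (sm := fun x => sin (IZR (Z.of_nat m - Z.of_nat n) * x)).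
  repeat split; [rewrite (K (/ 2) (/ 2) cp cm) | rewrite (K (- / 2) (/ 2) cp cm)
    | rewrite (K (/ 2) (- / 2) sp sm) | rewrite (K (/ 2) (/ 2) sp sm)];
    try (intros x; unfold cp, cm, sp, sm; auto with cont; fail);
    try (intros x; unfold cp, cm, sp, sm; rewrite plus_IZR, minus_IZR, Rmult_plus_distr_r,
      Rmult_minus_distr_r, ?cos_plus, ?cos_minus, ?sin_plus, ?sin_minus; rfield; fail);
    unfold cp, cm, sp, sm; rewrite ?RInt_cos_k, ?RInt_sin_k;
    destruct (Z.eq_dec (Z.of_nat m + Z.of_nat n) 0); try lia;
    destruct (Nat.eq_dec m n), (Z.eq_dec (Z.of_nat m - Z.of_nat n) 0); try lia; rfield.
Qed.

Definition trig_term (a b : nat -> R) (n : nat) (x : R) : R :=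
  a n * cos (IZR (Z.of_nat n) * x) + b n * sin (IZR (Z.of_nat n) * x).

Fixpoint trig_poly (c0 : R) (a b : nat -> R) (N : nat) (x : R) : R :=
  match N with
  | O => c0
  | S n => trig_poly c0 a b n x + trig_term a b (S n) x
  end.

Lemma trig_term_cper (a b : nat -> R) (n : nat) : cper (trig_term a b n).
Proof.
  apply (cper_plus (fun x => a n * cos (IZR (Z.of_nat n) * x)) (fun x => b n * sin (IZR (Z.of_nat n) * x)));
  apply cper_scal; [apply cper_cos_k | apply cper_sin_k].
Qed.
Lemma trig_poly_cper (c0 : R) (a b : nat -> R) (N : nat) : cper (trig_poly c0 a b N).
Proof.
  induction N as [|N IH]; [apply cper_const|].
  apply (cper_plus (trig_poly c0 a b N) (trig_term a b (S N))); [exact IH | apply trig_term_cper].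
Qed.

Lemma bounded_linear_add (kappa : R) (Lam : (R -> R) -> R) (g h : R -> R) :
  bounded_linear kappa Lam -> cper g -> cper h -> Lam (fun x => g x + h x) = Lam g + Lam h.
Proof.
  intros [_ [HL _]] Hg Hh.
  replace (fun x => g x + h x) with (fun x => g x + 1 * h x)
    by (apply functional_extensionality; intros; ring).
  rewrite HL by auto. ring.
Qed.

Lemma trig_term_coefs (a b : nat -> R) (m n : nat) : (0 < m)%nat ->
  cosc (trig_term a b m) (Z.of_nat n) = (if Nat.eq_dec m n then PI * a m else 0) /\
  sinc (trig_term a b m) (Z.of_nat n) = (if Nat.eq_dec m n then PI * b m else 0).
Proof.
  intros Hm. unfold trig_term.
  pose proof (cper_cos_k (Z.of_nat m)) as Cc. pose proof (cper_sin_k (Z.of_nat m)) as Cs.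
  rewrite (bounded_linear_add _ (fun h => cosc h (Z.of_nat n))
    (fun x => a m * cos (IZR (Z.of_nat m) * x)) (fun x => b m * sin (IZR (Z.of_nat m) * x))
    (bounded_linear_cosc _)) by (now apply cper_scal).
  rewrite (bounded_linear_add _ (fun h => sinc h (Z.of_nat n))
    (fun x => a m * cos (IZR (Z.of_nat m) * x)) (fun x => b m * sin (IZR (Z.of_nat m) * x))
    (bounded_linear_sinc _)) by (now apply cper_scal).
  rewrite !(bounded_linear_scal _ (fun h => cosc h (Z.of_nat n)) _ _ (bounded_linear_cosc _)) by auto.
  rewrite !(bounded_linear_scal _ (fun h => sinc h (Z.of_nat n)) _ _ (bounded_linear_sinc _)) by auto.
  destruct (trig_orthogonality m n Hm) as [-> [-> [-> ->]]].
  destruct (Nat.eq_dec m n); split; ring.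
Qed.

Lemma trig_poly_coefs_S (c0 : R) (a b : nat -> R) (N : nat) (k : Z) :
  cosc (trig_poly c0 a b (S N)) k = cosc (trig_poly c0 a b N) k + cosc (trig_term a b (S N)) k /\
  sinc (trig_poly c0 a b (S N)) k = sinc (trig_poly c0 a b N) k + sinc (trig_term a b (S N)) k.
Proof.
  split.
  - apply (bounded_linear_add _ (fun h => cosc h k) _ _ (bounded_linear_cosc k));
      [apply trig_poly_cper | apply trig_term_cper].
  - apply (bounded_linear_add _ (fun h => sinc h k) _ _ (bounded_linear_sinc k));
      [apply trig_poly_cper | apply trig_term_cper].
Qed.

Lemma trig_poly_coefs_high (c0 : R) (a b : nat -> R) (n N : nat) : (N < n)%nat ->
  cosc (trig_poly c0 a b N) (Z.of_nat n) = 0 /\ sinc (trig_poly c0 a b N) (Z.of_nat n) = 0.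
Proof.
  induction N as [|N IH]; intros Hn.
  - cbn [trig_poly]. unfold cosc, sinc. rewrite !RInt_scale by auto with cont.
    rewrite RInt_cos_k, RInt_sin_k. destruct (Z.eq_dec (Z.of_nat n) 0); [lia|]. split; rring.
  - destruct (trig_poly_coefs_S c0 a b N (Z.of_nat n)) as [-> ->].
    destruct (IH ltac:(lia)) as [-> ->].
    destruct (trig_term_coefs a b (S N) n ltac:(lia)) as [-> ->].
    destruct (Nat.eq_dec (S N) n); [lia|]. split; ring.
Qed.

Lemma trig_poly_coefs_low (c0 : R) (a b : nat -> R) (n N : nat) : (0 < n <= N)%nat ->
  cosc (trig_poly c0 a b N) (Z.of_nat n) = PI * a n /\
  sinc (trig_poly c0 a b N) (Z.of_nat n) = PI * b n.
Proof.
  intros Hn. induction N as [|N IH]; [lia|].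
  destruct (trig_poly_coefs_S c0 a b N (Z.of_nat n)) as [-> ->].
  destruct (trig_term_coefs a b (S N) n ltac:(lia)) as [-> ->].
  destruct (Nat.eq_dec (S N) n) as [<-|Hne].
  - destruct (trig_poly_coefs_high c0 a b (S N) N ltac:(lia)) as [-> ->]. split; ring.
  - destruct (IH ltac:(lia)) as [-> ->]. split; ring.
Qed.

Lemma trig_poly_coef_0 (c0 : R) (a b : nat -> R) (N : nat) :
  cosc (trig_poly c0 a b N) 0 = 2 * PI * c0.
Proof.
  induction N as [|N IH].
  - simpl. unfold cosc. rewrite (RInt_eq _ (fun _ => c0)).
    + rewrite RInt_const_R. rring.
    + intros x. rewrite Rmult_0_l, cos_0. rring.
  - rewrite (proj1 (trig_poly_coefs_S c0 a b N 0)), IH.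
    destruct (trig_term_coefs a b (S N) 0 ltac:(lia)) as [E _].
    change 0%Z with (Z.of_nat 0). rewrite E.
    destruct (Nat.eq_dec (S N) 0); [lia|]. ring.
Qed.

Definition fourier_sum (g : R -> R) (N : nat) : R -> R :=
  trig_poly (cosc g 0 / (2 * PI)) (fun n => cosc g (Z.of_nat n) / PI) (fun n => sinc g (Z.of_nat n) / PI) N.

Lemma sinc_0 (g : R -> R) : sinc g 0 = 0.
Proof.
  unfold sinc. rewrite (RInt_eq _ (fun _ => 0)).
  - rewrite RInt_const_R. rring.
  - intros x. rewrite Rmult_0_l, sin_0. rring.
Qed.

Lemma fourier_sum_coefs (g : R -> R) (n N : nat) : (n <= N)%nat ->
  cosc (fourier_sum g N) (Z.of_nat n) = cosc g (Z.of_nat n) /\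
  sinc (fourier_sum g N) (Z.of_nat n) = sinc g (Z.of_nat n).
Proof.
  assert (Hpi := PI_RGT_0). intros Hn. destruct n as [|n].
  - simpl Z.of_nat. unfold fourier_sum. rewrite trig_poly_coef_0, !sinc_0. split; [field; lra | reflexivity].
  - unfold fourier_sum. destruct (trig_poly_coefs_low (cosc g 0 / (2 * PI))
      (fun n => cosc g (Z.of_nat n) / PI) (fun n => sinc g (Z.of_nat n) / PI) (S n) N ltac:(lia)) as [-> ->].
    split; field; lra.
Qed.

Lemma trig_term_abs (a b : nat -> R) (n : nat) (x : R) : Rabs (trig_term a b n x) <= Rabs (a n) + Rabs (b n).
Proof.
  unfold trig_term. eapply Rle_trans; [apply Rabs_triang|]. rewrite !Rabs_mult.
  set (y := IZR (Z.of_nat n) * x). pose proof (COS_bound y). pose proof (SIN_bound y).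
  assert (Rabs (cos y) <= 1) by (apply Rabs_le; lra). assert (Rabs (sin y) <= 1) by (apply Rabs_le; lra).
  pose proof (Rabs_pos (a n)). pose proof (Rabs_pos (b n)). nra.
Qed.

Lemma series_tail_small (m : nat -> R) : ex_series m ->
  forall eps, 0 < eps -> exists N0, forall N, (N0 <= N)%nat -> Rabs (Series (fun n => m (N + n)%nat)) < eps.
Proof.
  intros Hm eps He.
  assert (L : is_lim_seq (fun n => sum_f_R0 m n) (Series m)).
  { apply (is_lim_seq_ext (sum_n m)); [apply sum_n_Reals|]. apply (Series_correct m Hm). }
  apply is_lim_seq_spec in L. destruct (L (mkposreal eps He)) as [N0 H0]. simpl in H0.
  exists (S N0). intros N HN. destruct N as [|N]; [lia|].
  specialize (H0 N ltac:(lia)).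
  rewrite (Series_incr_n m (S N)) in H0 by (lia || exact Hm). simpl pred in H0.
  rewrite Rabs_minus_sym in H0.
  match type of H0 with Rabs (?a + ?b - ?a) < _ => replace (a + b - a) with b in H0 by ring end.
  exact H0.
Qed.

(** The Weierstrass test gives a continuous sum [G]. Coefficients are bounded functionals, so those
    of [G] are limits of those of the partial sums and agree with those of g; uniqueness yields g =
    G. Since [m n] dominates the mode [S n], the error after [N] modes is the tail that starts at
    [m N]. *)
Lemma fourier_series_cv (g : R -> R) (m : nat -> R) :
  cper g -> ex_series m ->
  (forall n, Rabs (cosc g (Z.of_nat (S n)) / PI) + Rabs (sinc g (Z.of_nat (S n)) / PI) <= m n) ->
  (forall x, g x = cosc g 0 / (2 * PI) + Series (fun n =>
     trig_term (fun n => cosc g (Z.of_nat n) / PI) (fun n => sinc g (Z.of_nat n) / PI) (S n) x)) /\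
  forall N x, Rabs (g x - fourier_sum g N x) <= Series (fun n => m (N + n)%nat).
Proof.
  intros Hg Hm Hb. assert (Hpi := PI_RGT_0).
  set (a := fun n => cosc g (Z.of_nat n) / PI). set (b := fun n => sinc g (Z.of_nat n) / PI).
  assert (Htb : forall n x, Rabs (trig_term a b (S n) x) <= m n).
  { intros n x. exact (Rle_trans _ _ _ (trig_term_abs a b (S n) x) (Hb n)). }
  assert (Hex : forall x, ex_series (fun n => trig_term a b (S n) x)).
  { intros x. now apply (ex_series_dominated _ m). }
  set (G := fun x => cosc g 0 / (2 * PI) + Series (fun n => trig_term a b (S n) x)).
  assert (Hmt : forall N, ex_series (fun n => m (N + n)%nat)).
  { intros N. now apply (ex_series_incr_n m N). }
  assert (Htail : forall N x, G x - fourier_sum g N x = Series (fun n => trig_term a b (S (N + n)) x)).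
  { induction N as [|N IH]; intros x.
    - unfold G, fourier_sum. simpl. ring.
    - unfold fourier_sum. simpl. fold a b. specialize (IH x). unfold fourier_sum in IH. fold a b in IH.
      rewrite (Series_incr_1 (fun n => trig_term a b (S (N + n)) x)) in IH.
      + rewrite Nat.add_0_r in IH.
        rewrite (Series_ext _ (fun k => trig_term a b (S (N + S k)) x))
          by (intros n; f_equal; lia). lra.
      + apply (ex_series_incr_n (fun n => trig_term a b (S n) x) N). apply Hex. }
  assert (HGN : forall N x, Rabs (G x - fourier_sum g N x) <= Series (fun n => m (N + n)%nat)).
  { intros N x. rewrite Htail. eapply Rle_trans; [apply Series_Rabs|].
    - apply (ex_series_dominated _ (fun n => m (N + n)%nat)); [|apply Hmt].
      intros n. rewrite Rabs_Rabsolu. apply Htb.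
    - apply Series_le; [|apply Hmt]. intros n. split; [apply Rabs_pos | apply Htb]. }
  assert (Hps : forall N, cper (fourier_sum g N)) by (intros; apply trig_poly_cper).
  assert (HG : cper G).
  { split.
    - intros x. unfold G. f_equal. apply Series_ext. intros n. apply (trig_term_cper a b (S n)).
    - intros x. apply continuous_eps. intros eps He.
      destruct (series_tail_small m Hm (eps / 3) ltac:(lra)) as [N HN].
      specialize (HN N (le_n N)). pose proof (Rle_abs (Series (fun n => m (N + n)%nat))).
      destruct (Hps N) as [_ CN].
      destruct (eps_continuous _ x (eps / 3) (CN x) ltac:(lra)) as [d [Hd Hd']].
      exists d. split; [exact Hd|]. intros y Hy. specialize (Hd' y Hy).
      pose proof (HGN N x). pose proof (HGN N y).
      replace (G y - G x) with ((G y - fourier_sum g N y) + ((fourier_sum g N y - fourier_sum g N x) + - (G x - fourier_sum g N x))) by ring.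
      eapply Rle_trans; [apply Rabs_triang|].
      eapply Rle_trans; [apply Rplus_le_compat_l, Rabs_triang|]. rewrite Rabs_Ropp. lra. }
  assert (HgG : forall x, g x - G x = 0).
  { apply fourier_uniqueness; [now apply cper_minus|].
    apply coefs_vanish_nat; [now apply cper_minus|]. intros n.
    assert (Hsmall : forall Lam, bounded_linear (2 * PI) Lam ->
        (forall N, (n <= N)%nat -> Lam (fourier_sum g N) = Lam g) -> Lam (fun x => g x - G x) = 0).
    { intros Lam HL Hc. apply cond_eq. intros eps He. rewrite Rminus_0_r.
      destruct (series_tail_small m Hm (eps / (2 * PI + 1)) ltac:(apply Rdiv_lt_0_compat; lra)) as [N0 HN].
      set (N := Nat.max N0 n). specialize (HN N ltac:(lia)).
      pose proof (Rle_abs (Series (fun n => m (N + n)%nat))).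
      rewrite (bounded_linear_minus _ Lam g G HL Hg HG), <- (Hc N) by lia.
      rewrite <- (bounded_linear_minus _ Lam (fourier_sum g N) G HL (Hps N) HG).
      destruct HL as [_ [_ HB]]. eapply Rle_lt_trans.
      - apply (HB _ (eps / (2 * PI + 1))); [apply cper_minus; auto|].
        intros x. rewrite Rabs_minus_sym. specialize (HGN N x). lra.
      - assert (2 * PI * (eps / (2 * PI + 1)) = eps - eps / (2 * PI + 1)) by (field; lra).
        assert (0 < eps / (2 * PI + 1)) by (apply Rdiv_lt_0_compat; lra). lra. }
    split.
    - apply (Hsmall (fun h => cosc h (Z.of_nat n)) (bounded_linear_cosc _)).
      intros N HN. exact (proj1 (fourier_sum_coefs g n N HN)).
    - apply (Hsmall (fun h => sinc h (Z.of_nat n)) (bounded_linear_sinc _)).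
      intros N HN. exact (proj2 (fourier_sum_coefs g n N HN)). }
  assert (E : forall x, g x = G x) by (intros x; specialize (HgG x); lra).
  split; [exact E|]. intros N x. rewrite E. apply HGN.
Qed.

(** * The space H^1 *)

Definition H1_density (g : R -> R) (n : nat) : R :=
  (1 + IZR (Z.of_nat n) ^ 2) * (cosc g (Z.of_nat n) ^ 2 + sinc g (Z.of_nat n) ^ 2) / (2 * PI) ^ 2.

Lemma H1_weight_density (g : R -> R) (n : nat) : cper g ->
  H1_weight g (Z.of_nat n) = H1_density g n /\ H1_weight g (- Z.of_nat n) = H1_density g n.
Proof.
  intros Hg. assert (Hpi := PI_RGT_0).
  assert (E : forall k, H1_weight g k = (1 + IZR k ^ 2) * (cosc g k ^ 2 + sinc g k ^ 2) / (2 * PI) ^ 2).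
  { intros k. unfold H1_weight, fourier_coeff, Cmod. simpl fst. simpl snd.
    fold (cosc g k). fold (sinc g k). rewrite pow2_sqrt.
    - field. lra.
    - apply Rplus_le_le_0_compat; apply pow2_ge_0. }
  rewrite !E, cosc_opp, sinc_opp, opp_IZR by exact Hg. unfold H1_density. split; [reflexivity|].
  field. lra.
Qed.

Lemma H1_density_nonneg (g : R -> R) (n : nat) : 0 <= H1_density g n.
Proof.
  unfold H1_density. apply Rmult_le_pos.
  - apply Rmult_le_pos; [apply Rlt_le, one_plus_sq_pos|].
    apply Rplus_le_le_0_compat; apply pow2_ge_0.
  - apply Rlt_le, Rinv_0_lt_compat. assert (Hpi := PI_RGT_0). nra.
Qed.

Definition H1_sq (g : R -> R) : R := H1_density g 0 + Series (fun n => 2 * H1_density g (S n)).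

Lemma in_H1_cper (g : R -> R) : in_H1 g -> cper g.
Proof. intros [P [C _]]. now split. Qed.

Lemma fold_Z_H1_weight (g : R -> R) : cper g ->
  forall n, fold_Z (H1_weight g) n = 2 * H1_density g (S n).
Proof.
  intros Hg n. unfold fold_Z. destruct (H1_weight_density g (S n) Hg) as [-> ->]. ring.
Qed.

Lemma in_H1_iff (g : R -> R) :
  in_H1 g <-> cper g /\ ex_series (fun n => 2 * H1_density g (S n)).
Proof.
  split.
  - intros H. pose proof (in_H1_cper g H) as Hg. split; [exact Hg|].
    destruct H as [_ [_ H]]. eapply ex_series_ext; [|exact H]. now apply fold_Z_H1_weight.
  - intros [[P C] H]. repeat split; auto. eapply ex_series_ext; [|exact H].
    intros n. symmetry. now apply fold_Z_H1_weight.
Qed.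

Lemma sum_Z_H1_sq (g : R -> R) : cper g -> sum_Z (H1_weight g) = H1_sq g.
Proof.
  intros Hg. unfold sum_Z, H1_sq. f_equal.
  - apply (H1_weight_density g 0 Hg).
  - apply Series_ext. now apply fold_Z_H1_weight.
Qed.

Lemma Series_nonneg (a : nat -> R) : ex_series a -> (forall n, 0 <= a n) -> 0 <= Series a.
Proof.
  intros Ha Hn. replace 0 with (Series (fun n => 0 * a n)).
  - apply Series_le; [|exact Ha]. intros n. specialize (Hn n). lra.
  - rewrite Series_scal_l. ring.
Qed.

Lemma H1_sq_nonneg (g : R -> R) : in_H1 g -> 0 <= H1_sq g.
Proof.
  intros H. apply in_H1_iff in H. destruct H as [_ H].
  apply Rplus_le_le_0_compat; [apply H1_density_nonneg|].
  apply Series_nonneg; [exact H|]. intros n. pose proof (H1_density_nonneg g (S n)). lra.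
Qed.

Lemma H1_norm_sq (g : R -> R) : in_H1 g -> H1_norm g ^ 2 = H1_sq g.
Proof.
  intros H. unfold H1_norm. rewrite sum_Z_H1_sq by now apply in_H1_cper.
  apply pow2_sqrt. now apply H1_sq_nonneg.
Qed.

(** Parallelogram law: the right side exceeds the left by the density of g - c h. *)
Lemma H1_density_combination (g h : R -> R) (c : R) (n : nat) : cper g -> cper h ->
  H1_density (fun x => g x + c * h x) n <= 2 * H1_density g n + 2 * c ^ 2 * H1_density h n.
Proof.
  intros Hg Hh. assert (Hpi := PI_RGT_0). unfold H1_density.
  destruct (bounded_linear_cosc (Z.of_nat n)) as [_ [Lc _]].
  destruct (bounded_linear_sinc (Z.of_nat n)) as [_ [Ls _]].
  rewrite Lc, Ls by auto.
  set (w := (1 + IZR (Z.of_nat n) ^ 2)). assert (Hw : 0 < w) by apply one_plus_sq_pos.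
  assert (Hp : 0 < / (2 * PI) ^ 2) by (apply Rinv_0_lt_compat; nra).
  set (a := cosc g (Z.of_nat n)). set (b := cosc h (Z.of_nat n)).
  set (a' := sinc g (Z.of_nat n)). set (b' := sinc h (Z.of_nat n)). unfold Rdiv.
  assert (0 <= w * / (2 * PI) ^ 2 * ((a - c * b) ^ 2 + (a' - c * b') ^ 2)).
  { apply Rmult_le_pos; [apply Rlt_le, Rmult_lt_0_compat; lra | apply Rplus_le_le_0_compat; apply pow2_ge_0]. }
  match goal with |- ?l <= ?r => assert (r - l = w * / (2 * PI) ^ 2 * ((a - c * b) ^ 2 + (a' - c * b') ^ 2)) by ring end.
  lra.
Qed.

Lemma in_H1_combination (g h : R -> R) (c : R) : in_H1 g -> in_H1 h ->
  in_H1 (fun x => g x + c * h x) /\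
  H1_sq (fun x => g x + c * h x) <= 2 * H1_sq g + 2 * c ^ 2 * H1_sq h.
Proof.
  intros Hg Hh. apply in_H1_iff in Hg. apply in_H1_iff in Hh.
  destruct Hg as [Cg Sg], Hh as [Ch Sh].
  assert (Hs : ex_series (fun n => 2 * (2 * H1_density g (S n)) + 2 * c ^ 2 * (2 * H1_density h (S n)))).
  { apply ex_series_add; now apply ex_series_scale. }
  assert (Hle : forall n, 0 <= 2 * H1_density (fun x => g x + c * h x) (S n) <=
     2 * (2 * H1_density g (S n)) + 2 * c ^ 2 * (2 * H1_density h (S n))).
  { intros n. pose proof (H1_density_nonneg (fun x => g x + c * h x) (S n)).
    pose proof (H1_density_combination g h c (S n) Cg Ch). lra. }
  split.
  - apply in_H1_iff. split; [apply cper_plus; [exact Cg | now apply cper_scal]|].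
    refine (ex_series_dominated _ _ _ Hs).
    intros n. rewrite Rabs_pos_eq; apply Hle.
  - unfold H1_sq. pose proof (H1_density_combination g h c 0 Cg Ch).
    assert (Series (fun n => 2 * H1_density (fun x => g x + c * h x) (S n)) <=
      2 * Series (fun n => 2 * H1_density g (S n)) + 2 * c ^ 2 * Series (fun n => 2 * H1_density h (S n))); [|lra].
    rewrite <- !Series_scal_l, <- Series_plus.
    + now apply Series_le.
    + now apply ex_series_scale.
    + now apply ex_series_scale.
Qed.

Definition inv_weight (n : nat) : R := / (1 + IZR (Z.of_nat (S n)) ^ 2).

Lemma inv_weight_pos (n : nat) : 0 < inv_weight n.
Proof. unfold inv_weight. apply Rinv_0_lt_compat, one_plus_sq_pos. Qed.

(** Comparison with a telescoping series, using y (y + 1) / 2 <= 1 + y^2 for y = n + 1. *)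
Lemma ex_series_inv_weight : ex_series inv_weight.
Proof.
  apply (ex_series_dominated _ (fun n => 2 * (/ INR (S n) - / INR (S (S n))))).
  - intros n. rewrite Rabs_pos_eq by (apply Rlt_le, inv_weight_pos).
    unfold inv_weight. rewrite <- INR_IZR_INZ, (S_INR (S n)).
    assert (0 < INR (S n)) by (apply lt_0_INR; lia). set (y := INR (S n)) in *.
    replace (2 * (/ y - / (y + 1))) with (/ (y * (y + 1) / 2)) by (field; lra).
    apply Rinv_le_contravar; nra.
  - apply (ex_series_scale 2 (fun n => / INR (S n) - / INR (S (S n)))).
    exists (1 - 0). change (is_lim_seq (sum_n (fun n => / INR (S n) - / INR (S (S n)))) (1 - 0)).
    apply (is_lim_seq_ext (fun n => 1 - / INR (S (S n)))).
    + intros n. rewrite sum_n_Reals. induction n as [|n IH].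
      * simpl. field.
      * rewrite tech5, <- IH. ring.
    + apply (is_lim_seq_minus' (fun _ => 1) (fun n => / INR (S (S n))) 1 0); [apply is_lim_seq_const|].
      apply (is_lim_seq_inv _ p_infty).
      * apply (is_lim_seq_ext (fun n => INR (n + 2))).
        -- intros n. f_equal. lia.
        -- apply (is_lim_seq_incr_n INR 2 p_infty), is_lim_seq_INR.
      * discriminate.
Qed.

Definition weight_tail (N : nat) : R := Series (fun n => inv_weight (N + n)).

Lemma weight_tail_pos (N : nat) : 0 < weight_tail N.
Proof.
  unfold weight_tail. assert (E : ex_series (fun n => inv_weight (N + n))).
  { apply (ex_series_incr_n inv_weight N), ex_series_inv_weight. }
  rewrite Series_incr_1 by exact E.
  assert (0 <= Series (fun k => inv_weight (N + S k))).
  { apply Series_nonneg; [now apply (ex_series_incr_1 (fun n => inv_weight (N + n)))|].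
    intros; apply Rlt_le, inv_weight_pos. }
  pose proof (inv_weight_pos (N + 0)). lra.
Qed.

(* Weighted AM-GM on each Fourier mode; lam is free and is optimised by the callers. *)
Lemma fourier_sum_error (g : R -> R) (lam : R) : in_H1 g -> 0 < lam ->
  forall N x, Rabs (g x - fourier_sum g N x) <= lam / 2 * weight_tail N + 2 / lam * H1_sq g.
Proof.
  intros H Hlam N x. assert (Hpi := PI_RGT_0).
  apply in_H1_iff in H. destruct H as [Hg Hs].
  set (m := fun n => lam / 2 * inv_weight n + 2 / lam * (2 * H1_density g (S n))).
  assert (E1 : ex_series (fun n => lam / 2 * inv_weight n)).
  { apply ex_series_scale, ex_series_inv_weight. }
  assert (E2 : ex_series (fun n => 2 / lam * (2 * H1_density g (S n)))).
  { now apply ex_series_scale. }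
  assert (Em : ex_series m) by now apply ex_series_add.
  assert (Hm : forall n, Rabs (cosc g (Z.of_nat (S n)) / PI) + Rabs (sinc g (Z.of_nat (S n)) / PI) <= m n).
  { intros n. unfold m, inv_weight, H1_density.
    set (w := 1 + IZR (Z.of_nat (S n)) ^ 2). assert (Hw : 0 < w) by apply one_plus_sq_pos.
    set (c := cosc g (Z.of_nat (S n))). set (s := sinc g (Z.of_nat (S n))).
    set (p := Rabs (c / PI)). set (q := Rabs (s / PI)).
    assert (Ec : c ^ 2 = PI ^ 2 * p ^ 2).
    { unfold p. rewrite pow2_abs. field. lra. }
    assert (Es : s ^ 2 = PI ^ 2 * q ^ 2).
    { unfold q. rewrite pow2_abs. field. lra. }
    rewrite Ec, Es.
    replace (lam / 2 * / w + 2 / lam * (2 * (w * (PI ^ 2 * p ^ 2 + PI ^ 2 * q ^ 2) / (2 * PI) ^ 2)))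
      with ((lam ^ 2 + 2 * w ^ 2 * (p ^ 2 + q ^ 2)) / (2 * lam * w)) by (field; lra).
    assert (Hlw : 0 < 2 * lam * w) by (apply Rmult_lt_0_compat; lra).
    apply Rmult_le_reg_r with (2 * lam * w); [exact Hlw|].
    replace ((lam ^ 2 + 2 * w ^ 2 * (p ^ 2 + q ^ 2)) / (2 * lam * w) * (2 * lam * w))
      with (lam ^ 2 + 2 * w ^ 2 * (p ^ 2 + q ^ 2)) by (field; lra).
    assert (0 <= (lam - w * (p + q)) ^ 2 + w ^ 2 * (p - q) ^ 2).
    { apply Rplus_le_le_0_compat; [apply pow2_ge_0|]. apply Rmult_le_pos; apply pow2_ge_0. }
    nra. }
  eapply Rle_trans; [apply (proj2 (fourier_series_cv g m Hg Em Hm))|].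
  unfold m. rewrite Series_plus.
  - apply Rplus_le_compat.
    + right. apply (Series_scal_l (lam / 2) (fun n => inv_weight (N + n))).
    + rewrite (Series_scal_l (2 / lam) (fun n => 2 * H1_density g (S (N + n)))).
      apply Rmult_le_compat_l; [apply Rlt_le, Rdiv_lt_0_compat; lra|].
      unfold H1_sq. pose proof (H1_density_nonneg g 0).
      assert (Series (fun n => 2 * H1_density g (S (N + n))) <= Series (fun n => 2 * H1_density g (S n))); [|lra].
      destruct N as [|N]; [right; reflexivity|].
      rewrite (Series_incr_n (fun n => 2 * H1_density g (S n)) (S N)) by (lia || exact Hs).
      assert (0 <= sum_f_R0 (fun n => 2 * H1_density g (S n)) (pred (S N))); [|lra].
      apply cond_pos_sum. intros n. pose proof (H1_density_nonneg g (S n)). lra.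
  - exact (proj1 (ex_series_incr_n (fun n => lam / 2 * inv_weight n) N) E1).
  - exact (proj1 (ex_series_incr_n (fun n => 2 / lam * (2 * H1_density g (S n))) N) E2).
Qed.

(** This equals [weight_tail 0 / 2 + 2 + 1]: the first two terms are the truncation error at order 0
    with [lam] equal to the H^1 bound, the last one accounts for the mean value. *)
Definition sobolev_const : R := (1 + weight_tail 0) / 2 + 5 / 2.

Lemma sobolev_bound (g : R -> R) (A : R) : in_H1 g -> 0 < A -> H1_sq g <= A ^ 2 ->
  forall x, Rabs (g x) <= sobolev_const * A.
Proof.
  intros H HA HgA x. assert (Hpi := PI_RGT_0).
  pose proof (fourier_sum_error g A H HA 0 x) as E.
  unfold fourier_sum in E. simpl in E.
  assert (E0 : Rabs (cosc g 0 / (2 * PI)) <= A).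
  { apply Rsqr_incr_0_var; [|lra]. rewrite <- Rsqr_abs. unfold Rsqr.
    apply in_H1_iff in H. destruct H as [Hg Hs].
    assert (0 <= Series (fun n => 2 * H1_density g (S n))).
    { apply Series_nonneg; [exact Hs|]. intros n. pose proof (H1_density_nonneg g (S n)). lra. }
    assert (H1_density g 0 = cosc g 0 / (2 * PI) * (cosc g 0 / (2 * PI))).
    { unfold H1_density. simpl Z.of_nat. rewrite sinc_0. field. lra. }
    unfold H1_sq in HgA. lra. }
  assert (E1 : 2 / A * H1_sq g <= 2 * A).
  { apply Rle_trans with (2 / A * A ^ 2); [|right; field; lra].
    apply Rmult_le_compat_l; [apply Rlt_le, Rdiv_lt_0_compat; lra | exact HgA]. }
  replace (g x) with ((g x - cosc g 0 / (2 * PI)) + cosc g 0 / (2 * PI)) by ring.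
  eapply Rle_trans; [apply Rabs_triang|]. unfold sobolev_const.
  pose proof (weight_tail_pos 0). nra.
Qed.

Lemma sobolev_const_pos : 0 < sobolev_const.
Proof. unfold sobolev_const. pose proof (weight_tail_pos 0). lra. Qed.

Lemma continuous_in_H1_sq (u : R -> R -> R) : continuous_in_H1 u ->
  forall t0 eps, 0 < eps -> exists d, 0 < d /\ forall t, Rabs (t - t0) < d ->
    in_H1 (fun x => u x t - u x t0) /\ H1_sq (fun x => u x t - u x t0) <= eps ^ 2.
Proof.
  intros [H L] t0 eps He.
  assert (Hd : forall t, in_H1 (fun x => u x t - u x t0)).
  { intros t. destruct (in_H1_combination _ _ (-1) (H t) (H t0)) as [E _].
    replace (fun x => u x t - u x t0) with (fun x => u x t + -1 * u x t0)
      by (apply functional_extensionality; intros; ring). exact E. }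
  specialize (L t0). apply is_lim_spec in L. destruct (L (mkposreal eps He)) as [d Hd'].
  exists d. split; [apply cond_pos|]. intros t Ht. split; [apply Hd|].
  (* The limit at [t0] says nothing about [t0] itself; there the difference is the zero function and
     its coefficients are computed directly. *)
  destruct (Req_dec t t0) as [->|Hn].
  - destruct (in_H1_combination _ _ (-1) (H t0) (H t0)) as [_ _].
    assert (E : H1_sq (fun x => u x t0 - u x t0) = 0); [|rewrite E; nra].
    assert (E : forall n, H1_density (fun x => u x t0 - u x t0) n = 0).
    { intros n. unfold H1_density.
      replace (fun x => u x t0 - u x t0) with (fun x => 0 * u x t0)
        by (apply functional_extensionality; intros; ring).
      pose proof (in_H1_cper _ (H t0)) as C.
      rewrite (bounded_linear_scal _ (fun h => cosc h _) 0 _ (bounded_linear_cosc _) C).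
      rewrite (bounded_linear_scal _ (fun h => sinc h _) 0 _ (bounded_linear_sinc _) C).
      unfold Rdiv. ring. }
    unfold H1_sq. rewrite E, (Series_ext _ (fun n => 0 * 0)), Series_scal_l; [ring|].
    intros n. rewrite E. ring.
  - specialize (Hd' t Ht Hn). simpl in Hd'. rewrite Rminus_0_r in Hd'.
    rewrite <- H1_norm_sq by apply Hd. rewrite <- (pow2_abs (H1_norm _)).
    apply pow_incr. split; [apply Rabs_pos|]. lra.
Qed.

Lemma continuous_in_H1_CT (u : R -> R -> R) : continuous_in_H1 u -> CT u.
Proof.
  intros Hu. split.
  - intros t. apply in_H1_cper. apply Hu.
  - intros t0 eps He. pose proof sobolev_const_pos as Hc.
    assert (He' : 0 < eps / sobolev_const) by now apply Rdiv_lt_0_compat.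
    destruct (continuous_in_H1_sq u Hu t0 _ He') as [d [Hd H]].
    exists d. split; [exact Hd|]. intros t Ht x. destruct (H t Ht) as [H1 H2].
    eapply Rle_trans; [apply (sobolev_bound _ _ H1 He' H2)|]. right. field. lra.
Qed.

Lemma H1_sq_locally_bounded (u : R -> R -> R) : continuous_in_H1 u ->
  forall a b, a <= b -> exists A, forall t, a <= t <= b -> H1_sq (fun x => u x t) <= A.
Proof.
  intros Hu. apply (locally_bounded_on_interval (fun t A => H1_sq (fun x => u x t) <= A)).
  - intros. lra.
  - intros t. destruct (continuous_in_H1_sq u Hu t 1 ltac:(lra)) as [d [Hd H]].
    exists d, (2 * H1_sq (fun x => u x t) + 2). split; [exact Hd|]. intros s Hst.
    destruct (H s Hst) as [H1 H2]. destruct Hu as [Hu _].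
    destruct (in_H1_combination _ _ 1 (Hu t) H1) as [_ E].
    replace (fun x => u x t + 1 * (u x s - u x t)) with (fun x => u x s) in E
      by (apply functional_extensionality; intros; ring). lra.
Qed.

(** * The inverse of 1 - d_x^2 *)

(* green_plus g solves y' = y - g / 2 and green_minus g solves y' = - y + g / 2, both 2 pi-periodically; their sum inverts 1 - d_x^2. *)
Definition green_plus (g : R -> R) (x : R) : R :=
  exp x * (/ 2 * RInt (fun y => exp (- y) * g y) 0 (2 * PI) / (1 - exp (- (2 * PI)))
           - / 2 * RInt (fun y => exp (- y) * g y) 0 x).
Definition green_minus (g : R -> R) (x : R) : R := green_plus (fun y => g (- y)) (- x).

Definition helmholtz (g : R -> R) (x : R) : R := green_plus g x + green_minus g x.
Definition helmholtz_dx (g : R -> R) (x : R) : R := green_plus g x - green_minus g x.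

Lemma exp_2PI : 1 < exp (2 * PI) /\ exp (- (2 * PI)) < 1 /\ exp (2 * PI) * exp (- (2 * PI)) = 1.
Proof.
  assert (Hpi := PI_RGT_0). rewrite <- exp_0. repeat split.
  - apply exp_increasing; lra.
  - apply exp_increasing; lra.
  - rewrite <- exp_plus. f_equal. ring.
Qed.

Lemma green_plus_derive (g : R -> R) (x : R) : cper g ->
  is_derive (green_plus g) x (green_plus g x - g x / 2).
Proof.
  intros [_ Cg].
  assert (HI : is_derive (fun x => RInt (fun y => exp (- y) * g y) 0 x) x (exp (- x) * g x)).
  { apply (der_RInt (fun y => exp (- y) * g y)). intros. auto with cont. }
  unfold green_plus. eapply is_derive_eq.
  - apply der_mult; [apply is_derive_exp|].
    apply der_minus; [apply der_const|]. apply der_mult; [apply der_const | exact HI].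
  - assert (E : exp x * exp (- x) = 1) by (rewrite <- exp_plus, Rplus_opp_r; apply exp_0).
    to_R.
    replace (g x / 2) with (/ 2 * (exp x * exp (- x)) * g x) by (rewrite E; field). ring.
Qed.

Lemma cper_reflect (g : R -> R) : cper g -> cper (fun x => g (- x)).
Proof.
  intros [P C]. split.
  - intros x. rewrite <- (P (- (x + 2 * PI))). f_equal. ring.
  - intros x. apply (cont_comp (fun x => - x) g); cont.
Qed.

Lemma green_minus_derive (g : R -> R) (x : R) : cper g ->
  is_derive (green_minus g) x (- green_minus g x + g x / 2).
Proof.
  intros Hg. eapply is_derive_eq.
  - apply (der_comp (fun x => - x) _ x (-1)); [der; ring | apply green_plus_derive, cper_reflect, Hg].
  - unfold green_minus. rewrite Ropp_involutive. rfield.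
Qed.

Lemma linear_ode_zero (d : R -> R) (s : R) :
  (forall x, is_derive d x (s * d x)) -> d 0 = 0 -> forall x, d x = 0.
Proof.
  intros Hd H0 x.
  assert (E : d x * exp (- (s * x)) = d 0 * exp (- (s * 0))).
  { apply (derive_zero_const (fun x => d x * exp (- (s * x)))). intros y _.
    eapply is_derive_eq; [apply der_mult; [apply Hd | der; reflexivity]|].
    to_R. ring. }
  rewrite H0 in E. pose proof (exp_pos (- (s * x))). nra.
Qed.

(** The difference between the shifted and the original function solves y' = y. It vanishes at 0 by
    the choice of the factor 1 / (1 - exp (- 2 pi)), hence everywhere. *)
Lemma cper_green_plus (g : R -> R) : cper g -> cper (green_plus g).
Proof.
  intros Hg. pose proof Hg as [Pg _]. split.
  - intros x.
    assert (E : green_plus g (x + 2 * PI) - green_plus g x = 0); [|lra].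
    apply (linear_ode_zero (fun x => green_plus g (x + 2 * PI) - green_plus g x) 1).
    + intros y. eapply is_derive_eq.
      * apply der_minus; [|now apply green_plus_derive].
        apply (der_comp (fun x => x + 2 * PI) (green_plus g) y 1);
          [der; ring | now apply green_plus_derive].
      * rewrite (Pg y). rfield.
    + unfold green_plus. rewrite Rplus_0_l, RInt_same, exp_0.
      destruct exp_2PI as [H1 [H2 H3]].
      set (I := RInt (fun y => exp (- y) * g y) 0 (2 * PI)).
      set (p := exp (2 * PI)) in *. set (q := exp (- (2 * PI))) in *.
      replace (p * (/ 2 * I / (1 - q) - / 2 * I)) with (/ 2 * (p * q) * I / (1 - q)) by (field; lra).
      rewrite H3. field. lra.
  - intros x. eapply derive_cont, green_plus_derive, Hg.
Qed.

Lemma cper_green_minus (g : R -> R) : cper g -> cper (green_minus g).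
Proof. intros Hg. apply (cper_reflect (green_plus _)), cper_green_plus, cper_reflect, Hg. Qed.

Lemma green_plus_linear (g h : R -> R) (c x : R) : cper g -> cper h ->
  green_plus (fun x => g x + c * h x) x = green_plus g x + c * green_plus h x.
Proof.
  intros [_ Cg] [_ Ch]. unfold green_plus.
  assert (E : forall z, RInt (fun y => exp (- y) * (g y + c * h y)) 0 z
     = RInt (fun y => exp (- y) * g y) 0 z + c * RInt (fun y => exp (- y) * h y) 0 z).
  { intros z. rewrite <- RInt_scale, <- RInt_add by auto 10 with cont.
    apply RInt_eq. intros; rring. }
  rewrite !E. unfold Rdiv. ring.
Qed.
Lemma green_minus_linear (g h : R -> R) (c x : R) : cper g -> cper h ->
  green_minus (fun x => g x + c * h x) x = green_minus g x + c * green_minus h x.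
Proof.
  intros Hg Hh. apply (green_plus_linear (fun y => g (- y)) (fun y => h (- y))); now apply cper_reflect.
Qed.

(* e^{-x} (M / 2 - green_plus g) is monotone while green_plus g is periodic: this forces its sign. *)
Lemma green_plus_upper (g : R -> R) (M x : R) : cper g -> (forall x, g x <= M) ->
  green_plus g x <= M / 2.
Proof.
  intros Hg HM. destruct (cper_green_plus g Hg) as [P _]. assert (Hpi := PI_RGT_0).
  set (q := fun x => exp (- x) * (green_plus g x - M / 2)).
  assert (Hq : q x <= q (x + 2 * PI)).
  { apply (derive_nonneg_le q (fun x => exp (- x) * (/ 2 * (M - g x)))); [lra| |].
    - intros y _. unfold q. eapply is_derive_eq.
      + apply der_mult; [der; reflexivity|].
        apply der_minus; [now apply green_plus_derive | apply der_const].
      + to_R. field.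
    - intros y _. apply Rmult_le_pos; [apply Rlt_le, exp_pos|]. specialize (HM y). lra. }
  unfold q in Hq. rewrite (P x), Ropp_plus_distr, exp_plus in Hq.
  destruct exp_2PI as [_ [H2 _]]. pose proof (exp_pos (- x)). pose proof (exp_pos (- (2 * PI))).
  set (a := exp (- x)) in *. set (b := exp (- (2 * PI))) in *. set (y := green_plus g x - M / 2) in *.
  assert (a * y * (1 - b) <= 0) by lra.
  assert (y <= 0); [|unfold y in *; lra].
  apply Rnot_lt_le. intros Hy. assert (0 < a * y) by (apply Rmult_lt_0_compat; lra). nra.
Qed.

Lemma green_plus_bound (g : R -> R) (M x : R) : cper g -> (forall x, Rabs (g x) <= M) ->
  Rabs (green_plus g x) <= M / 2.
Proof.
  intros Hg HM. assert (HM' : forall x, - M <= g x <= M) by (intros; now apply Rabs_le_between).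
  assert (H2 : forall x, 0 + -1 * g x <= M) by (intros y; specialize (HM' y); lra).
  assert (Hm : cper (fun x => 0 + -1 * g x)) by (apply cper_plus; [apply cper_const | now apply cper_scal]).
  assert (Z : green_plus (fun _ => 0) x = 0).
  { unfold green_plus. rewrite !(RInt_eq (fun y => exp (- y) * 0) (fun _ => 0)) by (intros; rring).
    rewrite !RInt_const_R. unfold Rdiv. ring. }
  pose proof (green_plus_upper g M x Hg (fun y => proj2 (HM' y))).
  pose proof (green_plus_upper _ M x Hm H2) as A.
  rewrite green_plus_linear, Z in A by (auto using cper_const). apply Rabs_le; lra.
Qed.

Lemma green_bound (g : R -> R) (M x : R) : cper g -> (forall x, Rabs (g x) <= M) ->
  Rabs (green_plus g x) <= M / 2 /\ Rabs (green_minus g x) <= M / 2.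
Proof.
  intros Hg HM. split; apply green_plus_bound; auto. now apply cper_reflect.
Qed.

(** Each Green half is at most M / 2, so the inverse operator and its x-derivative both have sup
    norm at most 1, uniformly in x. The bounds on the time jets rest on this constant. *)
Lemma bounded_linear_helmholtz (x : R) : bounded_linear 1 (fun g => helmholtz g x).
Proof.
  unfold helmholtz. repeat split; [lra| |].
  - intros g h c Hg Hh. rewrite green_plus_linear, green_minus_linear by auto. ring.
  - intros g M Hg HM. destruct (green_bound g M x Hg HM).
    eapply Rle_trans; [apply Rabs_triang|]. lra.
Qed.
Lemma bounded_linear_helmholtz_dx (x : R) : bounded_linear 1 (fun g => helmholtz_dx g x).
Proof.
  unfold helmholtz_dx. repeat split; [lra| |].
  - intros g h c Hg Hh. rewrite green_plus_linear, green_minus_linear by auto. ring.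
  - intros g M Hg HM. destruct (green_bound g M x Hg HM).
    unfold Rminus. eapply Rle_trans; [apply Rabs_triang|]. rewrite Rabs_Ropp. lra.
Qed.

Lemma cper_helmholtz (g : R -> R) : cper g -> cper (helmholtz g).
Proof. intros Hg. apply cper_plus; [now apply cper_green_plus | now apply cper_green_minus]. Qed.
Lemma cper_helmholtz_dx (g : R -> R) : cper g -> cper (helmholtz_dx g).
Proof. intros Hg. apply cper_minus; [now apply cper_green_plus | now apply cper_green_minus]. Qed.

Lemma helmholtz_derive (g : R -> R) (x : R) : cper g ->
  is_derive (helmholtz g) x (helmholtz_dx g x).
Proof.
  intros Hg. eapply is_derive_eq.
  - apply der_plus; [now apply green_plus_derive | now apply green_minus_derive].
  - unfold helmholtz_dx. rfield.
Qed.
Lemma helmholtz_dx_derive (g : R -> R) (x : R) : cper g ->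
  is_derive (helmholtz_dx g) x (helmholtz g x - g x).
Proof.
  intros Hg. eapply is_derive_eq.
  - apply der_minus; [now apply green_plus_derive | now apply green_minus_derive].
  - unfold helmholtz. rfield.
Qed.

Lemma CT_helmholtz_dx (W : R -> R -> R) : CT W -> CT (fun x t => helmholtz_dx (fun y => W y t) x).
Proof.
  intros [C H]. split.
  - intros t. apply (cper_helmholtz_dx (fun y => W y t)), C.
  - intros t0 eps He. destruct (H t0 eps He) as [d [Hd H']]. exists d. split; [exact Hd|].
    intros t Ht x. pose proof (bounded_linear_helmholtz_dx x) as B.
    rewrite <- (bounded_linear_minus 1 (fun g => helmholtz_dx g x) _ _ B (C t) (C t0)).
    destruct B as [_ [_ B]]. rewrite <- (Rmult_1_l eps). apply B.
    + now apply (cper_minus (fun y => W y t) (fun y => W y t0)).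
    + intros y. now apply H'.
Qed.

Lemma RInt_derive_period (h dh : R -> R) :
  (forall x, is_derive h x (dh x)) -> (forall x, continuous dh x) -> periodic h ->
  RInt dh 0 (2 * PI) = 0.
Proof.
  intros H C P. rewrite (RInt_antideriv h dh) by auto.
  rewrite <- (P 0), Rplus_0_l. rring.
Qed.

(** Integration by parts over a period. With h = [helmholtz g], the derivative of h_x e - h e' is (1
    + z^2) h e - g e, and that of h e is h_x e + h e'. *)
Lemma helmholtz_moment (g e de : R -> R) (z : R) : cper g -> periodic e -> periodic de ->
  (forall x, is_derive e x (de x)) -> (forall x, is_derive de x (- z ^ 2 * e x)) ->
  RInt (fun x => helmholtz g x * e x) 0 (2 * PI) = RInt (fun x => g x * e x) 0 (2 * PI) / (1 + z ^ 2) /\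
  RInt (fun x => helmholtz_dx g x * e x) 0 (2 * PI) = - RInt (fun x => helmholtz g x * de x) 0 (2 * PI).
Proof.
  intros Hg Pe Pde De Dde. pose proof Hg as [_ Cg].
  pose proof (cper_helmholtz g Hg) as [P C]. pose proof (cper_helmholtz_dx g Hg) as [P' C'].
  assert (Ce : forall x, continuous e x) by (intros; eapply derive_cont, De).
  assert (Cde : forall x, continuous de x) by (intros; eapply derive_cont, Dde).
  pose proof (one_plus_sq_pos z). split.
  - assert (E : RInt (fun x => (1 + z ^ 2) * (helmholtz g x * e x) - g x * e x) 0 (2 * PI) = 0).
    { apply (RInt_derive_period (fun x => helmholtz_dx g x * e x - helmholtz g x * de x)).
      - intros x. eapply is_derive_eq.
        + apply der_minus; apply der_mult; [now apply helmholtz_dx_derive | apply De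
            | now apply helmholtz_derive | apply Dde].
        + to_R. ring.
      - auto 10 with cont.
      - intros x. now rewrite (P x), (P' x), (Pe x), (Pde x). }
    rewrite RInt_sub, RInt_scale in E by auto 10 with cont.
    apply Rmult_eq_reg_l with (1 + z ^ 2); [|lra]. to_R. field_simplify; lra.
  - assert (E : RInt (fun x => helmholtz_dx g x * e x + helmholtz g x * de x) 0 (2 * PI) = 0).
    { apply (RInt_derive_period (fun x => helmholtz g x * e x)).
      - intros x. apply der_mult; [now apply helmholtz_derive | apply De].
      - auto 10 with cont.
      - intros x. now rewrite (P x), (Pe x). }
    rewrite RInt_add in E by auto with cont. lra.
Qed.

Lemma helmholtz_coefs (g : R -> R) (k : Z) : cper g ->
  cosc (helmholtz g) k = cosc g k / (1 + IZR k ^ 2) /\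
  sinc (helmholtz g) k = sinc g k / (1 + IZR k ^ 2) /\
  cosc (helmholtz_dx g) k = IZR k * sinc g k / (1 + IZR k ^ 2) /\
  sinc (helmholtz_dx g) k = - IZR k * cosc g k / (1 + IZR k ^ 2).
Proof.
  intros Hg. pose proof (cper_helmholtz g Hg) as [_ C].
  pose proof (cos_k_periodic k) as Pc. pose proof (sin_k_periodic k) as Ps.
  destruct (helmholtz_moment g (fun x => cos (IZR k * x)) (fun x => - IZR k * sin (IZR k * x)) (IZR k) Hg)
    as [C1 C2]; [exact Pc | intros x; now rewrite (Ps x) | apply cos_k_derive | intros x; der; ring |].
  destruct (helmholtz_moment g (fun x => sin (IZR k * x)) (fun x => IZR k * cos (IZR k * x)) (IZR k) Hg)
    as [S1 S2]; [exact Ps | intros x; now rewrite (Pc x) | apply sin_k_derive | intros x; der; ring |].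
  rewrite (RInt_eq (fun x => helmholtz g x * (- IZR k * sin (IZR k * x)))
    (fun x => - IZR k * (helmholtz g x * sin (IZR k * x)))), RInt_scale in C2
    by (intros; rring || auto with cont).
  rewrite (RInt_eq (fun x => helmholtz g x * (IZR k * cos (IZR k * x)))
    (fun x => IZR k * (helmholtz g x * cos (IZR k * x)))), RInt_scale in S2
    by (intros; rring || auto with cont).
  unfold cosc, sinc. rewrite C2, S2, C1, S1. unfold Rdiv. repeat split; ring.
Qed.

(** The coefficients of [helmholtz g] are those of g over 1 + k^2. Those of g are bounded, so the
    Fourier series of [helmholtz g] converges absolutely and represents it at every point; that
    series is [helmholtz_inv g]. *)
Lemma helmholtz_inv_eq (g : R -> R) (x : R) : cper g -> helmholtz_inv g x = helmholtz g x.
Proof.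
  intros Hg. assert (Hpi := PI_RGT_0). pose proof (cper_helmholtz g Hg) as HL.
  destruct (cper_bounded g Hg) as [M [HM HgM]].
  set (m := fun n => 4 * M * inv_weight n).
  assert (Em : ex_series m).
  { apply ex_series_scale, ex_series_inv_weight. }
  assert (Hb : forall n, Rabs (cosc (helmholtz g) (Z.of_nat (S n)) / PI) + Rabs (sinc (helmholtz g) (Z.of_nat (S n)) / PI) <= m n).
  { intros n. destruct (helmholtz_coefs g (Z.of_nat (S n)) Hg) as [-> [-> _]].
    destruct (bounded_linear_cosc (Z.of_nat (S n))) as [_ [_ Bc]].
    destruct (bounded_linear_sinc (Z.of_nat (S n))) as [_ [_ Bs]].
    specialize (Bc g M Hg HgM). specialize (Bs g M Hg HgM).
    unfold m, inv_weight. pose proof (one_plus_sq_pos (IZR (Z.of_nat (S n)))) as Hw.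
    set (w := 1 + IZR (Z.of_nat (S n)) ^ 2) in *.
    assert (Hiw : 0 < / w) by now apply Rinv_0_lt_compat.
    assert (Hip : 0 < / PI) by now apply Rinv_0_lt_compat.
    unfold Rdiv. rewrite !Rabs_mult, (Rabs_pos_eq (/ w)), (Rabs_pos_eq (/ PI)) by lra.
    assert (Hpp : forall c, c <= 2 * PI * M -> c * / w * / PI <= 2 * M * / w).
    { intros c Hc. replace (2 * M * / w) with (2 * PI * M * / w * / PI) by (field; lra).
      apply Rmult_le_compat_r; [lra|]. apply Rmult_le_compat_r; lra. }
    specialize (Hpp _ Bc) as B1. specialize (Hpp _ Bs) as B2. lra. }
  rewrite (proj1 (fourier_series_cv (helmholtz g) m HL Em Hb) x).
  unfold helmholtz_inv, sum_Z.
  set (a := fun n => cosc (helmholtz g) (Z.of_nat n) / PI).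
  set (b := fun n => sinc (helmholtz g) (Z.of_nat n) / PI).
  assert (E0 : Re (Cmult (fourier_coeff g 0) (expi (0 * x))) / (1 + 0 ^ 2) = cosc (helmholtz g) 0 / (2 * PI)).
  { destruct (helmholtz_coefs g 0 Hg) as [-> _].
    unfold fourier_coeff, expi, Re, Cmult. simpl fst. simpl snd.
    fold (cosc g 0). fold (sinc g 0). rewrite Rmult_0_l, cos_0, sin_0. field. lra. }
  assert (Ek : forall k, Re (Cmult (fourier_coeff g k) (expi (IZR k * x)))
     = (cosc g k * cos (IZR k * x) + sinc g k * sin (IZR k * x)) / (2 * PI)).
  { intros k. unfold fourier_coeff, expi, Re, Cmult, cosc, sinc. cbn [fst snd]. field. lra. }
  rewrite E0. f_equal. apply Series_ext. intros n. unfold fold_Z, trig_term, a, b.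
  destruct (helmholtz_coefs g (Z.of_nat (S n)) Hg) as [-> [-> _]].
  rewrite !Ek, cosc_opp, sinc_opp by exact Hg. rewrite opp_IZR.
  set (z := IZR (Z.of_nat (S n))). pose proof (one_plus_sq_pos z).
  replace (- z * x) with (- (z * x)) by ring. rewrite cos_neg, sin_neg.
  field. lra.
Qed.

(** Let [W] be the time integral of the expected derivative [V]. Every Fourier coefficient of u(t) -
    u(0) - W(t) is constant in time and starts at 0, so uniqueness identifies u with u(0) + W, which
    is differentiable at each point. *)
Lemma solution_time_derivative (f : R -> R) (u : R -> R -> R) :
  CT u -> CT (fun x t => f (u x t)) -> distributional_solution f u ->
  forall x t, is_derive (fun t => u x t) t (- helmholtz_dx (fun y => f (u y t)) x).
Proof.
  intros Hu Hf Hsol.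
  set (V := fun x t => -1 * helmholtz_dx (fun y => f (u y t)) x).
  assert (HV : CT V) by (apply CT_scal; now apply (CT_helmholtz_dx (fun x t => f (u x t)))).
  set (W := fun x t => RInt (fun s => V x s) 0 t).
  assert (HW : CT W) by now apply CT_time_integral.
  assert (DW : forall x t, is_derive (fun t => W x t) t (V x t)).
  { intros x t. apply (der_RInt (fun s => V x s)). intros s. now apply CT_cont_t. }
  assert (W0 : forall x, W x 0 = 0) by (intros; apply RInt_same).
  assert (Cc : forall t k, cosc (fun x => V x t) k = - IZR k * sinc (fun x => f (u x t)) k / (1 + IZR k ^ 2)
                     /\ sinc (fun x => V x t) k = IZR k * cosc (fun x => f (u x t)) k / (1 + IZR k ^ 2)).
  { intros t k. pose proof (proj1 Hf t) as Cf. simpl in Cf. pose proof (cper_helmholtz_dx _ Cf) as Cd.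
    unfold V.
    rewrite (bounded_linear_scal _ (fun h => cosc h k) (-1) _ (bounded_linear_cosc k) Cd).
    rewrite (bounded_linear_scal _ (fun h => sinc h k) (-1) _ (bounded_linear_sinc k) Cd).
    destruct (helmholtz_coefs _ k Cf) as [_ [_ [-> ->]]]. unfold Rdiv. split; ring. }
  assert (HLam : forall Lam, bounded_linear (2 * PI) Lam ->
     (forall t, is_derive (fun t => Lam (fun x => u x t)) t (Lam (fun x => V x t))) ->
     forall t, Lam (fun x => u x t - u x 0 - W x t) = 0).
  { intros Lam HL HD t.
    assert (C1 : cper (fun x => u x t - u x 0)) by (apply (cper_minus (fun x => u x t) (fun x => u x 0)); apply Hu).
    rewrite (bounded_linear_minus _ Lam (fun x => u x t - u x 0) (fun x => W x t) HL C1 (proj1 HW t)).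
    rewrite (bounded_linear_minus _ Lam (fun x => u x t) (fun x => u x 0) HL (proj1 Hu t) (proj1 Hu 0)).
    assert (Z : Lam (fun x => W x 0) = 0).
    { replace (fun x => W x 0) with (fun x => 0 * W x 0)
        by (apply functional_extensionality; intros; rewrite W0; ring).
      rewrite (bounded_linear_scal _ Lam 0 _ HL (proj1 HW 0)). ring. }
    assert (D : Lam (fun x => u x t) - Lam (fun x => W x t) = Lam (fun x => u x 0) - Lam (fun x => W x 0)).
    { apply (derive_zero_const (fun t => Lam (fun x => u x t) - Lam (fun x => W x t))).
      intros s _. eapply is_derive_eq.
      - apply der_minus; [apply HD | apply (bounded_linear_derive _ Lam W V HL HW HV DW)].
      - rring. }
    lra. }
  assert (E : forall t x, u x t - u x 0 - W x t = 0).
  { intros t. apply (fourier_uniqueness (fun x => u x t - u x 0 - W x t)).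
    - apply (cper_minus (fun x => u x t - u x 0) (fun x => W x t)); [|apply HW].
      apply (cper_minus (fun x => u x t) (fun x => u x 0)); apply Hu.
    - intros k. split.
      + apply (HLam (fun h => cosc h k) (bounded_linear_cosc k)). intros s.
        rewrite (proj1 (Cc s k)). now apply cosc_derive.
      + apply (HLam (fun h => sinc h k) (bounded_linear_sinc k)). intros s.
        rewrite (proj2 (Cc s k)). now apply sinc_derive. }
  intros x t. apply (is_derive_ext (fun t => u x 0 + W x t)).
  - intros s. specialize (E s x). simpl in E. lra.
  - eapply is_derive_eq; [apply der_plus; [apply der_const | apply DW]|]. unfold V. rring.
Qed.

(** * Conservation of the H^1 norm *)

Definition fourier_sum_dx (g : R -> R) (N : nat) : R -> R :=
  trig_poly 0 (fun n => IZR (Z.of_nat n) * sinc g (Z.of_nat n) / PI)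
              (fun n => - IZR (Z.of_nat n) * cosc g (Z.of_nat n) / PI) N.

Lemma fourier_sum_derive (g : R -> R) (N : nat) (x : R) :
  is_derive (fourier_sum g N) x (fourier_sum_dx g N x).
Proof.
  unfold fourier_sum, fourier_sum_dx. induction N as [|N IH].
  - apply der_const.
  - cbn [trig_poly]. apply der_plus; [exact IH|]. unfold trig_term.
    generalize (IZR (Z.of_nat (S N))) (cosc g (Z.of_nat (S N))) (sinc g (Z.of_nat (S N))).
    intros z c s. der. assert (Hpi := PI_RGT_0). field. lra.
Qed.

Fixpoint H1_partial (g : R -> R) (N : nat) : R :=
  match N with
  | O => H1_density g 0
  | S n => H1_partial g n + 2 * H1_density g (S n)
  end.

Lemma H1_partial_sum (g : R -> R) (n : nat) :
  H1_partial g (S n) = H1_density g 0 + sum_f_R0 (fun n => 2 * H1_density g (S n)) n.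
Proof.
  induction n as [|n IH]; [reflexivity|].
  rewrite tech5, <- Rplus_assoc, <- IH. reflexivity.
Qed.

Lemma H1_partial_cv (g : R -> R) : in_H1 g ->
  forall eps, 0 < eps -> exists N0, forall N, (N0 <= N)%nat -> Rabs (H1_partial g N - H1_sq g) < eps.
Proof.
  intros H eps He. apply in_H1_iff in H. destruct H as [Hg Hs].
  set (t := fun n => 2 * H1_density g (S n)) in *.
  assert (L : is_lim_seq (sum_f_R0 t) (Series t)).
  { apply (is_lim_seq_ext (sum_n t)); [apply sum_n_Reals|]. apply (Series_correct t Hs). }
  apply is_lim_seq_spec in L. destruct (L (mkposreal eps He)) as [N1 HN1]. simpl in HN1.
  exists (S N1). intros N HN. destruct N as [|N]; [lia|]. rewrite H1_partial_sum.
  unfold H1_sq. fold t. specialize (HN1 N ltac:(lia)).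
  match goal with |- Rabs ?z < _ => replace z with (sum_f_R0 t N - Series t) by ring end.
  exact HN1.
Qed.

Lemma H1_partial_le (g : R -> R) (N : nat) : in_H1 g -> H1_partial g N <= H1_sq g.
Proof.
  intros H.
  assert (Hm : forall k N, H1_partial g N <= H1_partial g (N + k)).
  { induction k as [|k IH]; intros K; [rewrite Nat.add_0_r; lra|].
    rewrite Nat.add_succ_r. cbn [H1_partial]. specialize (IH K).
    pose proof (H1_density_nonneg g (S (K + k))). lra. }
  apply Rnot_lt_le. intros Hlt.
  destruct (H1_partial_cv g H (H1_partial g N - H1_sq g) ltac:(lra)) as [N0 H0].
  specialize (H0 (N + N0)%nat ltac:(lia)). specialize (Hm N0 N). apply Rabs_def2 in H0. lra.
Qed.

Lemma RInt_trig_term (h : R -> R) (a b : nat -> R) (n : nat) : (forall x, continuous h x) ->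
  RInt (fun x => h x * trig_term a b n x) 0 (2 * PI) = a n * cosc h (Z.of_nat n) + b n * sinc h (Z.of_nat n).
Proof.
  intros Ch. unfold trig_term, cosc, sinc. rewrite <- !RInt_scale, <- RInt_add by auto 10 with cont.
  apply RInt_eq. intros; rring.
Qed.

(** Orthogonality gives the exact value with weights k^2, which are then enlarged to 1 + k^2. *)
Lemma parseval_fourier_sum_dx (g : R -> R) (N : nat) :
  RInt (fun x => fourier_sum_dx g N x * fourier_sum_dx g N x) 0 (2 * PI) <= 2 * PI * H1_partial g N.
Proof.
  assert (Hpi := PI_RGT_0). unfold fourier_sum_dx.
  set (a := fun n => IZR (Z.of_nat n) * sinc g (Z.of_nat n) / PI).
  set (b := fun n => - IZR (Z.of_nat n) * cosc g (Z.of_nat n) / PI).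
  induction N as [|N IH].
  - simpl trig_poly. cbn [H1_partial]. pose proof (H1_density_nonneg g 0).
    rewrite RInt_const_R. nra.
  - cbn [trig_poly H1_partial].
    assert (Cp : forall x, continuous (trig_poly 0 a b N) x) by apply trig_poly_cper.
    assert (Cq : forall x, continuous (trig_term a b (S N)) x) by apply trig_term_cper.
    rewrite (RInt_eq _ (fun x => trig_poly 0 a b N x * trig_poly 0 a b N x +
        (2 * (trig_poly 0 a b N x * trig_term a b (S N) x) + trig_term a b (S N) x * trig_term a b (S N) x)))
      by (intros; rring).
    rewrite RInt_add, RInt_add, RInt_scale, !RInt_trig_term by auto 10 with cont.
    destruct (trig_poly_coefs_high 0 a b (S N) N ltac:(lia)) as [-> ->].
    destruct (trig_term_coefs a b (S N) (S N) ltac:(lia)) as [-> ->].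
    destruct (Nat.eq_dec (S N) (S N)); [|lia].
    assert (a (S N) * (PI * a (S N)) + b (S N) * (PI * b (S N)) <= 2 * PI * (2 * H1_density g (S N))); [|lra].
    unfold a, b, H1_density.
    generalize (IZR (Z.of_nat (S N))) (cosc g (Z.of_nat (S N))) (sinc g (Z.of_nat (S N))). intros z c s.
    replace (z * s / PI * (PI * (z * s / PI)) + - z * c / PI * (PI * (- z * c / PI)))
      with (z ^ 2 * (c ^ 2 + s ^ 2) / PI) by (field; lra).
    replace (2 * PI * (2 * ((1 + z ^ 2) * (c ^ 2 + s ^ 2) / (2 * PI) ^ 2)))
      with ((1 + z ^ 2) * (c ^ 2 + s ^ 2) / PI) by (field; lra).
    apply Rmult_le_compat_r; [apply Rlt_le, Rinv_0_lt_compat; lra|]. nra.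
Qed.

Lemma RInt_abs_fourier_sum_dx (g : R -> R) (N : nat) : in_H1 g ->
  RInt (fun x => Rabs (fourier_sum_dx g N x)) 0 (2 * PI) <= PI * (1 + H1_sq g).
Proof.
  intros H. assert (Hpi := PI_RGT_0).
  assert (Cp : forall x, continuous (fourier_sum_dx g N) x) by apply trig_poly_cper.
  pose proof (parseval_fourier_sum_dx g N) as Hp. pose proof (H1_partial_le g N H).
  assert (E : RInt (fun x => Rabs (fourier_sum_dx g N x)) 0 (2 * PI) <=
    RInt (fun x => / 2 + / 2 * (fourier_sum_dx g N x * fourier_sum_dx g N x)) 0 (2 * PI)).
  { apply RInt_mono; auto 10 with cont; [lra|]. intros x _.
    pose proof (pow2_abs (fourier_sum_dx g N x)). pose proof (pow2_ge_0 (Rabs (fourier_sum_dx g N x) - 1)). nra. }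
  rewrite RInt_add, RInt_scale, RInt_const_R in E by auto 10 with cont. nra.
Qed.

(** The integrand is the derivative of a primitive of f composed with the periodic partial sum. *)
Lemma RInt_fourier_sum_flux (f : R -> R) (g : R -> R) (N : nat) : (forall y, continuous f y) ->
  RInt (fun x => f (fourier_sum g N x) * fourier_sum_dx g N x) 0 (2 * PI) = 0.
Proof.
  intros Cf. destruct (trig_poly_cper (cosc g 0 / (2 * PI)) (fun n => cosc g (Z.of_nat n) / PI) (fun n => sinc g (Z.of_nat n) / PI) N) as [P C].
  fold (fourier_sum g N) in P, C.
  assert (Cp : forall x, continuous (fourier_sum_dx g N) x) by apply trig_poly_cper.
  apply (RInt_derive_period (fun x => RInt f 0 (fourier_sum g N x))).
  - intros x. eapply is_derive_eq.
    + apply (der_comp (fourier_sum g N) (fun y => RInt f 0 y)); [apply fourier_sum_derive | now apply der_RInt].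
    + rring.
  - intros x. apply cont_mult; [apply cont_comp; auto | auto].
  - intros x. now rewrite (P x).
Qed.

(** In the derivative of one mode the energy weight 1 + k^2 cancels the division by 1 + k^2 in the
    equation. What remains is k times the pairing of the coefficients of u and f(u), that is f(u)
    integrated against the derivative of the mode. *)
Lemma H1_partial_derive (f : R -> R) (u : R -> R -> R) (N : nat) :
  CT u -> CT (fun x t => f (u x t)) -> distributional_solution f u ->
  forall t, is_derive (fun t => H1_partial (fun x => u x t) N) t
    (RInt (fun x => f (u x t) * fourier_sum_dx (fun x => u x t) N x) 0 (2 * PI) / PI).
Proof.
  intros Hu Hf Hsol t. assert (Hpi := PI_RGT_0).
  assert (Cf : forall x, continuous (fun x => f (u x t)) x) by apply Hf.
  assert (D : forall n, is_derive (fun t => H1_density (fun x => u x t) n) t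
    (2 * IZR (Z.of_nat n) * (sinc (fun x => u x t) (Z.of_nat n) * cosc (fun x => f (u x t)) (Z.of_nat n)
      - cosc (fun x => u x t) (Z.of_nat n) * sinc (fun x => f (u x t)) (Z.of_nat n)) / (2 * PI) ^ 2)).
  { intros n. pose proof (cosc_derive f u (Z.of_nat n) Hu Hf Hsol t) as Dc.
    pose proof (sinc_derive f u (Z.of_nat n) Hu Hf Hsol t) as Ds.
    unfold H1_density. pose proof (one_plus_sq_pos (IZR (Z.of_nat n))). set (z := IZR (Z.of_nat n)) in *.
    apply (is_derive_ext (fun t => (1 + z ^ 2) * (cosc (fun x => u x t) (Z.of_nat n) * cosc (fun x => u x t) (Z.of_nat n)
       + sinc (fun x => u x t) (Z.of_nat n) * sinc (fun x => u x t) (Z.of_nat n)) / (2 * PI) ^ 2)).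
    { intros s. to_R. f_equal. ring. }
    eapply is_derive_eq.
    - apply der_div, der_mult; [apply der_const|]. apply der_plus; apply der_mult; first [exact Dc | exact Ds].
    - to_R. field. lra. }
  unfold fourier_sum_dx.
  set (a := fun n => IZR (Z.of_nat n) * sinc (fun x => u x t) (Z.of_nat n) / PI).
  set (b := fun n => - IZR (Z.of_nat n) * cosc (fun x => u x t) (Z.of_nat n) / PI).
  induction N as [|N IH].
  - eapply is_derive_eq; [apply (D 0%nat)|]. simpl trig_poly. simpl Z.of_nat.
    rewrite (RInt_eq _ (fun _ => 0)) by (intros; rring). rewrite RInt_const_R. to_R. field. lra.
  - cbn [H1_partial]. eapply is_derive_eq.
    + apply der_plus; [exact IH|]. apply der_mult; [apply der_const | apply D].
    + cbn [trig_poly].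
      rewrite (RInt_eq (fun x => f (u x t) * (trig_poly 0 a b N x + trig_term a b (S N) x))
        (fun x => f (u x t) * trig_poly 0 a b N x + f (u x t) * trig_term a b (S N) x)) by (intros; rring).
      assert (Cp : forall x, continuous (trig_poly 0 a b N) x) by apply trig_poly_cper.
      assert (Cq : forall x, continuous (trig_term a b (S N)) x) by apply trig_term_cper.
      rewrite RInt_add by auto with cont.
      rewrite (RInt_trig_term (fun x => f (u x t))) by exact Cf. unfold a at 3, b at 3.
      set (I := RInt (fun x => f (u x t) * trig_poly 0 a b N x) 0 (2 * PI)).
      generalize (IZR (Z.of_nat (S N))). intros z. to_R. field. lra.
Qed.

(** [lam] is fixed first so that the energy term is at most eps / 2, then the order makes the tail
    term at most eps / 2. Neither choice depends on g. *)
Lemma fourier_sum_uniform (A eps : R) : 0 <= A -> 0 < eps ->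
  exists N0, forall N, (N0 <= N)%nat -> forall g, in_H1 g -> H1_sq g <= A ->
    forall x, Rabs (g x - fourier_sum g N x) <= eps.
Proof.
  intros HA He. set (lam := 4 * (A + 1) / eps).
  assert (Hl : 0 < lam) by (apply Rdiv_lt_0_compat; lra).
  destruct (series_tail_small inv_weight ex_series_inv_weight (eps / lam)) as [N0 H0];
    [now apply Rdiv_lt_0_compat|].
  exists N0. intros N HN g Hg HgA x. specialize (H0 N HN).
  eapply Rle_trans; [apply (fourier_sum_error g lam Hg Hl)|].
  fold (weight_tail N) in H0. pose proof (Rle_abs (weight_tail N)).
  assert (lam / 2 * weight_tail N <= eps / 2).
  { replace (eps / 2) with (lam / 2 * (eps / lam)) by (field; lra).
    apply Rmult_le_compat_l; lra. }
  assert (2 / lam * H1_sq g <= eps / 2).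
  { apply Rle_trans with (2 / lam * (A + 1)).
    - apply Rmult_le_compat_l; [apply Rlt_le, Rdiv_lt_0_compat; lra | lra].
    - right. unfold lam. field. lra. }
  lra.
Qed.

Lemma uniformly_continuous_on_bounded (f : R -> R) (M eps : R) :
  (forall y, continuous f y) -> 0 < eps ->
  exists d, 0 < d /\ forall y z, Rabs y <= M -> Rabs z <= M -> Rabs (y - z) < d -> Rabs (f y - f z) < eps.
Proof.
  intros Cf He. destruct (Heine_cor2 (f := f) (a := - M) (b := M)) with (eps := mkposreal eps He) as [d Hd].
  - intros x _. apply continuity_pt_filterlim, Cf.
  - exists d. split; [apply cond_pos|]. intros y z Hy Hz Hyz.
    apply Hd; [now apply Rabs_le_between | now apply Rabs_le_between | exact Hyz].
Qed.

(* The truncated energy has derivative (1/pi) int f(u) (P_N u)_x, and f(u) can be replaced by f(P_N u) up to a uniformly small error, for which the integral vanishes. *)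
Theorem H1_sq_conserved (f : R -> R) (u : R -> R -> R) :
  continuous_in_H1 u -> (forall y, continuous f y) -> CT (fun x t => f (u x t)) ->
  distributional_solution f u ->
  forall t, H1_sq (fun x => u x t) = H1_sq (fun x => u x 0).
Proof.
  intros Hu Cf Hf Hsol t. assert (Hpi := PI_RGT_0).
  pose proof (continuous_in_H1_CT u Hu) as HCT. pose proof Hu as [Hin _].
  destruct (H1_sq_locally_bounded u Hu (- Rabs t) (Rabs t)) as [A HA]; [pose proof (Rabs_pos t); lra|].
  assert (HA0 : 0 <= A).
  { eapply Rle_trans; [apply (H1_sq_nonneg _ (Hin 0)) | apply HA]. pose proof (Rabs_pos t). lra. }
  destruct (CT_locally_bounded u HCT (Rabs t)) as [M [HM HuM]].
  apply cond_eq. intros eps He.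
  (* Truncation at the times [t] and 0 costs [e] each, and the drift of the truncated energy costs
     [e * (1 + A) * Rabs t]. *)
  set (K := 3 + (Rabs t) * (1 + A)).
  assert (HK : 0 < K) by (unfold K; pose proof (Rabs_pos t); nra).
  set (e := eps / K). assert (Hee : 0 < e) by now apply Rdiv_lt_0_compat.
  destruct (uniformly_continuous_on_bounded f (M + 1) e Cf Hee) as [d [Hd Hfd]].
  (* The cap 1 keeps the partial sums in [-(M + 1), M + 1], where the modulus [d] of f is valid. *)
  set (d' := Rmin (d / 2) 1). assert (Hd' : 0 < d') by (apply Rmin_glb_lt; lra).
  assert (Hd'd : d' < d /\ d' <= 1) by (unfold d'; pose proof (Rmin_l (d / 2) 1); pose proof (Rmin_r (d / 2) 1); lra).
  destruct (fourier_sum_uniform A d' HA0 Hd') as [N1 HN1].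
  destruct (H1_partial_cv _ (Hin t) e Hee) as [N2 HN2].
  destruct (H1_partial_cv _ (Hin 0) e Hee) as [N3 HN3].
  set (N := (N1 + N2 + N3)%nat).
  specialize (HN1 N ltac:(lia)). specialize (HN2 N ltac:(lia)). specialize (HN3 N ltac:(lia)).
  assert (Hder : forall s, Rabs s <= Rabs t ->
    Rabs (RInt (fun x => f (u x s) * fourier_sum_dx (fun x => u x s) N x) 0 (2 * PI) / PI) <= e * (1 + A)).
  { intros s Hs. set (g := fun x => u x s).
    assert (HgA : H1_sq g <= A) by (apply HA; now apply Rabs_le_between).
    specialize (HN1 g (Hin s) HgA).
    assert (Cp : forall x, continuous (fourier_sum_dx g N) x) by apply trig_poly_cper.
    assert (Cq : forall x, continuous (fourier_sum g N) x) by apply trig_poly_cper.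
    assert (Cg : forall x, continuous g x) by apply HCT.
    assert (Cfg : forall x, continuous (fun x => f (g x)) x) by (intros; now apply cont_comp).
    assert (Cfq : forall x, continuous (fun x => f (fourier_sum g N x)) x) by (intros; now apply cont_comp).
    assert (E : @RInt R_CompleteNormedModule (fun x => f (g x) * fourier_sum_dx g N x) 0 (2 * PI)
       = @RInt R_CompleteNormedModule (fun x => (f (g x) - f (fourier_sum g N x)) * fourier_sum_dx g N x) 0 (2 * PI)).
    { rewrite (RInt_eq (fun x => (f (g x) - f (fourier_sum g N x)) * fourier_sum_dx g N x)
        (fun x => f (g x) * fourier_sum_dx g N x - f (fourier_sum g N x) * fourier_sum_dx g N x)) by (intros; rring).
      rewrite RInt_sub, RInt_fourier_sum_flux by auto with cont. symmetry. apply Rminus_0_r. }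
    change (Rabs (RInt (fun x => f (g x) * fourier_sum_dx g N x) 0 (2 * PI) / PI) <= e * (1 + A)).
    rewrite E. unfold Rdiv. rewrite Rabs_mult, (Rabs_pos_eq (/ PI)) by (apply Rlt_le, Rinv_0_lt_compat; lra).
    apply Rmult_le_reg_r with PI; [lra|]. rewrite Rmult_assoc, Rinv_l, Rmult_1_r by lra.
    eapply Rle_trans; [apply abs_RInt_le; [lra | apply ex_RInt_cont; auto with cont]|].
    apply Rle_trans with (RInt (fun x => e * Rabs (fourier_sum_dx g N x)) 0 (2 * PI)).
    - apply RInt_mono; auto with cont; [lra|]. intros x _. rewrite Rabs_mult.
      apply Rmult_le_compat_r; [apply Rabs_pos|]. apply Rlt_le, Hfd.
      + specialize (HuM s x Hs). unfold g. lra.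
      + specialize (HuM s x Hs). specialize (HN1 x). unfold g at 1 in HN1.
        pose proof (Rabs_triang_inv (fourier_sum g N x) (u x s)). rewrite Rabs_minus_sym in HN1. lra.
      + specialize (HN1 x). lra.
    - rewrite RInt_scale by auto with cont. pose proof (RInt_abs_fourier_sum_dx g N (Hin s)).
      apply Rle_trans with (e * (PI * (1 + H1_sq g))); [apply Rmult_le_compat_l; lra|].
      rewrite Rmult_assoc. apply Rmult_le_compat_l; [lra|]. nra. }
  destruct (MVT_is_derive (fun t => H1_partial (fun x => u x t) N) _ 0 t
     (fun s _ => H1_partial_derive f u N HCT Hf Hsol s)) as [c [Hc Ec]].
  assert (Hct : Rabs c <= Rabs t).
  { unfold Rmin, Rmax in Hc. destruct (Rle_dec 0 t); unfold Rabs; repeat destruct Rcase_abs; lra. }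
  specialize (Hder c Hct). rewrite Rminus_0_r in Ec.
  assert (Hdiff : Rabs (H1_partial (fun x => u x t) N - H1_partial (fun x => u x 0) N) <= e * (1 + A) * Rabs t).
  { rewrite Ec, Rabs_mult. apply Rmult_le_compat_r; [apply Rabs_pos | exact Hder]. }
  replace eps with (e * K) by (unfold e; field; lra).
  apply Rabs_def2 in HN2. apply Rabs_def2 in HN3. apply Rabs_le_between in Hdiff. unfold K.
  apply Rabs_def1; nra.
Qed.

Lemma solution_bounded (f : R -> R) (u : R -> R -> R) :
  continuous_in_H1 u -> (forall y, continuous f y) -> CT (fun x t => f (u x t)) ->
  distributional_solution f u ->
  exists M, 0 < M /\ forall x t, Rabs (u x t) <= M.
Proof.
  intros Hu Cf Hf Hsol. pose proof Hu as [Hin _].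
  pose proof (H1_sq_nonneg _ (Hin 0)) as H0. pose proof sobolev_const_pos.
  set (A := H1_sq (fun x => u x 0) + 1).
  exists (sobolev_const * A). split; [apply Rmult_lt_0_compat; unfold A; lra|].
  intros x t. apply (sobolev_bound (fun x => u x t)); [apply Hin | unfold A; lra|].
  rewrite (H1_sq_conserved f u Hu Cf Hf Hsol t). unfold A. nra.
Qed.

Lemma trig_poly_abs (c0 : R) (a b : nat -> R) (K : R) (N : nat) (x : R) :
  (forall n, (n <= N)%nat -> Rabs (a n) + Rabs (b n) <= K) ->
  Rabs (trig_poly c0 a b N x) <= Rabs c0 + INR N * K.
Proof.
  induction N as [|N IH]; intros H.
  - simpl. lra.
  - cbn [trig_poly]. rewrite S_INR. eapply Rle_trans; [apply Rabs_triang|].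
    specialize (IH ltac:(intros; apply H; lia)). specialize (H (S N) (le_n _)).
    pose proof (trig_term_abs a b (S N) x). lra.
Qed.

(** Since the H^1 norm is conserved, one truncation order is accurate to eps / 3 at all times. The
    partial sums of that order have coefficients bounded through [M], hence a common Lipschitz
    constant. *)
Lemma solution_equicontinuous (f : R -> R) (u : R -> R -> R) :
  continuous_in_H1 u -> (forall y, continuous f y) -> CT (fun x t => f (u x t)) ->
  distributional_solution f u ->
  forall eps, 0 < eps -> exists d, 0 < d /\
    forall t x y, Rabs (x - y) < d -> Rabs (u x t - u y t) <= eps.
Proof.
  intros Hu Cf Hf Hsol eps He. pose proof Hu as [Hin _]. assert (Hpi := PI_RGT_0).
  destruct (solution_bounded f u Hu Cf Hf Hsol) as [M [HM HuM]].
  destruct (fourier_sum_uniform (H1_sq (fun x => u x 0)) (eps / 3) (H1_sq_nonneg _ (Hin 0)) ltac:(lra)) as [N HN].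
  specialize (HN N (le_n N)).
  (* Both coefficients of a mode of [fourier_sum_dx] are at most N times 2 pi M / pi. *)
  set (K := 4 * INR N * M). assert (HN0 := pos_INR N).
  assert (HK : 0 <= K) by (unfold K; nra).
  assert (Hlip : forall t x, Rabs (fourier_sum_dx (fun x => u x t) N x) <= INR N * K).
  { intros t x. unfold fourier_sum_dx. eapply Rle_trans; [apply (trig_poly_abs _ _ _ K)|].
    - intros n Hn. unfold Rdiv. rewrite !Rabs_mult, Rabs_Ropp, (Rabs_pos_eq (/ PI)) by (apply Rlt_le, Rinv_0_lt_compat; lra).
      rewrite <- INR_IZR_INZ, (Rabs_pos_eq (INR n)) by apply pos_INR.
      destruct (bounded_linear_cosc (Z.of_nat n)) as [_ [_ Bc]].
      destruct (bounded_linear_sinc (Z.of_nat n)) as [_ [_ Bs]].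
      assert (Cu : cper (fun x => u x t)) by now apply in_H1_cper.
      specialize (Bc _ M Cu (fun x => HuM x t)). specialize (Bs _ M Cu (fun x => HuM x t)).
      assert (Hp : forall c, 0 <= c <= 2 * PI * M -> INR n * c * / PI <= 2 * INR N * M).
      { intros c Hc. replace (2 * INR N * M) with (INR N * (2 * PI * M) * / PI) by (field; lra).
        apply Rmult_le_compat_r; [apply Rlt_le, Rinv_0_lt_compat; lra|].
        apply Rmult_le_compat; try lra; [apply pos_INR | now apply le_INR]. }
      specialize (Hp _ (conj (Rabs_pos _) Bc)) as P1. specialize (Hp _ (conj (Rabs_pos _) Bs)) as P2.
      unfold K. lra.
    - rewrite Rabs_R0. lra. }
  set (L := INR N * K + 1). assert (HL : 0 < L) by (unfold L; nra).
  exists (eps / 3 / L). split; [apply Rdiv_lt_0_compat; lra|].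
  intros t x y Hxy.
  assert (HS : Rabs (fourier_sum (fun x => u x t) N x - fourier_sum (fun x => u x t) N y) <= eps / 3).
  { destruct (MVT_is_derive (fourier_sum (fun x => u x t) N) (fourier_sum_dx (fun x => u x t) N) y x
      (fun z _ => fourier_sum_derive _ N z)) as [c [_ ->]].
    rewrite Rabs_mult. apply Rle_trans with (L * (eps / 3 / L)); [|right; field; lra].
    apply Rmult_le_compat; try apply Rabs_pos; [|lra].
    specialize (Hlip t c). unfold L. lra. }
  assert (Ht : H1_sq (fun x => u x t) <= H1_sq (fun x => u x 0))
    by (right; now apply (H1_sq_conserved f)).
  pose proof (HN _ (Hin t) Ht x) as Hx. pose proof (HN _ (Hin t) Ht y) as Hy. simpl in Hx, Hy.
  set (S := fourier_sum (fun x => u x t) N) in *.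
  replace (u x t - u y t) with ((u x t - S x) + ((S x - S y) + - (u y t - S y))) by ring.
  eapply Rle_trans; [apply Rabs_triang|].
  eapply Rle_trans; [apply Rplus_le_compat_l, Rabs_triang|]. rewrite Rabs_Ropp. lra.
Qed.

(** * Analyticity in time *)

(** A Taylor coefficient depends on all earlier ones, so recursion must see the whole past. Stage n
    tabulates the values up to n; entries above n are defaults that [strong_rec] never uses. *)
Fixpoint course_of_values {X : Type} (x0 : X) (Phi : nat -> (nat -> X) -> X) (n : nat) : nat -> X :=
  match n with
  | O => fun _ => x0
  | S m => fun k => if Nat.leb k m then course_of_values x0 Phi m k
                    else Phi m (course_of_values x0 Phi m)
  end.

Definition strong_rec {X : Type} (x0 : X) (Phi : nat -> (nat -> X) -> X) (n : nat) : X :=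
  course_of_values x0 Phi n n.

Lemma strong_rec_S {X : Type} (x0 : X) (Phi : nat -> (nat -> X) -> X) :
  (forall m v w, (forall j, (j <= m)%nat -> v j = w j) -> Phi m v = Phi m w) ->
  forall m, strong_rec x0 Phi (S m) = Phi m (strong_rec x0 Phi).
Proof.
  intros Hext m.
  assert (Hc : forall m k, (k <= m)%nat -> course_of_values x0 Phi m k = strong_rec x0 Phi k).
  { clear m. induction m as [|m IH]; intros k Hk.
    - replace k with 0%nat by lia. reflexivity.
    - destruct (Nat.eq_dec k (S m)) as [->|Hn]; [reflexivity|].
      cbn [course_of_values]. replace (Nat.leb k m) with true by (symmetry; apply Nat.leb_le; lia).
      apply IH. lia. }
  unfold strong_rec at 1. cbn [course_of_values].
  replace (Nat.leb (S m) m) with false by (symmetry; apply Nat.leb_gt; lia).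
  apply Hext. intros j Hj. now apply Hc.
Qed.

(** * Formal power series and the majorant *)

Definition cauchy_prod (v w : nat -> R) (n : nat) : R := sum_f_R0 (fun j => v j * w (n - j)%nat) n.

Fixpoint seq_pow (w : nat -> R) (i : nat) : nat -> R :=
  match i with
  | O => fun n => match n with O => 1 | S _ => 0 end
  | S i => cauchy_prod w (seq_pow w i)
  end.

(* Taylor coefficients of p(u) in terms of those of u. *)
Definition seq_poly (a : nat -> R) (d : nat) (w : nat -> R) (n : nat) : R :=
  sum_f_R0 (fun i => a i * seq_pow w i n) d.

Lemma seq_pow_ext (v w : nat -> R) (i : nat) : forall n,
  (forall j, (j <= n)%nat -> v j = w j) -> seq_pow v i n = seq_pow w i n.
Proof.
  induction i as [|i IH]; intros n H; [reflexivity|].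
  apply sum_eq. intros j Hj. rewrite H by lia. f_equal. apply IH. intros; apply H; lia.
Qed.

Lemma seq_poly_ext (a : nat -> R) (d : nat) (v w : nat -> R) (n : nat) :
  (forall j, (j <= n)%nat -> v j = w j) -> seq_poly a d v n = seq_poly a d w n.
Proof. intros H. apply sum_eq. intros i _. f_equal. now apply seq_pow_ext. Qed.

Lemma seq_poly_0 (a : nat -> R) (d : nat) (w : nat -> R) : seq_poly a d w 0 = polyval a d (w 0%nat).
Proof.
  apply sum_eq. intros i _. f_equal. induction i as [|i IH]; [reflexivity|].
  cbn [seq_pow]. unfold cauchy_prod. cbn [sum_f_R0 Nat.sub]. rewrite IH. reflexivity.
Qed.

Lemma seq_pow_abs (w b : nat -> R) (i : nat) : forall n,
  (forall j, (j <= n)%nat -> Rabs (w j) <= b j) -> Rabs (seq_pow w i n) <= seq_pow b i n.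
Proof.
  induction i as [|i IH]; intros n H.
  - destruct n; cbn [seq_pow]; rewrite Rabs_pos_eq; lra.
  - cbn [seq_pow]. unfold cauchy_prod. eapply Rle_trans; [apply Rsum_abs|].
    apply sum_Rle. intros j Hj. rewrite Rabs_mult.
    apply Rmult_le_compat; try apply Rabs_pos; [apply H; lia|].
    apply IH. intros; apply H; lia.
Qed.

Lemma seq_poly_abs (a : nat -> R) (d : nat) (w b : nat -> R) (n : nat) :
  (forall j, (j <= n)%nat -> Rabs (w j) <= b j) ->
  Rabs (seq_poly a d w n) <= seq_poly (fun i => Rabs (a i)) d b n.
Proof.
  intros H. eapply Rle_trans; [apply Rsum_abs|]. apply sum_Rle. intros i _. rewrite Rabs_mult.
  apply Rmult_le_compat_l; [apply Rabs_pos|]. now apply seq_pow_abs.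
Qed.

Definition weighted_sum (r : R) (w : nat -> R) (N : nat) : R := sum_f_R0 (fun n => w n * r ^ n) N.

Lemma weighted_sum_nonneg (r : R) (w : nat -> R) (N : nat) :
  0 <= r -> (forall n, 0 <= w n) -> 0 <= weighted_sum r w N.
Proof.
  intros Hr Hw. apply cond_pos_sum. intros n. apply Rmult_le_pos; [apply Hw | now apply pow_le].
Qed.

(** The product of the two partial sums contains the whole triangle of the Cauchy product; the terms
    left over have higher total degree and are nonnegative. *)
Lemma weighted_sum_cauchy_prod (r : R) (v w : nat -> R) (N : nat) :
  0 <= r -> (forall n, 0 <= v n) -> (forall n, 0 <= w n) ->
  weighted_sum r (cauchy_prod v w) N <= weighted_sum r v N * weighted_sum r w N.
Proof.
  intros Hr Hv Hw. unfold weighted_sum.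
  assert (Hvr : forall n, 0 <= v n * r ^ n) by (intros; apply Rmult_le_pos; [apply Hv | now apply pow_le]).
  assert (Hwr : forall n, 0 <= w n * r ^ n) by (intros; apply Rmult_le_pos; [apply Hw | now apply pow_le]).
  assert (E : sum_f_R0 (fun n => cauchy_prod v w n * r ^ n) N =
    sum_f_R0 (fun k => sum_f_R0 (fun p => (v p * r ^ p) * (w (k - p)%nat * r ^ (k - p))) k) N).
  { apply sum_eq. intros n _. unfold cauchy_prod. rewrite Rmult_comm, scal_sum.
    apply sum_eq. intros p Hp. replace (r ^ n) with (r ^ p * r ^ (n - p)); [ring|].
    rewrite <- pow_add. f_equal. lia. }
  rewrite E. destruct N as [|N].
  - cbn. right. ring.
  - rewrite (cauchy_finite (fun n => v n * r ^ n) (fun n => w n * r ^ n) (S N)) by lia.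
    match goal with |- ?x <= ?x + ?y => assert (0 <= y); [|lra] end.
    apply cond_pos_sum. intros k. apply cond_pos_sum. intros l. apply Rmult_le_pos; auto.
Qed.

Lemma seq_pow_nonneg (b : nat -> R) (i : nat) : (forall n, 0 <= b n) -> forall n, 0 <= seq_pow b i n.
Proof.
  intros Hb n. eapply Rle_trans; [apply Rabs_pos | apply (seq_pow_abs b b)].
  intros j _. rewrite Rabs_pos_eq; auto. lra.
Qed.

Lemma weighted_sum_seq_pow (r : R) (b : nat -> R) (i N : nat) : 0 <= r -> (forall n, 0 <= b n) ->
  weighted_sum r (seq_pow b i) N <= weighted_sum r b N ^ i.
Proof.
  intros Hr Hb. induction i as [|i IH].
  - cbn [pow]. unfold weighted_sum. induction N as [|N IHN]; [cbn; lra|].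
    rewrite tech5. cbn [seq_pow] in *. lra.
  - cbn [seq_pow pow]. eapply Rle_trans.
    + apply weighted_sum_cauchy_prod; auto. now apply seq_pow_nonneg.
    + apply Rmult_le_compat_l; [now apply weighted_sum_nonneg | exact IH].
Qed.

Lemma weighted_sum_seq_poly (r : R) (a b : nat -> R) (d N : nat) :
  0 <= r -> (forall n, 0 <= b n) -> (forall i, 0 <= a i) ->
  weighted_sum r (seq_poly a d b) N <= polyval a d (weighted_sum r b N).
Proof.
  intros Hr Hb Ha. unfold polyval, seq_poly.
  induction d as [|d IH]; cbn [sum_f_R0].
  - unfold weighted_sum at 1. rewrite (sum_eq _ (fun n => (seq_pow b 0 n * r ^ n) * a 0%nat)) by (intros; ring).
    rewrite <- scal_sum. apply Rmult_le_compat_l; [apply Ha|]. now apply (weighted_sum_seq_pow r b 0).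
  - unfold weighted_sum at 1.
    rewrite (sum_eq _ (fun n => sum_f_R0 (fun i => a i * seq_pow b i n) d * r ^ n
        + (seq_pow b (S d) n * r ^ n) * a (S d))) by (intros; ring).
    rewrite sum_plus. rewrite <- scal_sum. apply Rplus_le_compat; [exact IH|].
    apply Rmult_le_compat_l; [apply Ha|]. now apply (weighted_sum_seq_pow r b (S d)).
Qed.

Lemma polyval_mono (a : nat -> R) (d : nat) (x y : R) :
  (forall i, 0 <= a i) -> 0 <= x <= y -> polyval a d x <= polyval a d y.
Proof.
  intros Ha Hxy. apply sum_Rle. intros i _. apply Rmult_le_compat_l; [apply Ha|].
  now apply pow_incr.
Qed.

Lemma seq_poly_abs_nonneg (a b : nat -> R) (d n : nat) : (forall j, (j <= n)%nat -> 0 <= b j) ->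
  0 <= seq_poly (fun i => Rabs (a i)) d b n.
Proof.
  intros Hb. eapply Rle_trans; [apply Rabs_pos | apply (seq_poly_abs a d b b)].
  intros j Hj. rewrite Rabs_pos_eq by auto. lra.
Qed.

(* Majorant of the time-Taylor coefficients: the coefficients of b' = sum |a_i| b^i, b(0) = M. *)
Definition majorant (a : nat -> R) (d : nat) (M : R) : nat -> R :=
  strong_rec M (fun m b => seq_poly (fun i => Rabs (a i)) d b m / INR (S m)).

Lemma majorant_S (a : nat -> R) (d : nat) (M : R) (m : nat) :
  majorant a d M (S m) = seq_poly (fun i => Rabs (a i)) d (majorant a d M) m / INR (S m).
Proof.
  apply (strong_rec_S M (fun m b => seq_poly (fun i => Rabs (a i)) d b m / INR (S m))).
  intros k v w H. f_equal. now apply seq_poly_ext.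
Qed.

Lemma majorant_nonneg (a : nat -> R) (d : nat) (M : R) : 0 <= M -> forall n, 0 <= majorant a d M n.
Proof.
  intros HM. assert (H : forall n j, (j <= n)%nat -> 0 <= majorant a d M j).
  { induction n as [|n IH]; intros j Hj.
    - replace j with 0%nat by lia. exact HM.
    - destruct (Nat.eq_dec j (S n)) as [->|Hn]; [|apply IH; lia].
      rewrite majorant_S. apply Rmult_le_pos; [|apply Rlt_le, Rinv_0_lt_compat, lt_0_INR; lia].
      now apply seq_poly_abs_nonneg. }
  intros n. now apply (H n n).
Qed.

Lemma polyval_nonneg (a : nat -> R) (d : nat) (x : R) : (forall i, 0 <= a i) -> 0 <= x -> 0 <= polyval a d x.
Proof.
  intros Ha Hx. apply cond_pos_sum. intros i. apply Rmult_le_pos; [apply Ha | now apply pow_le].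
Qed.

(** With Q(y) = sum |a_i| y^i, dropping the divisors n + 1 from the recursion gives S_{N+1} <= M + r
    Q(S_N) for the partial sums at radius r. The bound 2 M reproduces itself as soon as r Q(2 M) <=
    M. *)
Lemma majorant_weighted_sum (a : nat -> R) (d : nat) (M r : R) : 0 < M -> 0 < r ->
  r * polyval (fun i => Rabs (a i)) d (2 * M) <= M ->
  forall N, weighted_sum r (majorant a d M) N <= 2 * M.
Proof.
  intros HM Hr Hsmall.
  assert (Hb := majorant_nonneg a d M ltac:(lra)).
  induction N as [|N IH].
  - unfold weighted_sum. cbn. unfold majorant, strong_rec. cbn. lra.
  - unfold weighted_sum. rewrite decomp_sum by lia. cbn [Init.Nat.pred pow].
    replace (majorant a d M 0) with M by reflexivity.
    assert (E : sum_f_R0 (fun i => majorant a d M (S i) * (r * r ^ i)) N <=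
       r * weighted_sum r (seq_poly (fun i => Rabs (a i)) d (majorant a d M)) N).
    { unfold weighted_sum. rewrite scal_sum. apply sum_Rle. intros n _. rewrite majorant_S.
      set (q := seq_poly (fun i => Rabs (a i)) d (majorant a d M) n).
      assert (Hq : 0 <= q) by (now apply seq_poly_abs_nonneg).
      assert (Hn : 1 <= INR (S n)) by (rewrite S_INR; pose proof (pos_INR n); lra).
      assert (q / INR (S n) <= q).
      { apply Rmult_le_reg_r with (INR (S n)); [lra|]. unfold Rdiv. rewrite Rmult_assoc, Rinv_l by lra. nra. }
      assert (0 <= r * r ^ n) by (apply Rmult_le_pos; [lra | apply pow_le; lra]).
      replace (q * r ^ n * r) with (q * (r * r ^ n)) by ring. now apply Rmult_le_compat_r. }
    assert (E2 := weighted_sum_seq_poly r (fun i => Rabs (a i)) (majorant a d M) d N ltac:(lra) Hb (fun i => Rabs_pos (a i))).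
    assert (E3 := polyval_mono (fun i => Rabs (a i)) d _ _ (fun i => Rabs_pos (a i))
       (conj (weighted_sum_nonneg r (majorant a d M) N ltac:(lra) Hb) IH)).
    assert (r * weighted_sum r (seq_poly (fun i => Rabs (a i)) d (majorant a d M)) N
       <= r * polyval (fun i => Rabs (a i)) d (2 * M)) by (apply Rmult_le_compat_l; lra).
    lra.
Qed.

Lemma weighted_term_le (r : R) (w : nat -> R) (n : nat) : 0 <= r -> (forall n, 0 <= w n) ->
  w n * r ^ n <= weighted_sum r w n.
Proof.
  intros Hr Hw. destruct n as [|n]; [unfold weighted_sum; cbn; lra|].
  unfold weighted_sum. rewrite tech5.
  assert (0 <= weighted_sum r w n) by now apply weighted_sum_nonneg. unfold weighted_sum in *. lra.
Qed.

(** Bounded partial sums at radius r bound each term by a multiple of r^(-n). The radius M / (Q(2 M)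
    + 1) depends only on the polynomial and on [M], hence not on time. *)
Lemma majorant_geometric (a : nat -> R) (d : nat) (M : R) : 0 < M ->
  exists A B, 0 < A /\ 0 < B /\ forall n,
    majorant a d M n <= A * B ^ n /\
    seq_poly (fun i => Rabs (a i)) d (majorant a d M) n <= A * B ^ n.
Proof.
  intros HM. set (Q := polyval (fun i => Rabs (a i)) d (2 * M)).
  assert (HQ : 0 <= Q) by (apply polyval_nonneg; [intros; apply Rabs_pos | lra]).
  set (r := M / (Q + 1)). assert (Hr : 0 < r) by (apply Rdiv_lt_0_compat; lra).
  assert (Hsmall : r * Q <= M).
  { assert (r * (Q + 1) = M) by (unfold r; field; lra). nra. }
  assert (Hb := majorant_nonneg a d M ltac:(lra)).
  assert (HS := majorant_weighted_sum a d M r HM Hr Hsmall).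
  exists (2 * M + Q), (/ r). split; [lra|]. split; [now apply Rinv_0_lt_compat|].
  assert (Hdiv : forall w n, w * r ^ n <= 2 * M + Q -> w <= (2 * M + Q) * (/ r) ^ n).
  { intros w n H. assert (Hp : 0 < r ^ n) by now apply pow_lt.
    apply Rmult_le_reg_r with (r ^ n); [exact Hp|].
    rewrite Rmult_assoc, <- Rpow_mult_distr, Rinv_l, pow1 by lra. lra. }
  intros n. split; apply Hdiv.
  - pose proof (weighted_term_le r _ n ltac:(lra) Hb). specialize (HS n). lra.
  - assert (Hs : forall n, 0 <= seq_poly (fun i => Rabs (a i)) d (majorant a d M) n) by (intros; now apply seq_poly_abs_nonneg).
    pose proof (weighted_term_le r _ n ltac:(lra) Hs).
    pose proof (weighted_sum_seq_poly r (fun i => Rabs (a i)) (majorant a d M) d n ltac:(lra) Hb (fun i => Rabs_pos (a i))).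
    pose proof (polyval_mono (fun i => Rabs (a i)) d _ _ (fun i => Rabs_pos (a i))
       (conj (weighted_sum_nonneg r (majorant a d M) n ltac:(lra) Hb) (HS n))).
    fold Q in H1. lra.
Qed.

(** * Time jets of the solution *)

(** Leibniz rule for derivatives divided by factorials: in the term of index j of order n + 1, the
    factor n + 1 splits as j + (n + 1 - j), one share for each factor. *)
Lemma cauchy_prod_derive (v w : nat -> R -> R) (n : nat) (t : R) :
  (forall j, (j <= n)%nat -> is_derive (v j) t (INR (S j) * v (S j) t)) ->
  (forall j, (j <= n)%nat -> is_derive (w j) t (INR (S j) * w (S j) t)) ->
  is_derive (fun t => cauchy_prod (fun j => v j t) (fun j => w j t) n) t
    (INR (S n) * cauchy_prod (fun j => v j t) (fun j => w j t) (S n)).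
Proof.
  intros Hv Hw. unfold cauchy_prod. eapply is_derive_eq.
  - apply (der_sum (fun j t => v j t * w (n - j)%nat t)
      (fun j t => INR (S j) * v (S j) t * w (n - j)%nat t + v j t * (INR (S (n - j)) * w (S (n - j)) t))).
    intros j Hj. apply der_mult; [apply Hv; lia | apply Hw; lia].
  - to_R. rewrite sum_plus.
    assert (E1 : sum_f_R0 (fun j => INR (S j) * v (S j) t * w (n - j)%nat t) n =
       sum_f_R0 (fun j => INR j * (v j t * w (S n - j)%nat t)) (S n)).
    { rewrite (decomp_sum (fun j => INR j * (v j t * w (S n - j)%nat t))) by lia.
      cbn [Init.Nat.pred INR]. rewrite Rmult_0_l, Rplus_0_l. apply sum_eq. intros j _.
      cbn [Nat.sub]. ring. }
    assert (E2 : sum_f_R0 (fun j => v j t * (INR (S (n - j)) * w (S (n - j)) t)) n =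
       sum_f_R0 (fun j => (INR (S n) - INR j) * (v j t * w (S n - j)%nat t)) (S n)).
    { rewrite tech5, Rminus_diag, Rmult_0_l, Rplus_0_r. apply sum_eq. intros j Hj.
      rewrite <- minus_INR by lia. replace (S n - j)%nat with (S (n - j)) by lia. ring. }
    rewrite E1, E2, <- sum_plus, scal_sum. apply sum_eq. intros; ring.
Qed.

Lemma seq_pow_derive (w : nat -> R -> R) (t : R) (i n : nat) :
  (forall j, (j <= n)%nat -> is_derive (w j) t (INR (S j) * w (S j) t)) ->
  forall k, (k <= n)%nat ->
  is_derive (fun t => seq_pow (fun j => w j t) i k) t (INR (S k) * seq_pow (fun j => w j t) i (S k)).
Proof.
  intros Hw. induction i as [|i IH]; intros k Hk.
  - cbn [seq_pow]. rewrite Rmult_0_r. apply der_const.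
  - cbn [seq_pow]. apply (cauchy_prod_derive w (fun k t => seq_pow (fun j => w j t) i k)).
    + intros j Hj. apply Hw. lia.
    + intros j Hj. apply IH. lia.
Qed.

Lemma seq_poly_derive (a : nat -> R) (d : nat) (w : nat -> R -> R) (t : R) (n : nat) :
  (forall j, (j <= n)%nat -> is_derive (w j) t (INR (S j) * w (S j) t)) ->
  is_derive (fun t => seq_poly a d (fun j => w j t) n) t (INR (S n) * seq_poly a d (fun j => w j t) (S n)).
Proof.
  intros Hw. unfold seq_poly. eapply is_derive_eq.
  - apply (der_sum (fun i t => a i * seq_pow (fun j => w j t) i n)
      (fun i t => a i * (INR (S n) * seq_pow (fun j => w j t) i (S n)))).
    intros i _. eapply is_derive_eq.
    + apply der_mult; [apply der_const | apply (seq_pow_derive w t i n Hw n (le_n n))].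
    + to_R. ring.
  - to_R. rewrite scal_sum. apply sum_eq. intros; ring.
Qed.

Lemma CT_seq_pow (W : nat -> R -> R -> R) (i : nat) : forall n, (forall j, (j <= n)%nat -> CT (W j)) ->
  CT (fun x t => seq_pow (fun j => W j x t) i n).
Proof.
  induction i as [|i IH]; intros n H.
  - exact (CT_const (match n with O => 1 | S _ => 0 end)).
  - cbn [seq_pow]. unfold cauchy_prod.
    apply (CT_sum (fun j x t => W j x t * seq_pow (fun j => W j x t) i (n - j)%nat)).
    intros j Hj. apply CT_mult; [apply H; lia|]. apply IH. intros; apply H; lia.
Qed.

Lemma CT_seq_poly (a : nat -> R) (d : nat) (W : nat -> R -> R -> R) (n : nat) :
  (forall j, (j <= n)%nat -> CT (W j)) -> CT (fun x t => seq_poly a d (fun j => W j x t) n).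
Proof.
  intros H. apply (CT_sum (fun i x t => a i * seq_pow (fun j => W j x t) i n)).
  intros i _. apply CT_scal. now apply CT_seq_pow.
Qed.

(* jet n = d_t^n u / n! when u solves u_t = - d_x (1 - d_x^2)^{-1} p(u). *)
Definition jet (a : nat -> R) (d : nat) (u : R -> R -> R) : nat -> R -> R -> R :=
  strong_rec u (fun m J x t => - helmholtz_dx (fun y => seq_poly a d (fun j => J j y t) m) x / INR (S m)).

Lemma jet_S (a : nat -> R) (d : nat) (u : R -> R -> R) (m : nat) :
  jet a d u (S m) = fun x t => - helmholtz_dx (fun y => seq_poly a d (fun j => jet a d u j y t) m) x / INR (S m).
Proof.
  apply (strong_rec_S u (fun m J x t => - helmholtz_dx (fun y => seq_poly a d (fun j => J j y t) m) x / INR (S m))).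
  intros k v w H. do 2 (apply functional_extensionality; intros). do 3 f_equal.
  apply functional_extensionality. intros y. apply seq_poly_ext. intros j Hj. now rewrite H.
Qed.

Lemma jet_CT (a : nat -> R) (d : nat) (u : R -> R -> R) : CT u -> forall n, CT (jet a d u n).
Proof.
  intros Hu. assert (H : forall n j, (j <= n)%nat -> CT (jet a d u j)).
  { induction n as [|n IH]; intros j Hj.
    - replace j with 0%nat by lia. exact Hu.
    - destruct (Nat.eq_dec j (S n)) as [->|Hn]; [|apply IH; lia].
      rewrite jet_S.
      pose proof (CT_helmholtz_dx _ (CT_seq_poly a d (jet a d u) n IH)) as HC.
      replace (fun x t => - helmholtz_dx (fun y => seq_poly a d (fun j => jet a d u j y t) n) x / INR (S n))
        with (fun x t => (- / INR (S n)) * helmholtz_dx (fun y => seq_poly a d (fun j => jet a d u j y t) n) x).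
      + apply (CT_scal (- / INR (S n)) _ HC).
      + do 2 (apply functional_extensionality; intros). unfold Rdiv. ring. }
  intros n. now apply (H n n).
Qed.

(** Point values of [helmholtz_dx] are bounded functionals, so the time derivative passes inside to
    the Taylor coefficients of p(u), where the Leibniz rule applies. *)
Lemma jet_derive (a : nat -> R) (d : nat) (u : R -> R -> R) : CT u ->
  (forall x t, is_derive (fun t => u x t) t (- helmholtz_dx (fun y => polyval a d (u y t)) x)) ->
  forall n x t, is_derive (fun t => jet a d u n x t) t (INR (S n) * jet a d u (S n) x t).
Proof.
  intros Hu Hder. pose proof (jet_CT a d u Hu) as HC.
  assert (H : forall n j, (j <= n)%nat -> forall x t, is_derive (fun t => jet a d u j x t) t (INR (S j) * jet a d u (S j) x t)).
  { induction n as [|n IH]; intros j Hj x t.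
    - replace j with 0%nat by lia. eapply is_derive_eq; [apply Hder|].
      rewrite jet_S. to_R. cbn [INR]. unfold Rdiv. rewrite Rinv_1, Rmult_1_l, Rmult_1_r.
      do 2 f_equal. apply functional_extensionality. intros y. now rewrite seq_poly_0.
    - destruct (Nat.eq_dec j (S n)) as [->|Hn]; [|apply IH; lia].
      rewrite (jet_S a d u (S n)). rewrite (jet_S a d u n).
      assert (Hsp : forall m, CT (fun x t => seq_poly a d (fun j => jet a d u j x t) m)).
      { intros m. apply CT_seq_poly. intros; apply HC. }
      pose proof (bounded_linear_derive 1 (fun g => helmholtz_dx g x) _ _ (bounded_linear_helmholtz_dx x)
        (Hsp n) (CT_scal (INR (S n)) _ (Hsp (S n)))) as HB.
      eapply is_derive_eq.
      + apply der_div, der_opp, HB. intros y s. apply (seq_poly_derive a d (fun j s => jet a d u j y s) s n).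
        intros k Hk. now apply IH.
      + rewrite (bounded_linear_scal 1 (fun g => helmholtz_dx g x) (INR (S n)) (fun y => seq_poly a d (fun j => jet a d u j y t) (S n))
          (bounded_linear_helmholtz_dx x) (proj1 (Hsp (S n)) t)).
        to_R. field. split; apply not_0_INR; lia. }
  intros n. now apply (H n n).
Qed.

(** As [helmholtz_dx] has norm at most 1 on C(T), the recursion of the jets is dominated term by
    term by that of [majorant]. *)
Lemma jet_bound (a : nat -> R) (d : nat) (u : R -> R -> R) (M : R) : CT u -> 0 <= M ->
  (forall x t, Rabs (u x t) <= M) -> forall n x t, Rabs (jet a d u n x t) <= majorant a d M n.
Proof.
  intros Hu HM HuM. pose proof (jet_CT a d u Hu) as HC.
  assert (H : forall n j, (j <= n)%nat -> forall x t, Rabs (jet a d u j x t) <= majorant a d M j).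
  { induction n as [|n IH]; intros j Hj x t.
    - replace j with 0%nat by lia. apply HuM.
    - destruct (Nat.eq_dec j (S n)) as [->|Hn]; [|apply IH; lia].
      rewrite jet_S, majorant_S.
      assert (Hp : 0 < / INR (S n)) by (apply Rinv_0_lt_compat, lt_0_INR; lia).
      unfold Rdiv. rewrite Rabs_mult, Rabs_Ropp, (Rabs_pos_eq (/ INR (S n))) by lra.
      apply Rmult_le_compat_r; [lra|].
      destruct (bounded_linear_helmholtz_dx x) as [_ [_ B]].
      rewrite <- (Rmult_1_l (seq_poly _ _ _ _)). apply B.
      + apply (CT_seq_poly a d (jet a d u) n). intros; apply HC.
      + intros y. apply seq_poly_abs. intros k Hk. now apply IH. }
  intros n. now apply (H n n).
Qed.

(** * Unique continuation in time *)

Lemma locally_constant_derive (h : R -> R) (v l lo hi x : R) :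
  (forall y, lo < y < hi -> h y = v) -> lo < x < hi -> is_derive h x l -> l = 0.
Proof.
  intros H Hx D. rewrite <- (is_derive_unique _ _ _ D). apply is_derive_unique.
  apply (is_derive_ext_near (fun _ => v) _ x 0 (Rmin (x - lo) (hi - x))); [apply Rmin_glb_lt; lra | | apply der_const].
  intros s Hs. pose proof (Rmin_l (x - lo) (hi - x)). pose proof (Rmin_r (x - lo) (hi - x)).
  apply Rabs_def2 in Hs. symmetry. apply H. lra.
Qed.

Lemma derive_chain_open_zero (h : nat -> R -> R) (a b : R) :
  (forall n t, is_derive (h n) t (INR (S n) * h (S n) t)) ->
  (forall t, a < t < b -> h 0%nat t = 0) -> forall n t, a < t < b -> h n t = 0.
Proof.
  intros Hd H0. induction n as [|n IH]; [exact H0|]. intros t Ht.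
  assert (E : INR (S n) * h (S n) t = 0).
  { exact (locally_constant_derive _ 0 _ a b t IH Ht (Hd n t)). }
  apply Rmult_integral in E. destruct E as [E|E]; [|exact E].
  exfalso. revert E. apply not_0_INR. lia.
Qed.

(** [h n] is the n-th derivative of [h 0] over n!. All Taylor coefficients at [t0] vanish, and
    within distance 1 / (2 B) the Lagrange remainder of order N + 1 is at most A / 2^(N + 1). *)
Lemma derive_chain_taylor_zero (h : nat -> R -> R) (A B : R) :
  0 < A -> 0 < B ->
  (forall n t, is_derive (h n) t (INR (S n) * h (S n) t)) ->
  (forall n t, Rabs (h n t) <= A * B ^ n) ->
  forall t0, (forall n, h n t0 = 0) -> forall s, t0 <= s <= t0 + / (2 * B) -> h 0%nat s = 0.
Proof.
  intros HA HB Hd Hb t0 Hz s Hs.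
  destruct (Req_dec s t0) as [->|Hne]; [apply Hz|].
  assert (HD : forall n t, Derive_n (h 0%nat) n t = INR (fact n) * h n t).
  { induction n as [|n IH]; intros t; [cbn; ring|].
    cbn [Derive_n]. rewrite (Derive_ext _ _ _ (fun s => IH s)).
    apply is_derive_unique. eapply is_derive_eq; [apply der_mult; [apply der_const | apply Hd]|].
    to_R. rewrite fact_simpl, mult_INR. ring. }
  assert (HE : forall n t, ex_derive_n (h 0%nat) n t).
  { intros [|n] t; [exact I|]. cbn [ex_derive_n].
    apply (ex_derive_ext (fun t => INR (fact n) * h n t)); [intros; now rewrite HD|].
    eexists. apply der_mult; [apply der_const | apply Hd]. }
  assert (Hsmall : forall N, Rabs (h 0%nat s) <= A * (/ 2) ^ (S N)).
  { intros N. destruct (Taylor_Lagrange (h 0%nat) N t0 s ltac:(lra)) as [z [Hz' ->]]; [intros; apply HE|].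
    rewrite (sum_eq _ (fun _ => 0 * 0)) by (intros; rewrite HD, Hz; ring).
    rewrite <- (scal_sum (fun _ => 0)), Rmult_0_l, Rplus_0_l, HD.
    pose proof (INR_fact_neq_0 (S N)) as Hf.
    replace ((s - t0) ^ S N / INR (fact (S N)) * (INR (fact (S N)) * h (S N) z))
      with ((s - t0) ^ S N * h (S N) z) by (field; exact Hf).
    rewrite Rabs_mult, <- RPow_abs, (Rabs_pos_eq (s - t0)) by lra.
    apply Rle_trans with ((/ (2 * B)) ^ S N * (A * B ^ S N)).
    - apply Rmult_le_compat; [apply pow_le; lra | apply Rabs_pos | apply pow_incr; lra | apply Hb].
    - right. replace (/ 2) with (/ (2 * B) * B) by (field; lra). rewrite Rpow_mult_distr. ring. }
  apply cond_eq. intros eps He. rewrite Rminus_0_r.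
  destruct (pow_lt_1_zero (/ 2)) with (y := eps / A) as [N HN].
  - rewrite Rabs_pos_eq; lra.
  - now apply Rdiv_lt_0_compat.
  - specialize (HN (S N) ltac:(lia)). rewrite Rabs_pos_eq in HN by (apply pow_le; lra).
    specialize (Hsmall N). eapply Rle_lt_trans; [exact Hsmall|].
    replace eps with (A * (eps / A)) by (field; lra). now apply Rmult_lt_compat_l.
Qed.

Lemma derive_chain_forward_zero (h : nat -> R -> R) (A B a b : R) :
  0 < A -> 0 < B ->
  (forall n t, is_derive (h n) t (INR (S n) * h (S n) t)) ->
  (forall n t, Rabs (h n t) <= A * B ^ n) ->
  a < b -> (forall t, a < t < b -> h 0%nat t = 0) -> forall t, a < t -> h 0%nat t = 0.
Proof.
  intros HA HB Hd Hb Hab H0 t Ht.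
  set (c := (a + b) / 2). set (rho := / (2 * B)).
  assert (Hrho : 0 < rho) by (apply Rinv_0_lt_compat; lra).
  assert (Hk : forall k s, a < s < b + INR k * (rho / 2) -> h 0%nat s = 0).
  { induction k as [|k IH]; intros s Hs.
    - apply H0. cbn in Hs. lra.
    - rewrite S_INR in Hs. set (e := b + INR k * (rho / 2)) in *.
      assert (He : b <= e) by (unfold e; pose proof (pos_INR k); nra).
      destruct (Rlt_dec s e) as [Hse|Hse]; [apply IH; lra|].
      (* The restart lies inside the interval already covered, where the whole chain vanishes; the
         midpoint [c] keeps it to the right of [a]. A Taylor step of length [rho] gains at least
         [3 * rho / 4], of which [rho / 2] is claimed. *)
      set (t0 := Rmax c (e - rho / 4)).
      assert (Ht0 : a < t0 /\ t0 < e /\ e - rho / 4 <= t0).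
      { unfold t0. pose proof (Rmax_l c (e - rho / 4)). pose proof (Rmax_r c (e - rho / 4)).
        repeat split; [unfold c in *; lra | apply Rmax_lub_lt; unfold c; lra | lra]. }
      apply (derive_chain_taylor_zero h A B HA HB Hd Hb t0).
      + intros n. apply (derive_chain_open_zero h a e Hd); [exact IH | lra].
      + fold rho. assert (e = b + INR k * (rho / 2)) by reflexivity. lra. }
  destruct (INR_unbounded ((t - b) / (rho / 2))) as [k Hk'].
  apply (Hk k). split; [exact Ht|].
  apply (Rmult_lt_compat_r (rho / 2)) in Hk'; [|lra].
  replace ((t - b) / (rho / 2) * (rho / 2)) with (t - b) in Hk' by (field; lra). lra.
Qed.

Theorem derive_chain_unique_continuation (h : nat -> R -> R) (A B a b : R) :
  0 < A -> 0 < B ->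
  (forall n t, is_derive (h n) t (INR (S n) * h (S n) t)) ->
  (forall n t, Rabs (h n t) <= A * B ^ n) ->
  a < b -> (forall t, a < t < b -> h 0%nat t = 0) -> forall t, h 0%nat t = 0.
Proof.
  intros HA HB Hd Hb Hab H0 t.
  destruct (Rlt_dec a t) as [Hat|Hat].
  - now apply (derive_chain_forward_zero h A B a b).
  (* Backward continuation is forward continuation of the time-reversed chain; the sign preserves
     the derivative rule. *)
  - set (k := fun n t => (-1) ^ n * h n (- t)).
    assert (E : k 0%nat (- t) = 0).
    { apply (derive_chain_forward_zero k A B (- b) (- a)); auto; try lra.
      - intros n s. unfold k. eapply is_derive_eq.
        + apply der_mult; [apply der_const|].
          apply (der_comp (fun t => - t) (h n) s (-1)); [der; ring | apply Hd].
        + to_R. cbn [pow]. ring.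
      - intros n s. unfold k. rewrite Rabs_mult, pow_1_abs, Rmult_1_l. apply Hb.
      - intros s Hs. unfold k. cbn [pow]. rewrite Rmult_1_l. apply H0. lra. }
    unfold k in E. cbn [pow] in E. rewrite Ropp_involutive, Rmult_1_l in E. exact E.
Qed.

(** Both quantities head a chain of normalised time derivatives with the same geometric bound: the
    jets of u at [x0], and [helmholtz] at [x0] applied to the Taylor coefficients of p(u). *)
Lemma time_unique_continuation (a : nat -> R) (d : nat) (u : R -> R -> R) (M x0 c T : R) :
  CT u -> 0 < M -> (forall x t, Rabs (u x t) <= M) ->
  (forall x t, is_derive (fun t => u x t) t (- helmholtz_dx (fun y => polyval a d (u y t)) x)) ->
  0 < T ->
  (forall t, 0 < t < T -> u x0 t = c /\ helmholtz (fun y => polyval a d (u y t)) x0 = polyval a d c) ->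
  forall t, u x0 t = c /\ helmholtz (fun y => polyval a d (u y t)) x0 = polyval a d c.
Proof.
  intros Hu HM HuM Hder HT H.
  pose proof (jet_CT a d u Hu) as HC. pose proof (jet_derive a d u Hu Hder) as HD.
  pose proof (jet_bound a d u M Hu (Rlt_le _ _ HM) HuM) as HB.
  destruct (majorant_geometric a d M HM) as [A [B [HA [HBp HAB]]]].
  assert (Hsp : forall m, CT (fun x t => seq_poly a d (fun j => jet a d u j x t) m)).
  { intros m. apply CT_seq_poly. intros; apply HC. }
  assert (Hshift : forall (h : nat -> R -> R) (v : R),
     (forall n t, is_derive (h n) t (INR (S n) * h (S n) t)) ->
     (forall n t, Rabs (h n t) <= A * B ^ n) ->
     (forall t, 0 < t < T -> h 0%nat t = v) -> forall t, h 0%nat t = v).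
  { intros h v Hd Hb H0 t.
    (* Subtracting a constant touches only the head of the chain and costs [Rabs v] in the bound. *)
    set (k := fun n t => match n with O => h 0%nat t - v | S _ => h n t end).
    assert (E : k 0%nat t = 0); [|unfold k in E; lra].
    apply (derive_chain_unique_continuation k (A + Rabs v) B 0 T); auto.
    - pose proof (Rabs_pos v). lra.
    - intros [|n] s; [|apply Hd]. unfold k. eapply is_derive_eq.
      + apply der_minus; [apply Hd | apply der_const].
      + to_R. ring.
    - intros n s. assert (Hbn := Hb n s). assert (0 < B ^ n) by now apply pow_lt.
      pose proof (Rabs_pos v). destruct n as [|n].
      + unfold k. cbn [pow] in *. unfold Rminus. eapply Rle_trans; [apply Rabs_triang|].
        rewrite Rabs_Ropp. lra.
      + unfold k. nra.
    - intros s Hs. unfold k. rewrite H0 by exact Hs. ring. }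
  intros t. split.
  - apply (Hshift (fun n t => jet a d u n x0 t) c).
    + intros n s. apply HD.
    + intros n s. eapply Rle_trans; [apply HB | apply HAB].
    + intros s Hs. now apply H.
  - assert (E0 : forall s, helmholtz (fun y => seq_poly a d (fun j => jet a d u j y s) 0) x0
        = helmholtz (fun y => polyval a d (u y s)) x0).
    { intros s. f_equal. apply functional_extensionality. intros y. apply seq_poly_0. }
    rewrite <- E0.
    apply (Hshift (fun n t => helmholtz (fun y => seq_poly a d (fun j => jet a d u j y t) n) x0) (polyval a d c)).
    + intros n s.
      rewrite <- (bounded_linear_scal 1 (fun g => helmholtz g x0) (INR (S n)) (fun y => seq_poly a d (fun j => jet a d u j y s) (S n))
          (bounded_linear_helmholtz x0) (proj1 (Hsp (S n)) s)).
      apply (bounded_linear_derive 1 (fun g => helmholtz g x0) _ _ (bounded_linear_helmholtz x0)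
        (Hsp n) (CT_scal (INR (S n)) _ (Hsp (S n)))).
      intros y r. apply (seq_poly_derive a d (fun j s => jet a d u j y s) r n).
      intros k Hk. apply HD.
    + intros n s. destruct (bounded_linear_helmholtz x0) as [_ [_ Bd]].
      apply Rle_trans with (1 * seq_poly (fun i => Rabs (a i)) d (majorant a d M) n).
      * apply Bd; [apply (Hsp n)|]. intros y. apply seq_poly_abs. intros j Hj. apply HB.
      * rewrite Rmult_1_l. apply HAB.
    + intros s Hs. rewrite E0. now apply H.
Qed.

(** * The monotone functional *)

Lemma polyval_derive (a : nat -> R) (m : nat) (x : R) :
  is_derive (polyval a (S m)) x (polyval (fun i => INR (S i) * a (S i)) m x).
Proof.
  unfold polyval. eapply is_derive_eq.
  - apply (der_sum (fun i x => a i * x ^ i) (fun i x => a i * (INR i * x ^ Init.Nat.pred i))).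
    intros i _. eapply is_derive_eq.
    + apply der_mult; [apply der_const|]. apply (is_derive_pow (fun x => x) i x 1), der_id.
    + to_R. ring.
  - to_R. rewrite decomp_sum by lia. cbn [Init.Nat.pred INR]. rewrite Rmult_0_l, Rmult_0_r, Rplus_0_l.
    apply sum_eq. intros i _. ring.
Qed.

(** Differentiation lowers the degree and multiplies the leading coefficient by a nonzero
    integer. *)
Lemma polyval_constant_on_interval (m : nat) : forall (a : nat -> R) (v lo hi : R),
  lo < hi -> (forall x, lo < x < hi -> polyval a (S m) x = v) -> a (S m) = 0.
Proof.
  induction m as [|m IH]; intros a v lo hi Hlh H.
  - assert (E := locally_constant_derive _ v _ lo hi ((lo + hi) / 2) H ltac:(lra) (polyval_derive a 0 _)).
    unfold polyval in E. cbn in E. lra.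
  - assert (E : forall x, lo < x < hi -> polyval (fun i => INR (S i) * a (S i)) (S m) x = 0).
    { intros x Hx. exact (locally_constant_derive _ v _ lo hi x H Hx (polyval_derive a (S m) x)). }
    specialize (IH _ 0 lo hi Hlh E). apply Rmult_integral in IH. destruct IH as [IH|IH]; [|exact IH].
    exfalso. revert IH. apply not_0_INR. lia.
Qed.

(** Provides barrier points as close to c as desired, on either side, where p differs from p(c). *)
Lemma polyval_leaves_level (a : nat -> R) (d : nat) (v lo hi : R) :
  (0 < d)%nat -> a d <> 0 -> lo < hi -> exists x, lo < x < hi /\ polyval a d x <> v.
Proof.
  intros Hd Ha Hlh. apply NNPP. intros Hn. apply Ha.
  destruct d as [|m]; [lia|]. apply (polyval_constant_on_interval m a v lo hi Hlh).
  intros x Hx. apply NNPP. intros Hx'. apply Hn. now exists x.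
Qed.

Lemma CT_comp (F : R -> R) (u : R -> R -> R) (M : R) : CT u -> (forall y, continuous F y) ->
  (forall x t, Rabs (u x t) <= M) -> CT (fun x t => F (u x t)).
Proof.
  intros [C H] CF HM. split.
  - intros t. apply (cper_comp F (fun x => u x t)); auto.
  - intros t0 eps He. destruct (uniformly_continuous_on_bounded F M eps CF He) as [d [Hd HF]].
    destruct (H t0 (d / 2) ltac:(lra)) as [d' [Hd' H']]. exists d'. split; [exact Hd'|].
    intros t Ht x. apply Rlt_le, HF; auto. specialize (H' t Ht x). lra.
Qed.

Lemma cube_le (x y : R) : 0 <= y -> x ^ 3 <= y ^ 3 -> x <= y.
Proof.
  intros Hy H. apply Rnot_lt_le. intros Hlt.
  assert (0 < (x - y) * (x ^ 2 + x * y + y ^ 2)).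
  { apply Rmult_lt_0_compat; nra. }
  nra.
Qed.

Lemma RInt_sq_mono (q : R -> R) (x0 x x1 : R) : (forall x, continuous q x) -> x0 <= x <= x1 ->
  0 <= RInt (fun x => q x ^ 2) x0 x <= RInt (fun x => q x ^ 2) x0 x1.
Proof.
  intros Cq Hx. rewrite (RInt_split (fun x => q x ^ 2) x0 x x1) by auto with cont.
  assert (Hn : forall a b, a <= b -> 0 <= RInt (fun x => q x ^ 2) a b).
  { intros a b Hab. apply RInt_nonneg; auto with cont. intros; apply pow2_ge_0. }
  pose proof (Hn x0 x). pose proof (Hn x x1). lra.
Qed.

Lemma poincare (q phi : R -> R) (x0 l : R) : 0 < l ->
  (forall x, continuous q x) -> (forall x, is_derive phi x (q x)) -> phi x0 = 0 ->
  forall x, x0 <= x <= x0 + l -> phi x ^ 2 <= l * RInt (fun x => q x ^ 2) x0 (x0 + l).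
Proof.
  intros Hl Cq D H0 x Hx.
  destruct (RInt_sq_mono q x0 x (x0 + l) Cq Hx) as [Hpos Hmono].
  destruct (Req_dec x x0) as [->|Hne].
  - rewrite H0. nra.
  (* [k] is the mean of [q] over [x0, x]; integrating the square of q - k gives the Cauchy-Schwarz
     inequality. *)
  - set (k := phi x / (x - x0)).
    assert (Hq : 0 <= RInt (fun y => q y ^ 2 + (- (2 * k) * q y + k ^ 2)) x0 x).
    { apply RInt_nonneg; [lra | auto 10 with cont|]. intros y _. pose proof (pow2_ge_0 (q y - k)). nra. }
    rewrite RInt_add, RInt_add, RInt_scale, RInt_const_R in Hq by auto 10 with cont.
    rewrite (RInt_antideriv phi q), H0 in Hq by auto.
    assert (E : - (2 * k) * (phi x - 0) + (x - x0) * k ^ 2 = - (phi x ^ 2 / (x - x0))).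
    { unfold k. field. lra. }
    rewrite E in Hq.
    assert (phi x ^ 2 <= (x - x0) * RInt (fun y => q y ^ 2) x0 x).
    { replace (phi x ^ 2) with ((x - x0) * (phi x ^ 2 / (x - x0))) by (field; lra).
      apply Rmult_le_compat_l; lra. }
    nra.
Qed.

(* The interval argument of the header, with p for f, P t = int phi_x^2 and w x = x0 + 1/2 - x. *)
Theorem spatial_continuation (a : nat -> R) (d : nat) (u : R -> R -> R) (M x0 c : R) :
  (0 < d)%nat -> a d <> 0 -> CT u -> 0 < M -> (forall x t, Rabs (u x t) <= M) ->
  (forall eps, 0 < eps -> exists d, 0 < d /\
    forall t x y, Rabs (x - y) < d -> Rabs (u x t - u y t) <= eps) ->
  (forall x t, is_derive (fun t => u x t) t (- helmholtz_dx (fun y => polyval a d (u y t)) x)) ->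
  (forall t, u x0 t = c /\ helmholtz (fun y => polyval a d (u y t)) x0 = polyval a d c) ->
  forall x t, x0 <= x <= x0 + / 2 ->
    u x t = c /\ helmholtz (fun y => polyval a d (u y t)) x = polyval a d c.
Proof.
  intros Hd Ha Hu HM HuM Heq Hder Hbase.
  set (p := polyval a d) in *.
  assert (Cp : forall y, continuous p y) by (intros; apply polyval_cont).
  assert (Hpu : CT (fun x t => p (u x t))) by now apply CT_polyval.
  set (phi := fun x t => helmholtz (fun y => p (u y t)) x - p c).
  set (q := fun x t => helmholtz_dx (fun y => p (u y t)) x) in *.
  set (g := fun y => p y - p c).
  assert (Cg : forall y, continuous g y) by (intros; unfold g; auto with cont).
  assert (Cu : forall t x, continuous (fun x => u x t) x) by (intros; now apply CT_cont_x).
  assert (Cgu : forall t x, continuous (fun x => g (u x t)) x) by (intros; apply cont_comp; auto).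
  assert (Dphi : forall t x, is_derive (fun x => phi x t) x (q x t)).
  { intros t x. unfold phi. eapply is_derive_eq.
    - apply der_minus; [apply (helmholtz_derive (fun y => p (u y t)) x), Hpu | apply der_const].
    - unfold q. rring. }
  assert (Dq : forall t x, is_derive (fun x => q x t) x (phi x t - g (u x t))).
  { intros t x. unfold q. eapply is_derive_eq.
    - apply (helmholtz_dx_derive (fun y => p (u y t)) x), Hpu.
    - unfold phi, g. rring. }
  assert (Cphi : forall t x, continuous (fun x => phi x t) x) by (intros; eapply derive_cont, Dphi).
  assert (Cq : forall t x, continuous (fun x => q x t) x) by (intros; eapply derive_cont, Dq).
  assert (phi0 : forall t, phi x0 t = 0).
  { intros t. unfold phi. rewrite (proj2 (Hbase t)). ring. }
  (* [u x0 t] is constant in time and its derivative is [- q x0 t]. *)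
  assert (q0 : forall t, q x0 t = 0).
  { intros t. pose proof (locally_constant_derive (fun t => u x0 t) c _ (t - 1) (t + 1) t
      (fun s _ => proj1 (Hbase s)) ltac:(lra) (Hder x0 t)) as E. unfold q. lra. }
  destruct (continuous_bounded_on_bounded p M Cp (Rlt_le _ _ HM)) as [Kp [HKp HpK]].
  assert (Hqb : forall x t, Rabs (phi x t - g (u x t)) <= 2 * Kp).
  { intros x t. unfold phi, g.
    destruct (bounded_linear_helmholtz x) as [_ [_ B]].
    specialize (B (fun y => p (u y t)) Kp (proj1 Hpu t) ltac:(intros; now apply HpK)).
    specialize (HpK (u x t) (HuM x t)).
    replace (helmholtz (fun y => p (u y t)) x - p c - (p (u x t) - p c))
      with (helmholtz (fun y => p (u y t)) x + - p (u x t)) by ring.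
    eapply Rle_trans; [apply Rabs_triang|]. rewrite Rabs_Ropp. lra. }
  set (x1 := x0 + / 2).
  set (P := fun t => RInt (fun x => q x t ^ 2) x0 x1).
  assert (Hphi : forall t x, x0 <= x <= x1 -> phi x t ^ 2 <= / 2 * P t).
  { intros t. apply (poincare (fun x => q x t) (fun x => phi x t) x0 (/ 2)); auto. lra. }
  assert (P0 : forall t, 0 <= P t).
  { intros t. apply (RInt_sq_mono (fun x => q x t) x0 x1 x1); auto. unfold x1. lra. }
  (* Interpolation between the L^2 norm and the Lipschitz constant [2 * Kp] of q: integrate (q^3)_x
     = 3 q^2 q_x from x0, where q vanishes. *)
  assert (Hq3 : forall t x, x0 <= x <= x1 -> Rabs (q x t) ^ 3 <= 6 * Kp * P t).
  { intros t x Hx.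
    assert (E : RInt (fun x => 3 * q x t ^ 2 * (phi x t - g (u x t))) x0 x = q x t ^ 3).
    { rewrite (RInt_antideriv (fun x => q x t ^ 3)).
      - rewrite q0. rring.
      - intros y. eapply is_derive_eq; [apply (is_derive_pow (fun x => q x t) 3 y), Dq|].
        to_R. simpl. ring.
      - intros; auto 10 with cont. }
    rewrite RPow_abs, <- E.
    eapply Rle_trans; [apply abs_RInt_le; [lra | apply ex_RInt_cont; auto 10 with cont]|].
    apply Rle_trans with (RInt (fun x => 6 * Kp * q x t ^ 2) x0 x).
    - apply RInt_mono; auto 10 with cont; [lra|]. intros y _.
      rewrite Rabs_mult, (Rabs_pos_eq (3 * q y t ^ 2)) by (pose proof (pow2_ge_0 (q y t)); lra).
      specialize (Hqb y t). pose proof (pow2_ge_0 (q y t)). nra.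
    - rewrite RInt_scale by auto with cont. apply Rmult_le_compat_l; [lra|].
      now apply (RInt_sq_mono (fun x => q x t)). }
  (* At distance [h] the mean value theorem gives a point z with q_x = phi - g(u) equal to a
     difference quotient of q, hence small; phi is small there too, so g(u) is small at z, and
     equicontinuity carries this to x. *)
  assert (Hg_small : forall eta, 0 < eta -> exists del, 0 < del /\
    forall t, P t < del -> forall x, x0 <= x <= x1 -> Rabs (g (u x t)) < eta).
  { intros eta Heta.
    destruct (uniformly_continuous_on_bounded g M (eta / 4) Cg ltac:(lra)) as [r [Hr Hgr]].
    destruct (Heq (r / 2) ltac:(lra)) as [h1 [Hh1 Hu1]].
    (* A step of at most half the interval length can be taken to the right or to the left of x
       without leaving the interval. *)
    set (h := Rmin (h1 / 2) (/ 4)).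
    assert (Hh : 0 < h /\ h < h1 /\ h <= / 4).
    { unfold h. pose proof (Rmin_l (h1 / 2) (/ 4)). pose proof (Rmin_r (h1 / 2) (/ 4)).
      split; [apply Rmin_glb_lt|]; lra. }
    assert (He8 : 0 < (eta * h / 8) ^ 3) by (apply pow_lt; nra).
    (* Through [Hphi] and [Hq3] the two entries yield |phi| <= eta / 4 and |q| <= eta h / 8; the
       latter bounds the difference quotient of q by eta / 4. *)
    set (del := Rmin (2 * (eta / 4) ^ 2) ((eta * h / 8) ^ 3 / (6 * Kp))).
    assert (Hdel : 0 < del).
    { apply Rmin_glb_lt; [nra | apply Rdiv_lt_0_compat; lra]. }
    exists del. split; [exact Hdel|]. intros t Ht.
    assert (Hphis : forall x, x0 <= x <= x1 -> Rabs (phi x t) <= eta / 4).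
    { intros x Hx. specialize (Hphi t x Hx).
      assert (del <= 2 * (eta / 4) ^ 2) by apply Rmin_l.
      apply Rsqr_incr_0_var; [|lra]. rewrite <- Rsqr_abs. unfold Rsqr. nra. }
    assert (Hqs : forall x, x0 <= x <= x1 -> Rabs (q x t) <= eta * h / 8).
    { intros x Hx. specialize (Hq3 t x Hx).
      assert (Hdr : del <= (eta * h / 8) ^ 3 / (6 * Kp)) by apply Rmin_r.
      apply cube_le; [nra|]. eapply Rle_trans; [exact Hq3|].
      replace ((eta * h / 8) ^ 3) with (6 * Kp * ((eta * h / 8) ^ 3 / (6 * Kp))) by (field; lra).
      apply Rmult_le_compat_l; lra. }
    intros x Hx.
    assert (Hy : exists y, x0 <= y <= x1 /\ Rabs (y - x) = h).
    { destruct (Rle_dec x (x0 + / 4)).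
      - exists (x + h). unfold x1 in *. split; [lra|]. replace (x + h - x) with h by ring. apply Rabs_pos_eq; lra.
      - exists (x - h). unfold x1 in *. split; [lra|]. replace (x - h - x) with (- h) by ring.
        rewrite Rabs_Ropp. apply Rabs_pos_eq; lra. }
    destruct Hy as [y [Hy Hyx]].
    destruct (MVT_is_derive (fun x => q x t) (fun x => phi x t - g (u x t)) x y (fun z _ => Dq t z)) as [z [Hz Ez]].
    assert (Hzx : x0 <= z <= x1 /\ Rabs (z - x) <= h).
    { rewrite <- Hyx. unfold Rmin, Rmax in Hz. destruct (Rle_dec x y);
        split; try lra; unfold Rabs; repeat destruct Rcase_abs; lra. }
    destruct Hzx as [Hz1 Hz2].
    pose proof (Hqs x Hx) as A1. pose proof (Hqs y Hy) as A2. pose proof (Hphis z Hz1) as A3.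
    assert (A4 : Rabs (phi z t - g (u z t)) <= eta / 4).
    { apply Rmult_le_reg_r with h; [lra|]. rewrite <- Hyx at 1. rewrite <- Rabs_mult, <- Ez.
      unfold Rminus. eapply Rle_trans; [apply Rabs_triang|]. rewrite Rabs_Ropp. lra. }
    assert (A5 : Rabs (g (u x t) - g (u z t)) < eta / 4).
    { apply Hgr; auto. assert (Rabs (u x t - u z t) <= r / 2); [|lra].
      apply Hu1. rewrite Rabs_minus_sym. lra. }
    replace (g (u x t)) with ((g (u x t) - g (u z t)) + (phi z t + - (phi z t - g (u z t)))) by ring.
    eapply Rle_lt_trans; [apply Rabs_triang|].
    apply Rle_lt_trans with (Rabs (g (u x t) - g (u z t)) + (Rabs (phi z t) + Rabs (phi z t - g (u z t)))); [|lra].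
    apply Rplus_le_compat_l. eapply Rle_trans; [apply Rabs_triang|]. rewrite Rabs_Ropp. lra. }
  (* The barriers [e1] and [e2] enclose c within eps and satisfy |g| >= eta there. While |g(u)| <
     eta, the continuous profile of u starts at c and cannot cross either of them. *)
  assert (Hu_small : forall eps, 0 < eps -> exists del, 0 < del /\
    forall t, P t < del -> forall x, x0 <= x <= x1 -> Rabs (u x t - c) <= eps).
  { intros eps Heps.
    destruct (polyval_leaves_level a d (p c) c (c + eps) Hd Ha ltac:(lra)) as [e1 [He1 Hp1]].
    destruct (polyval_leaves_level a d (p c) (c - eps) c Hd Ha ltac:(lra)) as [e2 [He2 Hp2]].
    fold p in Hp1, Hp2.
    set (eta := Rmin (Rabs (g e1)) (Rabs (g e2))).
    assert (Heta : 0 < eta) by (apply Rmin_glb_lt; apply Rabs_pos_lt; unfold g; lra).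
    destruct (Hg_small eta Heta) as [del [Hdel Hg]].
    exists del. split; [exact Hdel|]. intros t Ht x Hx. specialize (Hg t Ht).
    assert (Hcont : continuity (fun x => u x t)) by (intros y; apply continuity_pt_filterlim, Cu).
    assert (Hbar : forall e, Rabs (g e) >= eta -> ~ (Rmin (u x0 t) (u x t) <= e <= Rmax (u x0 t) (u x t))).
    { intros e He Hb. destruct (IVT_gen (fun x => u x t) x0 x e Hcont Hb) as [y [Hy Ey]].
      rewrite Rmin_left, Rmax_right in Hy by lra. specialize (Hg y ltac:(lra)). rewrite Ey in Hg. lra. }
    rewrite (proj1 (Hbase t)) in Hbar.
    assert (B1 := Hbar e1 (Rle_ge _ _ (Rmin_l _ _))). assert (B2 := Hbar e2 (Rle_ge _ _ (Rmin_r _ _))).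
    unfold Rmin, Rmax in B1, B2. destruct (Rle_dec c (u x t)); apply Rabs_le; lra. }
  set (G := fun y => RInt g c y).
  assert (DG : forall y, is_derive G y (g y)) by (intros; now apply der_RInt).
  assert (CG : forall y, continuous G y) by (intros; eapply derive_cont, DG).
  assert (Gc : G c = 0) by apply RInt_same.
  set (w := fun x => x1 - x).
  assert (Cw : forall x, continuous w x) by (intros; unfold w; auto with cont).
  set (E := fun t => RInt (fun x => G (u x t) * w x) x0 x1).
  assert (HGu : CT (fun x t => G (u x t))) by now apply (CT_comp G u M).
  assert (CGu : forall t x, continuous (fun x => G (u x t)) x) by (intros; apply cont_comp; auto).
  destruct (bounded_linear_weighted_RInt w x0 x1) as [kappa HBL]; [unfold x1; lra | exact Cw |].
  assert (DE : forall t, is_derive E t (RInt (fun x => g (u x t) * (-1 * q x t) * w x) x0 x1)).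
  { apply (bounded_linear_derive kappa _ (fun x t => G (u x t)) (fun x t => g (u x t) * (-1 * q x t)) HBL HGu).
    - apply CT_mult; [apply CT_minus; [exact Hpu | apply CT_const]|].
      apply CT_scal. now apply (CT_helmholtz_dx (fun x t => p (u x t))).
    - intros x t. eapply is_derive_eq; [apply (der_comp (fun t => u x t) G t); [apply Hder | apply DG]|].
      fold (q x t). rring. }
  assert (DE_ge : forall t, 3 / 8 * P t <= RInt (fun x => g (u x t) * (-1 * q x t) * w x) x0 x1).
  { intros t.
    assert (Hx01 : x0 <= x1) by (unfold x1; lra).
    (* The integrand is the x-derivative of w (q^2 - phi^2) / 2, since q_x = phi - g(u) and w' = -1.
       At x1 the weight vanishes, at x0 both q and phi do. *)
    assert (E0 : RInt (fun x => g (u x t) * (-1 * q x t) * w x - / 2 * (q x t ^ 2 - phi x t ^ 2)) x0 x1 = 0).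
    { rewrite (RInt_antideriv (fun x => w x * (/ 2 * (q x t ^ 2 - phi x t ^ 2)))).
      - rewrite q0, phi0. unfold w. rring.
      - intros x. eapply is_derive_eq.
        + apply der_mult; [unfold w; apply der_minus; [apply der_const | apply der_id]|].
          apply der_mult; [apply der_const|]. apply der_minus.
          * apply (is_derive_pow (fun x => q x t) 2 x), Dq.
          * apply (is_derive_pow (fun x => phi x t) 2 x), Dphi.
        + to_R. simpl. field.
      - intros; auto 12 with cont. }
    rewrite RInt_sub in E0 by auto 12 with cont.
    rewrite RInt_scale in E0 by auto 12 with cont.
    rewrite (RInt_sub (fun x => q x t ^ 2)) in E0 by auto 12 with cont. fold (P t) in E0.
    (* Pointwise phi^2 <= P / 2 on an interval of length 1/2; then (1 - 1/4) / 2 = 3/8. *)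
    assert (RInt (fun x => phi x t ^ 2) x0 x1 <= / 4 * P t); [|lra].
    apply Rle_trans with (RInt (fun _ => / 2 * P t) x0 x1).
    - apply RInt_mono; auto with cont.
    - rewrite RInt_const_R. unfold x1. lra. }
  assert (Emono : forall s t, s <= t -> E s <= E t).
  { intros s t Hst. apply (derive_nonneg_le E _ s t Hst (fun r _ => DE r)).
    intros r _. eapply Rle_trans; [|apply DE_ge]. specialize (P0 r). lra. }
  destruct (continuous_bounded_on_bounded G M CG (Rlt_le _ _ HM)) as [KG [HKG HGK]].
  set (KE := kappa * KG).
  assert (HEb : forall t, Rabs (E t) <= KE).
  { intros t. destruct HBL as [_ [_ B]]. apply (B (fun x => G (u x t))); [apply HGu|].
    intros x. now apply HGK. }
  assert (HKE : 0 <= KE) by (eapply Rle_trans; [apply Rabs_pos | apply (HEb 0)]).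
  (* If P stayed above [del] on such a window, E would grow by at least [2 * KE + 1], more than its
     range [-KE, KE] allows. *)
  assert (Hlong : forall del s, 0 < del -> exists t, s <= t <= s + (2 * KE + 1) / (3 / 8 * del) /\ P t < del).
  { intros del s Hdel. apply NNPP. intros Hn.
    set (L := (2 * KE + 1) / (3 / 8 * del)) in *.
    assert (HL : 0 < L) by (apply Rdiv_lt_0_compat; lra).
    destruct (MVT_is_derive E _ s (s + L) (fun r _ => DE r)) as [r [Hr Er]].
    rewrite Rmin_left, Rmax_right in Hr by lra.
    assert (HPr : del <= P r).
    { apply Rnot_lt_le. intros Hlt. apply Hn. now exists r. }
    specialize (DE_ge r). pose proof (HEb s) as B1. pose proof (HEb (s + L)) as B2.
    apply Rabs_le_between in B1. apply Rabs_le_between in B2.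
    replace (s + L - s) with L in Er by ring.
    assert (3 / 8 * del * L = 2 * KE + 1) by (unfold L; field; lra).
    assert (3 / 8 * del * L <= RInt (fun x => g (u x r) * (-1 * q x r) * w x) x0 x1 * L)
      by (apply Rmult_le_compat_r; lra).
    lra. }
  assert (HE_small : forall e, 0 < e -> exists del, 0 < del /\ forall t, P t < del -> Rabs (E t) <= e).
  { intros e He. destruct (eps_continuous G c e (CG c) He) as [eps [Heps HG]].
    destruct (Hu_small (eps / 2) ltac:(lra)) as [del [Hdel Hs]].
    exists del. split; [exact Hdel|]. intros t Ht. specialize (Hs t Ht).
    apply Rle_trans with ((x1 - x0) * (e * / 2)).
    - apply RInt_abs_le; [unfold x1; lra | auto with cont|]. intros x Hx. rewrite Rabs_mult.
      apply Rmult_le_compat; try apply Rabs_pos.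
      + specialize (Hs x Hx). specialize (HG (u x t) ltac:(lra)). rewrite Gc, Rminus_0_r in HG. lra.
      + unfold w, x1 in *. rewrite Rabs_pos_eq; lra.
    - unfold x1. lra. }
  assert (E0 : forall t, E t = 0).
  { intros t. apply cond_eq. intros e He. rewrite Rminus_0_r.
    destruct (HE_small (e / 2) ltac:(lra)) as [del [Hdel Hs]].
    destruct (Hlong del t Hdel) as [t2 [Ht2 HP2]].
    destruct (Hlong del (t - (2 * KE + 1) / (3 / 8 * del)) Hdel) as [t1 [Ht1 HP1]].
    pose proof (Emono t t2 ltac:(lra)). pose proof (Emono t1 t ltac:(lra)).
    pose proof (Hs t1 HP1) as B1. pose proof (Hs t2 HP2) as B2.
    apply Rabs_le_between in B1. apply Rabs_le_between in B2. apply Rabs_def1; lra. }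
  assert (PZ : forall t, P t = 0).
  { intros t. assert (Z : RInt (fun x => g (u x t) * (-1 * q x t) * w x) x0 x1 = 0).
    { eapply eq_trans; [symmetry; apply (is_derive_unique _ _ _ (DE t))|].
      apply is_derive_unique. apply (is_derive_ext (fun _ => 0)); [|apply der_const].
      intros s. symmetry. apply E0. }
    specialize (DE_ge t). specialize (P0 t). lra. }
  intros x t Hx. split.
  - apply cond_eq. intros e He. destruct (Hu_small (e / 2) ltac:(lra)) as [del [Hdel Hs]].
    specialize (Hs t ltac:(rewrite PZ; lra) x Hx). lra.
  - specialize (Hphi t x Hx). rewrite PZ in Hphi. unfold phi in Hphi.
    assert (helmholtz (fun y => p (u y t)) x - p c = 0) by nra. lra.
Qed.

Theorem mainTheorem9 (f : R -> R) (u : R -> R -> R)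
  (hf : nonconstant_polynomial f)
  (hu : continuous_in_H1 u)
  (hsol : distributional_solution f u) :
  let psi := fun x t => helmholtz_inv (fun y => f (u y t)) x in
  (forall (omega : R -> Prop) (c T : R),
      open omega -> periodic_set omega -> (exists x, omega x) -> 0 < T ->
      (forall x t, omega x -> 0 < t < T -> u x t = c) ->
      forall x t, u x t = c)
  /\
  (forall x0 c T : R,
      0 < T ->
      (forall t, 0 < t < T -> u x0 t = c /\ psi x0 t = f c) ->
      forall x t, u x t = c).
Proof.
  intros psi.
  destruct hf as [d [a [Hd [Ha Hf]]]].
  assert (Ef : f = polyval a d) by (apply functional_extensionality; exact Hf).
  clear Hf. subst f.
  set (p := polyval a d) in *.
  assert (Cp : forall y, continuous p y) by (intros; apply polyval_cont).
  pose proof (continuous_in_H1_CT u hu) as HCT.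
  assert (Hpu : CT (fun x t => p (u x t))) by now apply CT_polyval.
  pose proof (solution_time_derivative p u HCT Hpu hsol) as Hder.
  destruct (solution_bounded p u hu Cp Hpu hsol) as [M [HM HuM]].
  pose proof (solution_equicontinuous p u hu Cp Hpu hsol) as Heq.
  assert (Epsi : forall x t, psi x t = helmholtz (fun y => p (u y t)) x).
  { intros x t. apply helmholtz_inv_eq, (proj1 Hpu t). }
  assert (Main : forall x0 c T, 0 < T ->
      (forall t, 0 < t < T -> u x0 t = c /\ psi x0 t = p c) -> forall x t, u x t = c).
  { intros x0 c T HT H.
    assert (H0 : forall t, u x0 t = c /\ helmholtz (fun y => p (u y t)) x0 = p c).
    { apply (time_unique_continuation a d u M x0 c T HCT HM HuM Hder HT).
      intros t Ht. rewrite <- Epsi. now apply H. }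
    assert (Hk : forall k x t, x0 <= x <= x0 + INR k * / 2 ->
        u x t = c /\ helmholtz (fun y => p (u y t)) x = p c).
    { induction k as [|k IH]; intros x t Hx.
      - cbn [INR] in Hx. replace x with x0 by lra. apply H0.
      - rewrite S_INR in Hx. pose proof (pos_INR k).
        destruct (Rle_dec x (x0 + INR k * / 2)); [apply IH; lra|].
        apply (spatial_continuation a d u M (x0 + INR k * / 2) c Hd Ha HCT HM HuM Heq Hder); [|lra].
        intros s. apply IH. lra. }
    (* Each step covers length 1/2, so more than [4 * PI] steps cover a full period. *)
    intros x t. destruct (INR_unbounded (4 * PI)) as [k HkPI].
    destruct (period_representative x0 x) as [m [y [Hy ->]]].
    destruct (proj1 HCT t) as [Pu _]. rewrite (periodic_Z (fun x => u x t) Pu).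
    apply (Hk k). lra. }
  split; [|exact Main].
  intros omega c T Hopen _ [x0 Hx0] HT H. apply (Main x0 c T HT).
  intros t Ht. split; [now apply H|]. rewrite Epsi.
  destruct (Hopen x0 Hx0) as [e He].
  assert (Hdx : forall x, omega x -> helmholtz_dx (fun y => p (u y t)) x = 0).
  { intros x Hx.
    pose proof (locally_constant_derive (fun t => u x t) c _ 0 T t (fun s => H x s Hx) Ht (Hder x t)). lra. }
  assert (E : helmholtz (fun y => p (u y t)) x0 - p (u x0 t) = 0).
  { rewrite <- (is_derive_unique _ _ _ (helmholtz_dx_derive _ x0 (proj1 Hpu t))).
    apply is_derive_unique. apply (is_derive_ext_loc (fun _ => 0)); [|apply der_const].
    exists e. intros y Hy. symmetry. apply Hdx. now apply He. }
  rewrite (H x0 t Hx0 Ht) in E. lra.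
Qed.
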